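(* Let $(X,d,\mu)$ be a complete unbounded metric space with $\mu$ Ahlfors $Q$-regular, $Q>1$. Let $1<p<Q/(2-Q)$ if $1<Q<2$, and $p>Q/2$ if $Q\ge 2$. Suppose that $(X,d,\mu)$ supports a $q$-Poincaré inequality, where $q=p$ if $Q/2<p\le Q$ and $q=pQ/(2p-Q)$ if $p\ge Q$. Let $(\hat X,\hat d)$ be the sphericalization of $(X,d)$ with respect to a base point $a\in X$, equipped with the measure $\hat\mu(A)=\int_{A\setminus\{\infty\}}(1+d(x,a))^{-2p}\,d\mu(x)$. Then $(\hat X,\hat d,\hat\mu)$ supports a $p$-Poincaré inequality and $\hat\mu$ is doubling on $(\hat X,\hat d)$.
   Context: $\mu$ is a positive complete Borel measure with $0<\mu(B)<\infty$ for all balls $B=B(x,r)=\{y:d(x,y)<r\}$; $\lambda B=B(x,\lambda r)$. Ahlfors $Q$-regular: there is $C\ge1$ with $C^{-1}r^Q\le\mu(B(x,r))\le Cr^Q$ for all $x\in X$, $r>0$. A measure $\nu$ is doubling if there is $C>0$ with $0<\nu(2B)\le C\nu(B)<\infty$ for all balls $B$. Curves are nonconstant, compact and rectifiable, parameterized by arc length $ds$. A Borel function $g:X\to[0,\infty]$ is an upper gradient of $u:X\to[-\infty,\infty]$ if $|u(\gamma(0))-u(\gamma(l_\gamma))|\le\int_\gamma g\,ds$ for all curves $\gamma:[0,l_\gamma]\to X$ (left-hand side is $\infty$ if a term is infinite). $X$ supports a $q$-Poincaré inequality if there are $C>0$, $\lambda\ge1$ such that for all balls $B$, all integrable $u$ and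 all upper gradients $g$ of $u$, $\frac1{\mu(B)}\int_B|u-u_B|\,d\mu\le C\,\mathrm{diam}(B)\bigl(\frac1{\mu(\lambda B)}\int_{\lambda B}g^q\,d\mu\bigr)^{1/q}$, $u_B=\frac1{\mu(B)}\int_Bu\,d\mu$; similarly for $(\hat X,\hat d,\hat\mu)$. Sphericalization: $\hat X=X\cup\{\infty\}$ is the one-point compactification of $X$. Define $d_a(x,y)=\frac{d(x,y)}{(1+d(x,a))(1+d(y,a))}$ for $x,y\in X$, $d_a(x,\infty)=d_a(\infty,x)=\frac1{1+d(x,a)}$ for $x\in X$, $d_a(\infty,\infty)=0$, and $\hat d(x,y)=\inf\sum_{j=1}^kd_a(x_j,x_{j-1})$, infimum over all finite sequences $x=x_0,x_1,\dots,x_k=y$ in $\hat X$. Then $\hat d$ is a metric on $\hat X$, and $(\hat X,\hat d)$ is the sphericalization of $(X,d)$. *)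

(* Defs.v *)
From HB Require Import structures.
From mathcomp Require Import all_boot all_order all_algebra.
From mathcomp Require Import all_classical all_reals all_analysis.
From mathcomp Require Import measurable_realfun.
From mathcomp Require Import ring lra.

Set Implicit Arguments.
Unset Strict Implicit.
Unset Printing Implicit Defensive.

Import Order.TTheory GRing.Theory Num.Theory.
Import numFieldNormedType.Exports.

Local Open Scope classical_set_scope.
Local Open Scope ring_scope.

HB.mixin Record Metric_Measurable_isBorel (d : measure_display)
    (R : numDomainType) T & Metric R T & Measurable d T := {
  open_measurable : forall U : set T, open U -> measurable U }.

#[short(type="borelMetricType")]
HB.structure Definition BorelMetric (d : measure_display) (R : numDomainType) :=
  {T of Metric R T & Measurable d T & Metric_Measurable_isBorel d R T}.

Section metric_measure_notions.
Context (d : measure_display) (R : realType) (X : borelMetricType d R).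

Local Notation borel_space := (g_sigma_algebraType (@open X)).

(* The domain of mu is the completion of the Borel sigma-algebra. *)
Definition complete_borel (mu : set X -> \bar R) : Prop :=
  @measurable d X = completed_algebra_gen (mu : set borel_space -> \bar R).

Definition ahlfors_regular (mu : set X -> \bar R) (Q : R) : Prop :=
  exists2 C : R, 1 <= C & forall (x : X) (r : R), 0 < r ->
    ((C^-1 * r `^ Q)%:E <= mu (ball x r) <= (C * r `^ Q)%:E)%E.

Definition doubling_measure (mu : set X -> \bar R) : Prop :=
  exists2 C : R, 0 < C & forall (x : X) (r : R), 0 < r ->
    [/\ (0 < mu (ball x (2 * r)))%E,
        (mu (ball x (2 * r)) <= C%:E * mu (ball x r))%E
      & (C%:E * mu (ball x r) < +oo)%E].

Definition curve_length (gamma : R -> X) (s t : R) : \bar R :=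
  ereal_sup [set (\sum_(r <- pairmap
      (fun u v => mdist (gamma u) (gamma v)) s l) r)%:E | l in itv_partition s t].

(* Only the values of gamma on `[0, l] matter; such a curve has length l, so it *)
(* is rectifiable, and nonconstant since 0 < l.                                 *)
Definition arc_length_curve (l : R) (gamma : R -> X) : Prop :=
  [/\ 0 < l, {within `[0, l], continuous gamma} &
      forall t, 0 <= t <= l -> curve_length gamma 0 t = t%:E].

(* When u (gamma 0) or u (gamma l) is infinite the left-hand side is +oo, since *)
(* +oo - +oo and -oo - -oo are both -oo in \bar R, of absolute value +oo.       *)
Definition upper_gradient (g u : X -> \bar R) : Prop :=
  [/\ measurable_fun [set: borel_space] (g : borel_space -> \bar R),
      forall x, (0 <= g x)%E &
      forall (l : R) (gamma : R -> X), arc_length_curve l gamma ->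
        (`|u (gamma 0%R) - u (gamma l)| <=
         \int[lebesgue_measure]_(t in `[0%R, l]) g (gamma t))%E].

Definition mean (mu : set X -> \bar R) (A : set X) (f : X -> \bar R) : \bar R :=
  ((\int[mu]_(x in A) f x) / mu A)%E.

Definition diameter (A : set X) : \bar R :=
  ereal_sup [set (mdist z.1 z.2)%:E | z in A `*` A].

Definition poincare_inequality (mu : set X -> \bar R) (q : R) : Prop :=
  exists C lambda : R, [/\ 0 < C, 1 <= lambda &
    forall (x : X) (r : R) (u g : X -> \bar R), 0 < r ->
      mu.-integrable [set: X] u -> upper_gradient g u ->
      let B := ball x r in
      (mean mu B (fun y => `|u y - mean mu B u|) <=
       C%:E * diameter B *
         (mean mu (ball x (lambda * r)%R) (fun y => g y `^ q)) `^ (q^-1))%E].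

End metric_measure_notions.

(* X together with the point at infinity None; an alias, so that it carries the *)
(* metric below and not the topology of one_point_compactification X.           *)
Definition sphericalization (d : measure_display) (R : realType)
  (X : borelMetricType d R) (a : X) : Type := one_point_compactification X.

Section sphericalization_metric.
Context (d : measure_display) (R : realType) (X : borelMetricType d R) (a : X).
Local Notation hX := (sphericalization a).

HB.instance Definition _ := Choice.on hX.
HB.instance Definition _ := Pointed.on hX.

Definition sph_da (x y : hX) : R :=
  match x, y with
  | Some x, Some y => mdist x y / ((1 + mdist x a) * (1 + mdist y a))
  | Some x, None => (1 + mdist x a)^-1
  | None, Some y => (1 + mdist y a)^-1
  | None, None => 0
  end.

Definition sph_chain_length (x : hX) (s : seq hX) : R :=
  \sum_(r <- pairmap sph_da x s) r.

(* The chain x = x_0, ..., x_k = y is given by x and s = [:: x_1; ...; x_k].      *)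
Definition sph_dist (x y : hX) : R :=
  inf [set sph_chain_length x s | s in [set s | last x s = y]].

Let h (x : hX) : R := if x is Some x' then (1 + mdist x' a)^-1 else 0.

Let onepd (x : X) : 0 < 1 + mdist x a.
Proof. by rewrite ltr_pwDl// mdist_ge0. Qed.

Let h_gt0 (x : X) : 0 < h (Some x).
Proof. by rewrite /= invr_gt0. Qed.

Let da_SomeE (x y : X) : sph_da (Some x) (Some y) =
  mdist x y * h (Some x) * h (Some y).
Proof. by rewrite /= invfM mulrA. Qed.

Let da_ge0 x y : 0 <= sph_da x y.
Proof.
case: x y => [x|] [y|] //=; rewrite ?invr_ge0 ?(ltW (onepd _))//.
by rewrite divr_ge0 ?mdist_ge0// mulr_ge0// ltW.
Qed.

Let da_sym x y : sph_da x y = sph_da y x.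
Proof.
case: x y => [x|] [y|] //=.
by rewrite metric_sym mulrC [in RHS]mulrC (mulrC (1 + _)).
Qed.

Let daxx x : sph_da x x = 0.
Proof. by case: x => [x|]//=; rewrite mdistxx mul0r. Qed.

Let h_da x y : h x - h y <= sph_da x y.
Proof.
case: x y => [x|] [y|]; rewrite ?subr0 ?subrr//.
- rewrite da_SomeE /= -subr_ge0.
  have xa := onepd x; have ya := onepd y.
  rewrite [X in 0 <= X](_ : _ = (mdist x y - mdist y a + mdist x a) *
     (1 + mdist x a)^-1 * (1 + mdist y a)^-1); last first.
    by field; rewrite !gt_eqF.
  rewrite mulr_ge0 ?invr_ge0 ?(ltW ya)// mulr_ge0 ?invr_ge0 ?(ltW xa)//.
  have := metric_triangle y x a; rewrite (metric_sym y x); lra.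
- by rewrite /= sub0r (@le_trans _ _ 0)// ?oppr_le0 invr_ge0 ltW.
Qed.

Let len_ge0 x s : 0 <= sph_chain_length x s.
Proof.
elim: s x => [|y s ih] x; first by rewrite /sph_chain_length big_nil.
by rewrite /sph_chain_length/= big_cons addr_ge0// ih.
Qed.

Let len_cons x y s :
  sph_chain_length x (y :: s) = sph_da x y + sph_chain_length y s.
Proof. by rewrite /sph_chain_length/= big_cons. Qed.

Let len_cat x s t : sph_chain_length x (s ++ t) =
  sph_chain_length x s + sph_chain_length (last x s) t.
Proof.
by rewrite /sph_chain_length pairmap_cat big_cat.
Qed.

Let len_rev x s : sph_chain_length (last x s) (rev (belast x s)) =
  sph_chain_length x s.
Proof.
elim: s x => [//|y s ih] x /=.
rewrite rev_cons -cats1 len_cat ih [RHS]len_cons addrC; congr (_ + _).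
have -> : last (last y s) (rev (belast y s)) = y.
  by case: s {ih} => [//|z s] /=; rewrite rev_cons last_rcons.
by rewrite len_cons /sph_chain_length big_nil addr0 da_sym.
Qed.

Let last_rev x (s : seq hX) : last (last x s) (rev (belast x s)) = x.
Proof. by case: s => [//|z s] /=; rewrite rev_cons last_rcons. Qed.

Let dist_lb x y s : last x s = y -> sph_dist x y <= sph_chain_length x s.
Proof.
move=> xsy; apply: inf_lbound; last by exists s.
by exists 0 => _ [t _ <-].
Qed.

Let dist_glb x y c : (forall s, last x s = y -> c <= sph_chain_length x s) ->
  c <= sph_dist x y.
Proof.
move=> H; apply: lb_le_inf; last by move=> _ [s /H ? <-].
by exists (sph_chain_length x [:: y]), [:: y].
Qed.

Let dist_ge0 x y : 0 <= sph_dist x y.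
Proof. by apply: dist_glb. Qed.

Let distxx x : sph_dist x x = 0.
Proof.
apply/le_anti/andP; split => //.
have := @dist_lb x x [::] erefl.
by rewrite /sph_chain_length big_nil.
Qed.

Let dist_sym_le x y : sph_dist x y <= sph_dist y x.
Proof.
apply: dist_glb => s <-; rewrite -(len_rev y s).
by apply: dist_lb; exact: last_rev.
Qed.

Let dist_sym x y : sph_dist x y = sph_dist y x.
Proof. by apply/le_anti; rewrite !dist_sym_le. Qed.

Let dist_triangle y x z : sph_dist x z <= sph_dist x y + sph_dist y z.
Proof.
rewrite -lerBlDr; apply: dist_glb => s sy.
rewrite lerBlDr -lerBlDl; apply: dist_glb => t tz.
rewrite lerBlDl -{1}sy -len_cat; apply: dist_lb.
by rewrite last_cat sy.
Qed.

Let h_len x s z : z \in x :: s -> h x - h z <= sph_chain_length x s.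
Proof.
elim: s x => [|y s ih] x.
  by rewrite inE => /eqP ->; rewrite subrr.
rewrite in_cons => /predU1P[->|/ih {}ih]; first by rewrite subrr.
rewrite len_cons; have := h_da x y; lra.
Qed.

Let far_len (c : R) x s : 0 < c -> (forall z, z \in x :: s -> c <= h z) ->
  exists x0 y0, [/\ x = Some x0, last x s = Some y0 &
    mdist x0 y0 * (c * c) <= sph_chain_length x s].
Proof.
move=> c0; elim: s x => [|y s ih] x H.
  have := H x (mem_head _ _); case: x H => [x|] _ /= cx; last first.
    by move: c0; rewrite ltNge cx.
  by exists x, x; split => //; rewrite mdistxx mul0r.
have [z zs|y0 [y1 [yE lE len]]] := ih y.
  by apply: H; rewrite in_cons zs orbT.
have := H x (mem_head _ _); case: x H => [x|] H cx; last first.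
  by move: c0; rewrite ltNge cx.
exists x, y1; split => //; rewrite len_cons.
have cy : c <= h y by apply: H; rewrite !inE eqxx orbT.
move: cy; rewrite yE => cy.
have ch : c * c <= h (Some x) * h (Some y0) by rewrite ler_pM// ltW.
have dxy : mdist x y0 * (c * c) <= sph_da (Some x) (Some y0).
  by rewrite da_SomeE -mulrA ler_wpM2l// mdist_ge0.
have := metric_triangle x y0 y1.
move/(ler_wpM2r (ltW (mulr_gt0 c0 c0))).
rewrite mulrDl yE in len *; lra.
Qed.

Let dist_Some (x0 : X) y : Some x0 <> y -> 0 < sph_dist (Some x0) y.
Proof.
move=> xy; have hx := h_gt0 x0; set c := h (Some x0) / 2.
have c0 : 0 < c by rewrite /c; lra.
pose e := if y is Some y0 then Num.min c (mdist x0 y0 * (c * c)) else c.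
have e0 : 0 < e.
  rewrite /e; case: y xy @e => [y|//] xy; rewrite lt_min c0/= mulr_gt0 ?mulr_gt0//.
  by rewrite mdist_gt0; apply/eqP => xy'; apply: xy; rewrite xy'.
apply: (lt_le_trans e0); apply: dist_glb => s sy.
have ec : e <= c by rewrite /e; case: y {xy sy e e0} => // y; rewrite ge_min lexx.
have [[z zs zc]|H] := pselect (exists2 z, z \in Some x0 :: s & h z < c).
  apply: (le_trans ec); apply: le_trans (h_len zs).
  by rewrite /c in zc *; lra.
have [|x1 [y1 [[<-] lE len]]] := @far_len c (Some x0) s c0.
  move=> z zs; rewrite leNgt; apply/negP => zc; apply: H.
  by exists z.
by apply: le_trans len; rewrite /e -sy lE ge_min lexx orbT.
Qed.

Let dist_positivity x y : sph_dist x y = 0 -> x = y.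
Proof.
move=> xy0; have [//|/eqP xy] := pselect (x = y).
case: x xy xy0 => [x|] /eqP xy xy0.
  by have := dist_Some xy; rewrite xy0 ltxx.
case: y xy xy0 => [y|//] xy; rewrite dist_sym => xy0.
by have /dist_Some : Some y <> None :> hX by []; rewrite xy0 ltxx.
Qed.

HB.instance Definition _ := isMetric.Build R hX
  distxx dist_positivity dist_sym dist_triangle.

Lemma sph_mdistE (x y : hX) : mdist x y = sph_dist x y.
Proof. by []. Qed.

Lemma sph_dist_le_mdist (x y : X) :
  mdist (Some x : hX) (Some y) <= mdist x y.
Proof.
rewrite sph_mdistE; apply: le_trans (dist_lb (_ : last _ [:: Some y] = _)) _ => //.
rewrite len_cons /sph_chain_length big_nil addr0 /=.
rewrite ler_pdivrMr ?mulr_gt0//.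
rewrite ler_peMr ?mdist_ge0//.
have := mdist_ge0 x a; have := mdist_ge0 y a; nra.
Qed.

Lemma sph_Some_continuous : continuous (Some : X -> hX).
Proof.
move=> x; apply/metricType_numDomainType.cvgrPdist_lt => e e0; near=> y.
apply: (le_lt_trans (sph_dist_le_mdist x y)).
near: y; apply: metricType_numDomainType.cvgr_dist_lt => //.
Unshelve. all: by end_near. Qed.

End sphericalization_metric.

Section sphericalization_measure.
Context (d : measure_display) (R : realType) (X : borelMetricType d R) (a : X).
Local Notation hX := (sphericalization a).

(* As Some is a homeomorphism of X onto the open set of finite points, this is  *)
(* the completion of the Borel sigma-algebra of hX with respect to sph_measure  *)
(* when that of X is the completion with respect to mu.                         *)
Definition sph_measurable : set (set hX) :=
  image_set_system [set: X] (Some : X -> hX) measurable.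

Let sph_measurableP (A : set hX) :
  sph_measurable A <-> measurable ((Some : X -> hX) @^-1` A).
Proof. by rewrite /sph_measurable /image_set_system/= setTI. Qed.

Let sph_measurable0 : sph_measurable set0.
Proof. by apply/sph_measurableP; rewrite preimage_set0. Qed.

Let sph_measurableC A : sph_measurable A -> sph_measurable (~` A).
Proof.
move=> /sph_measurableP mA; apply/sph_measurableP.
by rewrite preimage_setC; exact: measurableC.
Qed.

Let sph_measurable_bigcup (F : (set hX)^nat) :
  (forall i, sph_measurable (F i)) -> sph_measurable (\bigcup_i (F i)).
Proof.
move=> mF; apply/sph_measurableP; rewrite preimage_bigcup.
by apply: bigcupT_measurable => i; exact/sph_measurableP.
Qed.

HB.instance Definition _ := @isMeasurable.Build d hX sph_measurable
  sph_measurable0 sph_measurableC sph_measurable_bigcup.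

Let sph_open_measurable (U : set hX) : open U -> measurable U.
Proof.
move=> oU; apply/sph_measurableP; apply: open_measurable.
by apply: open_comp => // x _; exact: sph_Some_continuous.
Qed.

HB.instance Definition _ :=
  Metric_Measurable_isBorel.Build d R hX sph_open_measurable.

Context (mu : {measure set X -> \bar R}) (p : R).

Definition sph_weight (x : X) : \bar R := ((1 + mdist x a) `^ (- (2 * p)))%:E.

Definition sph_measure (A : set hX) : \bar R :=
  (\int[mu]_(x in (Some : X -> hX) @^-1` A) sph_weight x)%E.

Let weight_ge0 x : (0 <= sph_weight x)%E.
Proof. by rewrite lee_fin powR_ge0. Qed.

Lemma mdist_measurable : measurable_fun [set: X] (fun x => mdist x a).
Proof.
apply: (measurability _ (RGenOInfty.measurableE R)) => //.
move=> _ [_ [r ->] <-]; rewrite setTI.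
apply: open_measurable; rewrite openE => x /= .
rewrite in_itv/= andbT => rx.
rewrite /interior -nbhs_ballE; exists (mdist x a - r) => /=.
  by rewrite subr_gt0.
move=> y; rewrite ballEmdist/= in_itv/= andbT => xy.
have := metric_triangle x y a; lra.
Qed.

Let measurable_weight : measurable_fun [set: X] sph_weight.
Proof.
apply/measurable_EFinP.
apply: (measurableT_comp (measurable_powR _)).
by apply: measurable_funD => //; exact: mdist_measurable.
Qed.

Let sph_measure0 : sph_measure set0 = 0%E.
Proof. by rewrite /sph_measure preimage_set0 integral_set0. Qed.

Let sph_measure_ge0 A : (0 <= sph_measure A)%E.
Proof. by apply: integral_ge0. Qed.

Let sph_measure_sigma_additive : semi_sigma_additive sph_measure.
Proof.
move=> F mF tF mUF; rewrite /sph_measure preimage_bigcup.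
rewrite ge0_integral_bigcup//=; last 3 first.
- by move=> k; apply: (sph_measurableP _).1; exact: mF.
- exact: measurable_funTS.
- move=> i j _ _ [x [Fi Fj]]; apply: tF => //.
  by exists (Some x).
by apply: is_cvg_ereal_nneg_natsum_cond => n _ _; exact: integral_ge0.
Qed.

HB.instance Definition _ := isMeasure.Build d hX R sph_measure
  sph_measure0 sph_measure_ge0 sph_measure_sigma_additive.

End sphericalization_measure.

Arguments sph_measure {d R X} a mu p A.

(* Main.v *)
(* Write |x| = d(x, a) and h(x) = 1 / (1 + |x|). Away from infinity the metric of   *)
(* the sphericalization is d multiplied by the conformal factor h^2, so an upper    *)
(* gradient g on the sphere pulls back to the upper gradient g h^2 on X, and the    *)
(* weight h^(2p) is chosen so that the p-energies of g and g h^2 agree. Hence       *)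
(* everything can be done on X.                                                     *)
(*   A ball of radius r about x with r << h(x) is comparable to a ball of X on      *)
(* which h is nearly constant, and the Poincare inequality of X suffices. The       *)
(* other balls are comparable to neighbourhoods of infinity, i.e. to the exterior   *)
(* of B(a, M) with M about 1/r. There the difficulty is that the energy of g is     *)
(* controlled only outside of a ball about a, while the balls of the Poincare       *)
(* inequality of X contain a. As q <= Q, the point a has small q-capacity:          *)
(* multiplying truncations of u by a logarithmic cutoff that vanishes near a costs  *)
(* arbitrarily little energy. This gives a Poincare inequality on each annulus      *)
(* M <= |x| < N M, and a telescoping sum over the annuli K^k M <= |x| < K^(k+1) M   *)
(* converges since 2p > Q.                                                          *)

Require Import Defs.
From HB Require Import structures.
From mathcomp Require Import all_boot all_order all_algebra.
From mathcomp Require Import all_classical all_reals all_analysis.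
From mathcomp Require Import measurable_realfun ring lra.
Set Implicit Arguments.
Unset Strict Implicit.
Unset Printing Implicit Defensive.
Import Order.TTheory GRing.Theory Num.Theory.
Import numFieldNormedType.Exports.
Local Open Scope classical_set_scope.
Local Open Scope ring_scope.

(** Write h(x) = 1 / (1 + d(x, a)) ([infdist]). Near a finite point the spherical distance is h^2
    times the distance of X, up to a quadratic error ([sph_dist_conformal]), so arc length is
    multiplied by h^2 and an upper gradient g on the sphere becomes g h^2 on X
    ([upper_gradient_sph]). The density h^(2p) gives both the same p-energy
    ([integral_sph_measure_power]), and both claims become weighted estimates on X.

    The exponents enter through 1 < q <= min(p, Q) and Q < 2p. As q <= p, p-energy controls q-energy
    at a fixed scale ([integral_power_le]); as 1 < q <= Q, a logarithmic cutoff around a has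
    arbitrarily small q-energy ([exists_cutoff_length]); as Q < 2p, the measure near infinity is
    finite and decays ([exterior_measure]).

    Doubling: a ball of radius r about x has measure comparable to max(h(x), r)^(2p-2Q) r^Q, with r
    capped at 1 ([sph_ball_ge], [sph_ball_le]). For r much smaller than h(x) it is nearly a ball of
    X of radius r / h(x)^2 with weight h(x)^(2p); otherwise it is comparable to the set h < r, of
    measure about r^(2p-Q). Doubling is the scaling of this formula.

    Poincare inequality: for r much smaller than h(x) the inequality of X is transported
    ([local_sph_poincare]). For the other balls one works outside of B(a, M) with M about 1/r. If u
    differed by too much between two large parts of an annulus, its truncation times the cutoff
    would contradict the inequality of X on a ball around a ([weak_annulus]); a finite cover of the
    annulus turns this into an oscillation bound ([annulus_poincare]). The constants approximating u
    on consecutive annuli are compared on overlaps. They drift by about M^(1-Q/p) at scale M,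
    against a weighted mass M^(Q-2p), and the sum converges by [exponent_gap] ([exterior_poincare]).
    Gluing in a ball around a gives [whole_poincare], and both give [infinity_poincare]. Finally
    [sph_poincare] rewrites the weighted bounds as means, which needs a lower bound for the diameter
    of balls ([sph_diameter]). *)

Lemma eq_ler (R : numDomainType) (x y : R) : x = y -> x <= y.
Proof. by move->. Qed.

(** * Integration against the image of a measure with density *)

Section ge0_integral_density.
Local Open Scope ereal_scope.
Context d1 d2 (X : measurableType d1) (Y : measurableType d2) (R : realType).
Variables (phi : X -> Y) (mu : {measure set X -> \bar R})
  (nu : {measure set Y -> \bar R}) (w : X -> R).
Hypotheses (mphi : measurable_fun [set: X] phi)
  (mw : measurable_fun [set: X] w) (w0 : forall x, (0 <= w x)%R)
  (nuE : forall A, measurable A ->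
    nu A = \int[mu]_(x in phi @^-1` A) (w x)%:E).

Import HBNNSimple.

(** [nuE] is the case of an indicator function; linearity gives simple functions and monotone
    convergence the rest. *)
Let integral_densityT (f : Y -> \bar R) :
  measurable_fun [set: Y] f -> (forall y, 0 <= f y) ->
  \int[nu]_y f y = \int[mu]_x (f (phi x) * (w x)%:E).
Proof.
move=> mf f0; pose f_ := nnsfun_approx measurableT mf.
have cvf y : (f_ n y)%:E @[n --> \oo] --> f y.
  by apply: cvg_nnsfun_approx => //= *; exact: f0.
have ndf y m n : (m <= n)%N -> (f_ m y <= f_ n y)%R.
  by move=> mn; exact/lefP/nd_nnsfun_approx.
have mew : measurable_fun [set: X] (EFin \o w) by exact/measurable_EFinP.
transitivity (limn (fun n => \int[nu]_x (f_ n x)%:E)).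
  rewrite -monotone_convergence//.
  - by apply: eq_integral => y _; apply/esym/cvg_lim.
  - by move=> n; exact/measurable_EFinP/measurable_funP.
  - by move=> n y _; rewrite lee_fin.
  - by move=> y _ m n mn; rewrite lee_fin ndf.
transitivity (limn (fun n => \int[mu]_x ((f_ n (phi x))%:E * (w x)%:E))); last first.
  rewrite -monotone_convergence//.
  - apply: eq_integral => x _; apply/cvg_lim => //.
    by apply: cvgeZr => //; exact: cvf.
  - move=> n; apply: emeasurable_funM => //; apply/measurable_EFinP.
    by apply: measurableT_comp => //; exact/measurable_funP.
  - by move=> n y _; rewrite mule_ge0// lee_fin.
  - by move=> y _ m n mn; rewrite lee_wpmul2r// lee_fin// ndf.
congr (limn _); apply/funext => n.
have mfn r : measurable (f_ n @^-1` [set r]).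
  by rewrite -[X in measurable X]setTI; exact: measurable_funP.
have mfnphi r : measurable (phi @^-1` (f_ n @^-1` [set r])).
  by rewrite -[X in measurable X]setTI; exact: mphi.
transitivity (\sum_(k \in range (f_ n))
    \int[mu]_x ((k * \1_(phi @^-1` (f_ n @^-1` [set k])) x)%:E * (w x)%:E)).
  under eq_integral do rewrite fimfunE -fsumEFin//.
  rewrite ge0_integral_fsum//; last 2 first.
  - by move=> y; exact/measurable_EFinP/measurable_funM.
  - by move=> y x _; rewrite nnfun_muleindic_ge0.
  apply: eq_fsbigr => r _; rewrite integralZl_indic_nnsfun// integral_indic//=.
  have [r0|r0] := ltP r 0%R.
    rewrite preimage_nnfun0// set0I measure0 mule0 preimage_set0.
    by under eq_integral do rewrite indicE in_set0 mulr0 mul0e; rewrite integral0.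
  under [RHS]eq_integral do rewrite EFinM -muleA.
  rewrite ge0_integralZl//.
  - rewrite setIT nuE// integral_mkcond; congr (_ * _).
    apply: eq_integral => x _; rewrite /patch indicE.
    by case: ifPn => _; rewrite ?mul1e ?mul0e.
  - by apply: emeasurable_funM => //; exact/measurable_EFinP.
  - by move=> x _; rewrite mule_ge0// lee_fin.
rewrite -ge0_integral_fsum//.
- apply: eq_integral => x _; rewrite fimfunE -fsumEFin// ge0_mule_fsuml//.
  by move=> r; rewrite EFinM nnfun_muleindic_ge0.
- move=> r; apply: emeasurable_funM => //.
  by apply/measurable_EFinP/measurable_funM.
- move=> r x _; rewrite mule_ge0// ?lee_fin//.
  have := nnfun_muleindic_ge0 (f_ n) r (phi x).
  by rewrite -EFinM lee_fin !indicE.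
Qed.

(** Serves twice: for the change of variable along a curve, where [nu] is Lebesgue measure, and for
    the measure of the sphericalization, where [phi] is [Some]. *)
Lemma ge0_integral_density D (f : Y -> \bar R) : measurable D ->
  measurable_fun D f -> (forall y, D y -> 0 <= f y) ->
  \int[nu]_(y in D) f y = \int[mu]_(x in phi @^-1` D) (f (phi x) * (w x)%:E).
Proof.
move=> mD mf f0; rewrite integral_mkcond integral_densityT.
- rewrite [RHS]integral_mkcond; apply: eq_integral => x _.
  rewrite !patchE (_ : (x \in phi @^-1` D) = (phi x \in D)); last first.
    by apply/idP/idP; rewrite !inE.
  by case: ifP; rewrite ?mul0e.
- exact/(measurable_restrictT _ mD).
- by move=> y; exact: erestrict_ge0.
Qed.

End ge0_integral_density.

(** Bisecting n times multiplies the quadratic bound by 2^-n. This replaces differentiation: two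
    quantities on intervals are compared by checking that they agree to first order on short
    intervals. *)
Lemma subadditive_quadratic_le0 (R : realType) (Phi : R -> R -> R) (C a b : R) :
  (forall s r t, a <= s -> s <= r -> r <= t -> t <= b ->
    Phi s t <= Phi s r + Phi r t) ->
  (forall s t, a <= s -> s <= t -> t <= b -> Phi s t <= C * (t - s) ^+ 2) ->
  forall s t, a <= s -> s <= t -> t <= b -> Phi s t <= 0.
Proof.
move=> sub quad.
have bisect n s t : a <= s -> s <= t -> t <= b ->
    Phi s t <= C * (t - s) ^+ 2 * 2^-1 ^+ n.
  elim: n s t => [|n ih] s t as_ st tb; first by rewrite expr0 mulr1 quad.
  have sm : s <= (s + t) / 2 by lra.
  have mt : (s + t) / 2 <= t by lra.
  apply: (le_trans (sub s _ t as_ sm mt tb)).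
  have := lerD (ih s _ as_ sm (le_trans mt tb)) (ih _ t (le_trans as_ sm) mt tb).
  move=> /le_trans; apply; rewrite (exprS _ n).
  set x := _ ^+ n; rewrite [leLHS](_ : _ = C * (t - s) ^+ 2 * (2^-1 * x))//.
  by field.
move=> s t as_ st tb.
have := @cvg_geometric R (C * (t - s) ^+ 2) 2^-1.
rewrite ger0_norm ?invr_ge0// invf_lt1// ltr1n => /(_ isT) cv.
rewrite -(cvg_lim _ cv)//; apply: limr_ge; first by apply/cvg_ex; exists 0.
by apply: nearW => n /=; exact: bisect.
Qed.
(** * Arc length *)

Section interval_integral.
Context (R : realType).
Local Notation leb := (@lebesgue_measure R).

Lemma continuous_itv_integrable (phi : R -> R) (s t : R) : continuous phi -> leb.-integrable `]s, t] (EFin \o phi).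
Proof.
move=> cphi; have : leb.-integrable `[s, t] (EFin \o phi); last first.
  by apply: integrableS => //; exact: subset_itv_oc_cc.
apply: continuous_compact_integrable; first exact: segment_compact.
exact: continuous_subspaceT.
Qed.

Context (phi : R -> R) (cphi : continuous phi).
Local Notation I s t := (\int[leb]_(x in `]s, t]) phi x).

Lemma Rintegral_itv_EFin (s t : R) :
  (\int[leb]_(x in `]s, t]) (phi x)%:E)%E = (I s t)%:E.
Proof. by rewrite fineK//; exact/integrable_fin_num/continuous_itv_integrable. Qed.

Lemma Rintegral_itvD (s r t : R) : s <= r -> r <= t -> I s t = I s r + I r t.
Proof.
move=> sr rt; rewrite (@itv_bndbnd_setU _ _ (BRight s) (BRight r) (BRight t)) ?bnd_simp//.
rewrite Rintegral_setU//.
- rewrite -itv_bndbnd_setU ?bnd_simp//; exact: continuous_itv_integrable.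
- rewrite disj_set2E; apply/eqP/seteqP; split => x //=.
  by rewrite !in_itv/= => -[/andP[_ ?] /andP[? _]]; lra.
Qed.

Lemma Rintegral_itv_cst (m s t : R) : s <= t ->
  (\int[leb]_(x in `]s, t]) m = m * (t - s)).
Proof.
move=> st; rewrite Rintegral_cst//= lebesgue_measure_itv/= lte_fin.
have [//|ts] := ltP s t; have -> : s = t by apply/le_anti; rewrite st.
by rewrite subrr.
Qed.

Lemma Rintegral_itv_ge (m s t : R) : s <= t ->
  (forall x, s <= x <= t -> m <= phi x) -> m * (t - s) <= I s t.
Proof.
move=> st mphi; rewrite -Rintegral_itv_cst//; apply: le_Rintegral => //.
- exact: (@continuous_itv_integrable (cst m) s t (fun=> cvg_cst m)).
- exact: continuous_itv_integrable.
- by move=> x /=; rewrite in_itv/= => /andP[sx xt]; apply: mphi; rewrite (ltW sx).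
Qed.

Lemma Rintegral_itv_le (m s t : R) : s <= t ->
  (forall x, s <= x <= t -> phi x <= m) -> I s t <= m * (t - s).
Proof.
move=> st mphi; rewrite -Rintegral_itv_cst//; apply: le_Rintegral => //.
- exact: continuous_itv_integrable.
- exact: (@continuous_itv_integrable (cst m) s t (fun=> cvg_cst m)).
- by move=> x /=; rewrite in_itv/= => /andP[sx xt]; apply: mphi; rewrite (ltW sx).
Qed.

Lemma primitive_itv : exists S : R -> R, S 0 = 0 /\ forall s t, s <= t -> S t - S s = I s t.
Proof.
have I0 s t : t <= s -> I s t = 0.
  by move=> ts; rewrite set_itv_ge ?Rintegral_set0// bnd_simp -leNgt.
(* At most one of the two integrals is over a nonempty interval, which yields a primitive on both
   sides of 0. *)
exists (fun t => I 0 t - I t 0); split; first by rewrite subrr.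
move=> s t st; have [s0|s0] := leP 0 s; have [t0|t0] := leP 0 t.
- rewrite (Rintegral_itvD s0 st) (I0 t 0)// (I0 s 0)//; lra.
- lra.
- rewrite (Rintegral_itvD (ltW s0) t0) (I0 t 0)// (I0 0 s) ?(ltW s0)//; lra.
- rewrite (Rintegral_itvD st (ltW t0)) (I0 0 t) ?(ltW t0)// (I0 0 s) ?(ltW s0)//; lra.
Qed.

End interval_integral.

Section arc_length.
Context (d : measure_display) (R : realType) (X : borelMetricType d R).
Implicit Types (gamma : R -> X) (s t r : R) (l : seq R).

Definition chord_length gamma s l : R :=
  \sum_(r <- pairmap (fun u v => mdist (gamma u) (gamma v)) s l) r.

Lemma chord_length_nil gamma s : chord_length gamma s [::] = 0.
Proof. by rewrite /chord_length big_nil. Qed.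

Lemma chord_length_cons gamma s r l :
  chord_length gamma s (r :: l) = mdist (gamma s) (gamma r) + chord_length gamma r l.
Proof. by rewrite /chord_length big_cons. Qed.

Lemma chord_length_rcons gamma s r l : chord_length gamma s (rcons l r) =
  chord_length gamma s l + mdist (gamma (last s l)) (gamma r).
Proof.
elim: l s => [|x l ih] s; first by rewrite /= chord_length_cons !chord_length_nil addrC.
by rewrite /= !chord_length_cons ih addrA.
Qed.

(** Inserting the point r can only increase the chord length, by the triangle inequality. *)
Lemma chord_length_split gamma s r t l : s <= r -> r <= t -> itv_partition s t l ->
  exists l1 l2, [/\ itv_partition s r l1, itv_partition r t l2 &
    chord_length gamma s l <= chord_length gamma s l1 + chord_length gamma r l2].
Proof.
elim: l s => [|x l ih] s sr rt.
  move=> /itv_partition_nil st; have rs : r = s by lra.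
  exists [::], [::]; split; rewrite ?chord_length_nil ?addr0//.
    by split => //=; rewrite rs eqxx.
  by split => //=; rewrite rs st eqxx.
move=> [/= /andP[sx xl] lt].
have [rs|rs] := eqVneq r s.
  exists [::], (x :: l); rewrite rs chord_length_nil add0r; split => //.
  by split => //=; rewrite sx.
have sr' : s < r by rewrite lt_neqAle eq_sym rs.
have [xr|rx|xr] := ltgtP x r.
- have [|l1 [l2 [p1 p2 le]]] := ih x (ltW xr) rt; first by split.
  exists (x :: l1), l2; split => //.
    by case: p1 => p1 p1'; split => //=; rewrite sx.
  by rewrite !chord_length_cons -addrA lerD2l.
- exists [:: r], (x :: l); split.
  + by split => //=; rewrite ?sr' ?eqxx.
  + by split => //=; rewrite rx.
  + rewrite !chord_length_cons chord_length_nil addr0 addrA lerD2r.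
    exact: metric_triangle.
- exists [:: r], l; split.
  + by split => //=; rewrite ?sr' ?eqxx.
  + by split => //=; rewrite -xr.
  + by rewrite !chord_length_cons xr chord_length_nil addr0.
Qed.

Context (L : R) (gamma : R -> X) (arc : arc_length_curve L gamma).

Lemma arc_chord_le t l : 0 <= t <= L -> itv_partition 0 t l ->
  chord_length gamma 0 l <= t.
Proof.
case: arc => _ _ arc' /arc' tE pl; rewrite -lee_fin -tE.
by apply: ereal_sup_ubound; exists l.
Qed.

Lemma arc_chord_gt t e : 0 <= t <= L -> 0 < e -> exists2 l, itv_partition 0 t l &
  t - e < chord_length gamma 0 l.
Proof.
case: arc => _ _ arc' /arc' tE e0.
have : ((t - e)%:E < curve_length gamma 0 t)%E by rewrite tE lte_fin; lra.
by move=> /ereal_sup_gt[_ [l pl <-]]; rewrite lte_fin => ?; exists l.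
Qed.

(** Append t to a partition of [0, s] whose chords have total length almost s: the whole still has
    length at most t. *)
Lemma arc_mdist_le s t : 0 <= s -> s <= t -> t <= L ->
  mdist (gamma s) (gamma t) <= t - s.
Proof.
move=> s0; rewrite le_eqVlt => /predU1P[->|st] tL; first by rewrite mdistxx subrr.
apply/ler_addgt0Pr => e e0.
have [|l pl le] := @arc_chord_gt s e _ e0; first by lra.
have := @arc_chord_le t (rcons l t); rewrite chord_length_rcons.
have [pl1 /eqP pl2] := pl; rewrite pl2 => H.
have : itv_partition 0 t (rcons l t).
  by split; rewrite ?last_rcons// rcons_path pl1 pl2.
move/H; rewrite tL (le_trans s0 (ltW st)) => /(_ isT); lra.
Qed.

(** Subarcs have the right length too: split an almost optimal partition of [0, t] at s; its first
    half accounts for at most s. *)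
Lemma arc_chord_itv_gt s t e : 0 <= s -> s <= t -> t <= L -> 0 < e ->
  exists2 l, itv_partition s t l & t - s - e < chord_length gamma s l.
Proof.
move=> s0 st tL e0.
have [|l pl le] := @arc_chord_gt t e _ e0; first by lra.
have [l1 [l2 [p1 p2 l12]]] := chord_length_split gamma s0 st pl.
exists l2 => //; have := arc_chord_le _ p1; rewrite s0 (le_trans st tL) => /(_ isT).
lra.
Qed.

End arc_length.

(** * Borel measurability, Lipschitz maps and change of variable *)

Section borel_measurability.
Context (d : measure_display) (R : realType) (X : borelMetricType d R).
Local Notation borelX := (g_sigma_algebraType (@open X)).

Lemma open_borel (U : set X) : open U -> measurable (U : set borelX).
Proof. by move=> oU; apply: sub_sigma_algebra. Qed.

Lemma borel_measurable (U : set X) : measurable (U : set borelX) -> measurable U.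
Proof.
apply: smallest_sub => //; first exact: sigma_algebra_measurable.
by move=> V; exact: Defs.open_measurable.
Qed.

(** Upper gradients are Borel, whereas integrals against the measure use the sigma-algebra of X,
    which contains the Borel sets. *)
Lemma borel_measurable_fun d' (T : measurableType d') (f : X -> T) :
  measurable_fun [set: borelX] f -> measurable_fun [set: X] f.
Proof.
move=> mf _ A mA; rewrite setTI; apply: borel_measurable.
by rewrite -[X in measurable X]setTI; exact: mf.
Qed.

Lemma continuous_borel d' (Y : borelMetricType d' R) (f : X -> Y) : continuous f ->
  measurable_fun [set: borelX] (f : borelX -> g_sigma_algebraType (@open Y)).
Proof.
move=> /continuousP cf; apply: (@measurability _ _ borelX (g_sigma_algebraType (@open Y)) setT f (@open Y) erefl).
by move=> _ [U oU <-]; rewrite setTI; apply: open_borel; exact: cf.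
Qed.

Lemma continuous_borel_real (f : X -> R) : continuous f ->
  measurable_fun [set: borelX] f.
Proof.
move=> /continuousP cf; apply: (measurability _ (RGenOInfty.measurableE R)).
move=> _ [_ [r ->] <-]; rewrite setTI; apply: open_borel; apply: cf.
exact: interval_open.
Qed.

Lemma continuous_real_borel (f : R -> X) : continuous f ->
  measurable_fun [set: R] (f : R -> borelX).
Proof.
move=> /continuousP cf; apply: (@measurability _ _ R borelX setT f (@open X) erefl).
by move=> _ [U oU <-]; rewrite setTI; apply: measurable_realfun.open_measurable; exact: cf.
Qed.

End borel_measurability.

Lemma ball_lipschitz_continuous (R : realType) (Y : pseudoMetricType R)
    (f : R -> Y) (K : R) :
  (forall s t e, s <= t -> K * (t - s) < e -> ball (f s) e (f t)) -> continuous f.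
Proof.
move=> lipf x; apply/cvg_ballP => e e0.
have K0 : 0 < `|K| + 1 by rewrite ltr_wpDl.
have Kle u : 0 <= u -> K * u <= (`|K| + 1) * u.
  by move=> u0; rewrite ler_wpM2r// (le_trans (ler_norm _))// lerDl.
near=> y.
have xye : (`|K| + 1) * `|x - y| < e.
  rewrite mulrC -ltr_pdivlMr//; near: y; apply/nbhs_ballP.
  exists (e / (`|K| + 1)); first exact: divr_gt0.
  by [].
have [xy|/ltW yx] := leP x y; [|apply: ball_sym]; apply: lipf => //;
  apply: (le_lt_trans _ xye); apply: (le_trans (Kle _ _)); rewrite ?subr_ge0//.
- by rewrite distrC ler_wpM2l ?(ltW K0)// ler_norm.
- by rewrite ler_wpM2l ?(ltW K0)// ler_norm.
Unshelve. all: by end_near. Qed.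

Lemma mdist_lipschitz_continuous (R : realType) (Y : metricType R) (f : R -> Y) (K : R) :
  (forall s t, s <= t -> mdist (f s) (f t) <= K * (t - s)) -> continuous f.
Proof.
move=> lipf; apply: (@ball_lipschitz_continuous _ _ _ K) => s t e st.
by rewrite ballEmdist/=; exact/le_lt_trans/lipf.
Qed.

Lemma lipschitz_continuous (R : realType) (f : R -> R) (K : R) :
  (forall s t, s <= t -> `|f t - f s| <= K * (t - s)) -> continuous f.
Proof.
move=> lipf; apply: (@ball_lipschitz_continuous _ _ _ K) => s t e st.
by rewrite -ball_normE/= distrC; exact/le_lt_trans/lipf.
Qed.

(** As [phi] is bounded below by a positive constant, its primitive S is an increasing bijection of
    the line. The image under S of the measure with density [phi] gives each half-open interval its
    length, hence is Lebesgue measure. *)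
Lemma integration_by_substitution_primitive (R : realType) (phi : R -> R) (m M : R) :
  continuous phi -> 0 < m -> (forall x, m <= phi x <= M) ->
  exists S T : R -> R, [/\ S 0 = 0, cancel S T, cancel T S,
    (forall s t, s <= t ->
       S t - S s = \int[lebesgue_measure]_(x in `]s, t]) phi x) &
    forall (f : R -> \bar R) (l : R), measurable_fun [set: R] f ->
      (forall x, (0 <= f x)%E) ->
      (\int[lebesgue_measure]_(x in `[0%R, S l]) f x =
       \int[lebesgue_measure]_(x in `[0%R, l]) (f (S x) * (phi x)%:E))%E].
Proof.
move=> cphi m0 mphiM; have [S [S0 SI]] := primitive_itv cphi.
have Sge s t : s <= t -> m * (t - s) <= S t - S s.
  move=> st; rewrite SI//; apply: Rintegral_itv_ge => // x _.
  by have /andP[] := mphiM x.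
have Sle s t : s <= t -> S t - S s <= M * (t - s).
  move=> st; rewrite SI//; apply: Rintegral_itv_le => // x _.
  by have /andP[] := mphiM x.
have Slt s t : s < t -> S s < S t.
  move=> st; rewrite -subr_gt0; apply: (lt_le_trans _ (Sge _ _ (ltW st))).
  by rewrite mulr_gt0// subr_gt0.
have Smono : {mono S : s t / s <= t} by apply: le_mono => s t; exact: Slt.
have cS : continuous S.
  apply: (@lipschitz_continuous _ _ M) => s t st.
  by rewrite ger0_norm ?Sle// subr_ge0 Smono.
(* Since S grows at rate at least m, its values at [- b] and [b] enclose y, and the intermediate
   value theorem applies. *)
have Ssurj y : exists x, S x == y.
  pose b := `|y| / m; have b0 : 0 <= b by rewrite divr_ge0// ltW.
  have [| | |x _ <-] := @IVT _ S (- b) b y; last by exists x.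
  - lra.
  - exact: continuous_subspaceT.
  - have yb : `|y| = m * b by rewrite /b mulrC divfK// gt_eqF.
    have := Sge 0 b b0; have := Sge (- b) 0; rewrite S0 oppr_le0 => /(_ b0).
    rewrite ge_min le_max => h1 h2; apply/andP; split; apply/orP; [left|right].
      by have := ler_norm (- y); rewrite normrN; lra.
    by have := ler_norm y; lra.
pose T y := sval (cid (Ssurj y)).
have TK : cancel T S by move=> y; rewrite /T; case: cid => x /= /eqP.
have SK : cancel S T by move=> x; apply: (inc_inj Smono); rewrite TK.
exists S, T; split => // f l mf f0.
have mS : measurable_fun [set: R] S by exact: continuous_measurable_fun.
have mphi : measurable_fun [set: R] phi by exact: continuous_measurable_fun.
have phi0 x : 0 <= phi x by have /andP[+ _] := mphiM x; lra.
have mSA (A : set (measurableTypeR R)) : measurable A -> measurable (S @^-1` A).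
  by move=> mA; rewrite -[X in measurable X]setTI; exact: mS.
pose nuf (A : set (measurableTypeR R)) : \bar R :=
  (\int[lebesgue_measure]_(x in S @^-1` A) (phi x)%:E)%E.
have nu0 : nuf set0 = 0%E by rewrite /nuf preimage_set0 integral_set0.
have nu_ge0 A : (0 <= nuf A)%E by apply: integral_ge0 => x _; rewrite lee_fin.
have nu_sigma : semi_sigma_additive nuf.
  move=> F mF tF mUF; rewrite /nuf preimage_bigcup.
  rewrite ge0_integral_bigcup//=; last 4 first.
  - by move=> k; exact: mSA.
  - by apply/measurable_EFinP; exact: measurable_funTS.
  - by move=> x _; rewrite lee_fin.
  - by move=> i j _ _ [x [Fi Fj]]; apply: tF => //; exists (S x).
  apply: is_cvg_ereal_nneg_natsum_cond => n _ _.
  by apply: integral_ge0 => x _; rewrite lee_fin.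
pose nu : {measure set (measurableTypeR R) -> \bar R} :=
  HB.pack nuf (isMeasure.Build _ _ _ nuf nu0 nu_ge0 nu_sigma).
have nuE A : measurable A -> lebesgue_measure A = nuf A.
  apply: (@lebesgue_measure_unique _ nu) => B /ocitvP[->|[[a b] /= ab ->]].
    by rewrite !measure0.
  rewrite lebesgue_measure_itv/= lte_fin ab /nu/= /nuf.
  have -> : S @^-1` `]a, b] = `]T a, T b]%classic.
    have E x : (a < S x <= b) = (T a < x <= T b).
      by rewrite -{1}(TK a) -{1}(TK b) (leW_mono Smono) Smono.
    by apply/seteqP; split=> x /=; rewrite !in_itv/= E.
  rewrite Rintegral_itv_EFin// -SI; first by rewrite !TK.
  by rewrite -Smono !TK ltW.
rewrite (@ge0_integral_density _ _ (measurableTypeR R) (measurableTypeR R) R S lebesgue_measure lebesgue_measure phi)//.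
- congr integral; apply/seteqP; split=> x /=.
    by rewrite !in_itv/= -{1}S0 !Smono.
  by rewrite !in_itv/= -{2}S0 !Smono.
- exact: measurable_funTS.
Qed.
Lemma itv_partition_mem (R : realType) (s t x : R) l : itv_partition s t l ->
  x \in l -> s < x <= t.
Proof.
elim: l s => // y l ih s [/= /andP[sy yl] lt]; rewrite in_cons => /predU1P[->|xl].
  by rewrite sy/=; have /itv_partition_le : itv_partition y t l by split.
have /ih /(_ xl) /andP[yx ->] : itv_partition y t l by split.
by rewrite (lt_trans sy yx).
Qed.

Lemma itv_partition_exists (R : realType) (s t : R) : s <= t ->
  exists l, itv_partition s t l.
Proof.
rewrite le_eqVlt => /predU1P[->|st]; last by exists [:: t]; exact: itv_partition1.
by exists [::]; split => //=.
Qed.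

Section chord_comparison.
Context (R : realType) d d' (X : borelMetricType d R) (Y : borelMetricType d' R).

Lemma chord_length_ge (gamma : R -> X) (gamma' : R -> Y) (c s t : R) l :
  itv_partition s t l ->
  (forall u v, s <= u -> u <= v -> v <= t ->
    c * mdist (gamma u) (gamma v) <= mdist (gamma' u) (gamma' v)) ->
  c * chord_length gamma s l <= chord_length gamma' s l.
Proof.
elim: l s => [|x l ih] s p H; first by rewrite !chord_length_nil mulr0.
have xt := itv_partition_mem p (mem_head _ _); have /andP[sx xt'] := xt.
rewrite !chord_length_cons mulrDr lerD ?H ?(ltW sx)// ih//.
  by case: p => /= /andP[_ ? ?]; split.
by move=> u v xu; apply: H; rewrite (le_trans (ltW sx)).
Qed.

Lemma chord_length_le (gamma : R -> X) (F : R -> R) (s t : R) l :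
  itv_partition s t l ->
  (forall u v, s <= u -> u <= v -> v <= t ->
    mdist (gamma u) (gamma v) <= F v - F u) ->
  chord_length gamma s l <= F t - F s.
Proof.
elim: l s => [|x l ih] s p H.
  by rewrite chord_length_nil (itv_partition_nil p) subrr.
have xt := itv_partition_mem p (mem_head _ _); have /andP[sx xt'] := xt.
rewrite chord_length_cons; have h1 := H s x (lexx _) (ltW sx) xt'.
have : chord_length gamma x l <= F t - F x.
  apply: ih; first by case: p => /= /andP[_ ? ?]; split.
  by move=> u v xu; apply: H; rewrite (le_trans (ltW sx)).
lra.
Qed.

Lemma chord_length_map (gamma : R -> X) (S : R -> R) (s : R) l :
  chord_length gamma (S s) (map S l) = chord_length (gamma \o S) s l.
Proof.
elim: l s => [|x l ih] s /=; first by rewrite !chord_length_nil.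
by rewrite !chord_length_cons ih.
Qed.

Lemma chord_length_cat (gamma : R -> X) (s : R) l1 l2 :
  chord_length gamma s (l1 ++ l2) =
  chord_length gamma s l1 + chord_length gamma (last s l1) l2.
Proof.
elim: l1 s => [|x l ih] s /=; first by rewrite !chord_length_nil add0r.
by rewrite !chord_length_cons ih addrA.
Qed.

End chord_comparison.

Section clamp.
Context (R : realDomainType).
Implicit Types a l s t x y : R.

Lemma maxB_bounds a x y : y <= x -> 0 <= Num.max a x - Num.max a y <= x - y.
Proof. by move=> yx; case: (leP a x) => ?; case: (leP a y) => ?; lra. Qed.

Lemma minB_bounds a x y : y <= x -> 0 <= Num.min a x - Num.min a y <= x - y.
Proof. by move=> yx; case: (leP a x) => ?; case: (leP a y) => ?; lra. Qed.

(** Used to extend a curve from [0, l] to the whole line, constant outside, and to truncate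
    functions to [0, 1]. *)
Definition clamp l t := Num.max 0 (Num.min l t).

Lemma clamp_id l t : 0 <= t <= l -> clamp l t = t.
Proof. by move=> /andP[t0 tl]; rewrite /clamp min_r// max_r. Qed.

Lemma clamp_in l t : 0 <= l -> 0 <= clamp l t <= l.
Proof. by move=> l0; rewrite /clamp le_max lexx/= ge_max l0 ge_min lexx. Qed.

Lemma clampB_bounds l s t : s <= t -> 0 <= clamp l t - clamp l s <= t - s.
Proof.
move=> st; have /andP[h1 h2] := minB_bounds l st; rewrite subr_ge0 in h1.
by have /andP[-> /le_trans ->] := maxB_bounds 0 h1.
Qed.

Lemma clamp_lipschitz l s t : `|clamp l t - clamp l s| <= `|t - s|.
Proof.
have [st|/ltW ts] := leP s t.
  by have /andP[h1 h2] := clampB_bounds l st; rewrite !ger0_norm// subr_ge0.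
by have /andP[h1 h2] := clampB_bounds l ts; rewrite !(distrC _ s) (distrC _ (clamp l s)) !ger0_norm// subr_ge0.
Qed.

End clamp.

(** * Conformal maps and upper gradients *)

(* A map that scales distances by omega, up to a quadratic error, also scales *)
(* the arc length element by omega.                                           *)
Section conformal_map.
Context (R : realType) d d' (X : borelMetricType d R) (Y : borelMetricType d' R).
Variables (iota : X -> Y) (omega : X -> R) (K : R).
Hypotheses (K0 : 0 <= K) (omega_gt0 : forall x, 0 < omega x)
  (omega_le1 : forall x, omega x <= 1)
  (omega_lip : forall x y, omega x - omega y <= K * mdist x y)
  (iota_omega : forall x y,
    `|mdist (iota x) (iota y) - omega x * mdist x y| <= K * mdist x y ^+ 2).

Section curve.
Variables (l : R) (gamma : R -> X) (arc : arc_length_curve l gamma).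

Let l0 : 0 < l. Proof. by case: arc. Qed.

Let gammac t := gamma (clamp l t).

Let gammac_lip s t : s <= t -> mdist (gammac s) (gammac t) <= t - s.
Proof.
move=> st; have /andP[h1 h2] := clampB_bounds l st.
have /andP[s0 _] := clamp_in s (ltW l0); have /andP[_ tl] := clamp_in t (ltW l0).
apply: le_trans h2; apply: (arc_mdist_le arc) => //.
by rewrite -subr_ge0.
Qed.

Let phi t := omega (gammac t).

Let phi_lip s t : s <= t -> `|phi t - phi s| <= K * (t - s).
Proof.
move=> st; have h := ler_wpM2l K0 (gammac_lip st).
rewrite ler_norml; apply/andP; split.
  by have := omega_lip (gammac s) (gammac t); rewrite /phi; lra.
by have := omega_lip (gammac t) (gammac s); rewrite metric_sym /phi; lra.
Qed.

Let phi_cont : continuous phi.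
Proof. exact: lipschitz_continuous phi_lip. Qed.

Let phi_min : exists2 m, 0 < m & forall x, m <= phi x <= 1.
Proof.
have [|c cl cmin] := @EVT_min _ phi 0 l (ltW l0).
  exact: continuous_subspaceT.
exists (phi c); [exact: omega_gt0|move=> x]; rewrite omega_le1 andbT.
have -> : phi x = phi (clamp l x).
  by rewrite /phi /gammac [in RHS]clamp_id//; exact/clamp_in/ltW.
by apply: cmin; rewrite in_itv/= clamp_in// ltW.
Qed.

Let gammac_chord s t e : 0 <= s -> s <= t -> t <= l -> 0 < e ->
  exists2 p, itv_partition s t p & t - s - e < chord_length gammac s p.
Proof.
move=> s0 st tl e0; have [p pp h] := arc_chord_itv_gt arc s0 st tl e0.
exists p => //; apply: (lt_le_trans h).
rewrite -[leLHS]mul1r; apply: (chord_length_ge pp) => u v su uv vt.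
by rewrite mul1r /gammac !clamp_id//; lra.
Qed.

Section reparametrized.
Variables (S : R -> R) (I : forall s t, s <= t ->
  S t - S s = \int[lebesgue_measure]_(x in `]s, t]) phi x).

Let S_ge s t : s <= t -> (phi s - K * (t - s)) * (t - s) <= S t - S s.
Proof.
move=> st; rewrite I//; apply: Rintegral_itv_ge => // x /andP[sx xt].
have := phi_lip sx; rewrite ler_norml => /andP[+ _].
have := ler_wpM2l K0 (lerB xt (lexx s)); lra.
Qed.

Let S_le s t : s <= t -> S t - S s <= (phi s + K * (t - s)) * (t - s).
Proof.
move=> st; rewrite I//; apply: Rintegral_itv_le => // x /andP[sx xt].
have := phi_lip sx; rewrite ler_norml => /andP[_ +].
have := ler_wpM2l K0 (lerB xt (lexx s)); lra.
Qed.

(** The difference of the two sides is subadditive in the interval. On a short one the distance is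
    at most phi(s) (t - s) and the integral at least that, both up to a multiple of (t - s)^2, so
    [subadditive_quadratic_le0] applies. *)
Lemma conformal_mdist_le s t : s <= t ->
  mdist (iota (gammac s)) (iota (gammac t)) <= S t - S s.
Proof.
move=> st; rewrite -subr_le0.
apply: (@subadditive_quadratic_le0 _ (fun s t =>
  mdist (iota (gammac s)) (iota (gammac t)) - (S t - S s)) (2 * K) s t) => //.
- move=> {st t}s r t _ _ _ _.
  by have := metric_triangle (iota (gammac s)) (iota (gammac r)) (iota (gammac t)); lra.
move=> {st} s' t' _ st _.
have := iota_omega (gammac s') (gammac t'); rewrite ler_norml => /andP[_].
have dst := gammac_lip st; have d0 := mdist_ge0 (gammac s') (gammac t').
have := S_ge st; rewrite -/(phi s').
have := ler_wpM2l (ltW (omega_gt0 (gammac s'))) dst; rewrite -/(phi s').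
have : K * mdist (gammac s') (gammac t') ^+ 2 <= K * (t' - s') ^+ 2.
  by rewrite ler_wpM2l// lerXn2r// ?nnegrE ?subr_ge0.
rewrite [(t' - s') ^+ 2]expr2; lra.
Qed.

Let chords s t := [set chord_length (iota \o gammac) s p | p in itv_partition s t].

Let chords_sup s t : s <= t -> has_sup (chords s t).
Proof.
move=> st; split.
  by have [p pp] := itv_partition_exists st; exists (chord_length (iota \o gammac) s p), p.
exists (S t - S s) => _ [p pp <-]; apply: chord_length_le => // u v _ uv _.
exact: conformal_mdist_le.
Qed.

(** Converse of [conformal_mdist_le]: partitions concatenate, so the defect of S against the
    supremum of chord sums is subadditive. On a short interval, a partition that almost exhausts the
    original arc has image chords scaled by nearly phi(s). *)
Lemma conformal_chord_ge s t e : 0 <= s -> s <= t -> t <= l -> 0 < e ->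
  exists2 p, itv_partition s t p &
    S t - S s - e < chord_length (iota \o gammac) s p.
Proof.
move=> s0 st tl e0.
suff H : S t - S s - sup (chords s t) <= 0.
  have [_ [p pp <-] h] := sup_adherent e0 (chords_sup st).
  by exists p => //; lra.
apply: (@subadditive_quadratic_le0 _ (fun s t =>
  S t - S s - sup (chords s t)) (3 * K) 0 l) => //.
- move=> {s0 st tl} {}s r {}t s0 sr rt tl.
  apply/ler_addgt0Pr => e' e'0.
  have [_ [p pp <-] hp] := sup_adherent (divr_gt0 e'0 (ltr0Sn _ 1)) (chords_sup sr).
  have [_ [p' pp' <-] hp'] := sup_adherent (divr_gt0 e'0 (ltr0Sn _ 1)) (chords_sup rt).
  have : chord_length (iota \o gammac) s (p ++ p') <= sup (chords s t).
    apply: ub_le_sup; first by have [] := chords_sup (le_trans sr rt).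
    by exists (p ++ p') => //; exact: itv_partition_cat pp pp'.
  rewrite chord_length_cat; have [_ /eqP ->] := pp; lra.
move=> {s0 st tl e e0} {}s {}t s0 st tl; apply/ler_addgt0Pr => e e0.
have hS := S_le st.
have le_sup p : itv_partition s t p -> chord_length (iota \o gammac) s p <= sup (chords s t).
  by move=> pp; apply: ub_le_sup; [have [] := chords_sup st|exists p].
(* Lower bound for the scaling of every chord: one K (t - s) for the variation of [phi], one for the
   quadratic error of [iota]. It may be negative, whence the absolute value in the tolerance
   below. *)
pose c := phi s - 2 * K * (t - s).
have ce0 : 0 < e / (`|c| + 1) by rewrite divr_gt0// ltr_wpDl.
have [p pp hp] := gammac_chord s0 st tl ce0.
have : c * chord_length gammac s p <= chord_length (iota \o gammac) s p.
  apply: (chord_length_ge pp) => u v su uv vt.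
  have := iota_omega (gammac u) (gammac v); rewrite ler_norml => /andP[+ _].
  have := phi_lip su; rewrite ler_norml => /andP[+ _].
  have d0 := mdist_ge0 (gammac u) (gammac v).
  have duv := gammac_lip uv.
  set D := mdist (gammac u) (gammac v) in d0 duv *.
  rewrite -/(phi u) /= -/D expr2 => h1 h2.
  have h3 : D * D <= D * (t - s) by apply: ler_wpM2l => //; lra.
  have h4 : (phi s - K * (t - s)) * D <= phi u * D.
    apply: ler_wpM2r => //; have : K * (u - s) <= K * (t - s) by apply: ler_wpM2l => //; lra.
    lra.
  have := ler_wpM2l K0 h3; rewrite /c; lra.
move=> hc; have := le_sup _ pp => hsup.
have chord_le : chord_length gammac s p <= t - s.
  by apply: (@chord_length_le _ _ _ _ id) => // u v _ uv _; exact: gammac_lip.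
have ecE : e = (`|c| + 1) * (e / (`|c| + 1)) by field; rewrite gt_eqF// ltr_wpDl.
have hce : c * (t - s) - e <= c * chord_length gammac s p.
  set A := chord_length _ _ _ in hp chord_le *; set x := e / _ in hp ce0 ecE.
  have : c * (t - s - A) <= `|c| * x.
    apply: (@le_trans _ _ (`|c| * (t - s - A))).
      by apply: ler_wpM2r; [lra|exact: ler_norm].
    by apply: ler_wpM2l => //; lra.
  lra.
rewrite /c in hce hc; rewrite expr2; lra.
Qed.

End reparametrized.

(** The image curve is reparametrized by the primitive S of the conformal factor.
    [conformal_mdist_le] and [conformal_chord_ge] bound its length from above and below, so the new
    parameter is arc length. *)
Lemma conformal_curve (f : Y -> \bar R) :
  measurable_fun [set: g_sigma_algebraType (@open Y)] f -> (forall y, (0 <= f y)%E) ->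
  exists (L : R) (gamma' : R -> Y), [/\ arc_length_curve L gamma',
    gamma' 0 = iota (gamma 0), gamma' L = iota (gamma l) &
    (\int[lebesgue_measure]_(t in `[0%R, L]) f (gamma' t) =
     \int[lebesgue_measure]_(t in `[0%R, l])
       (f (iota (gamma t)) * (omega (gamma t))%:E))%E].
Proof.
move=> mf f0; have [m m0 mphi] := phi_min.
have [S [T [S0 SK TK SI Ssub]]] := integration_by_substitution_primitive phi_cont m0 mphi.
have Sge s t : s <= t -> m * (t - s) <= S t - S s.
  move=> st; rewrite SI//; apply: Rintegral_itv_ge => // x _.
  by have /andP[] := mphi x.
have Slt s t : s < t -> S s < S t.
  move=> st; rewrite -subr_gt0; apply: (lt_le_trans _ (Sge _ _ (ltW st))).
  by rewrite mulr_gt0// subr_gt0.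
have Smono : {mono S : s t / s <= t} by apply: le_mono => s t; exact: Slt.
have Tmono : {mono T : s t / s <= t} by move=> s t; rewrite -Smono !TK.
pose gamma' := iota \o gammac \o T.
have gamma'_lip s t : s <= t -> mdist (gamma' s) (gamma' t) <= t - s.
  move=> st; rewrite -{2}(TK t) -{2}(TK s); apply: (conformal_mdist_le SI).
  by rewrite Tmono.
have T0 : T 0 = 0 by rewrite -S0 SK.
have gamma'_cont : continuous gamma'.
  by apply: (@mdist_lipschitz_continuous _ _ _ 1) => s t st; rewrite mul1r gamma'_lip.
exists (S l), gamma'; split.
- split; first by rewrite -S0 Slt.
    exact: continuous_subspaceT.
  move=> t /andP[t0 tSl]; apply/le_anti/andP; split.
    apply: ge_ereal_sup => _ [p pp <-]; rewrite lee_fin.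
    apply: (le_trans (chord_length_le (F := id) pp _)); last by rewrite subr0.
    by move=> u v _ uv _; exact: gamma'_lip.
  apply/lee_addgt0Pr => e e0.
  have [| |p pp hp] := @conformal_chord_ge S SI 0 (T t) e (lexx _) _ _ e0.
  - by rewrite -T0 Tmono.
  - by rewrite -(SK l) Tmono.
  rewrite -leeBlDr//.
  apply: (@le_trans _ _ (chord_length gamma' 0 (map S p))%:E); last first.
    apply: ereal_sup_ubound; exists (map S p) => //.
    have [pp1 /eqP pp2] := pp; split.
      rewrite -S0 path_map; apply: sub_path pp1 => u v /=.
      by rewrite (leW_mono Smono).
    by rewrite -S0 last_map pp2 TK.
  rewrite lee_fin -[X in chord_length _ X]S0 chord_length_map.
  rewrite (_ : gamma' \o S = iota \o gammac); last by apply/funext => x /=; rewrite /gamma'/= SK.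
  by rewrite TK S0 subr0 in hp; exact: ltW.
- by rewrite /gamma'/= T0 /gammac clamp_id// lexx ltW.
- by rewrite /gamma'/= SK /gammac clamp_id// lexx ltW.
- rewrite (Ssub (f \o gamma'))//.
    apply: eq_integral => x; rewrite inE/= in_itv/= => xl.
    by rewrite /gamma'/= SK /phi /gammac clamp_id.
    exact: (measurableT_comp mf (continuous_real_borel gamma'_cont)).
  by move=> x; exact: f0.
Qed.

End curve.

Lemma upper_gradient_conformal (g u : Y -> \bar R) : continuous iota ->
  continuous omega -> upper_gradient g u ->
  upper_gradient (fun x => g (iota x) * (omega x)%:E)%E (u \o iota).
Proof.
move=> ciota comega [mg g0 gu]; split.
- apply: emeasurable_funM; last by apply/measurable_EFinP; exact: continuous_borel_real.
  exact: (measurableT_comp mg (continuous_borel ciota)).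
- by move=> x; rewrite mule_ge0// lee_fin ltW.
- move=> l gamma arc.
  have [L [gamma' [arc' g0' gL' <-]]] := conformal_curve arc mg g0.
  by rewrite /= -g0' -gL'; exact: gu.
Qed.

End conformal_map.

(** * Localization of upper gradients, and truncation *)

Section metric_borel.
Context (d : measure_display) (R : realType) (X : borelMetricType d R).
Local Notation borelX := (g_sigma_algebraType (@open X)).

Lemma lipschitz_metric_continuous (f : X -> R) (K : R) :
  (forall x y, f x - f y <= K * mdist x y) -> continuous f.
Proof.
move=> lipf x; apply/cvg_ballP => e e0.
have K0 : 0 < `|K| + 1 by rewrite ltr_wpDl.
near=> y.
have xye : (`|K| + 1) * mdist x y < e.
  rewrite mulrC -ltr_pdivlMr//; near: y.
  apply/metricType_numDomainType.nbhs_mdistP.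
  by exists (e / (`|K| + 1)); first exact: divr_gt0.
have Kle : K * mdist x y <= (`|K| + 1) * mdist x y.
  by rewrite ler_wpM2r ?mdist_ge0// (le_trans (ler_norm _))// lerDl.
have := lipf x y; have := lipf y x; rewrite (metric_sym y x) => h1 h2.
by rewrite -ball_normE/= ltr_norml; apply/andP; split; lra.
Unshelve. all: by end_near. Qed.

Lemma mdist_continuous (a : X) : continuous (fun x => mdist x a).
Proof.
apply: (@lipschitz_metric_continuous _ 1) => x y.
by have := metric_triangle x y a; lra.
Qed.

Lemma ball_sphereE (x : X) r : ball x r = [set y | mdist y x < r].
Proof. by rewrite ballEmdist; apply/seteqP; split=> y /=; rewrite metric_sym. Qed.

Lemma open_mball (x : X) r : open (ball x r).
Proof.
rewrite ball_sphereE.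
have /continuousP /(_ [set t | t < r]) := @mdist_continuous x; apply.
exact: open_lt.
Qed.

Lemma open_mdist_gt (x : X) r : open [set y | r < mdist y x].
Proof.
have /continuousP /(_ [set t | r < t]) := @mdist_continuous x; apply.
exact: open_gt.
Qed.

Lemma measurable_mball (x : X) r : measurable (ball x r).
Proof. exact/Defs.open_measurable/open_mball. Qed.

Lemma measurable_mdist_gt (x : X) r : measurable [set y | r < mdist y x].
Proof. exact/Defs.open_measurable/open_mdist_gt. Qed.

Lemma measurable_mdist_ge (x : X) r : measurable [set y | r <= mdist y x].
Proof.
rewrite (_ : [set y | _] = ~` ball x r); first exact/measurableC/measurable_mball.
by rewrite ball_sphereE; apply/seteqP; split=> y /=; rewrite leNgt => /negP.
Qed.

Lemma arc_extension (l : R) (gamma : R -> X) : arc_length_curve l gamma ->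
  exists2 gamma' : R -> X,
    (forall s t, s <= t -> mdist (gamma' s) (gamma' t) <= t - s) &
    (forall t, 0 <= t <= l -> gamma' t = gamma t).
Proof.
move=> arc; have l0 : 0 <= l by case: arc => /ltW.
exists (gamma \o clamp l) => [s t st|t tl]; last by rewrite /= clamp_id.
have /andP[h1 h2] := clampB_bounds l st; apply: le_trans h2.
have /andP[s0 _] := clamp_in s l0; have /andP[_ tl] := clamp_in t l0.
by apply: (arc_mdist_le arc) => //; rewrite -subr_ge0.
Qed.

Lemma arc_measurable (l : R) (gamma : R -> X) (f : X -> \bar R) :
  arc_length_curve l gamma -> measurable_fun [set: borelX] f ->
  measurable_fun `[0, l] (f \o gamma).
Proof.
move=> arc mf; have [gamma' lip ext] := arc_extension arc.
apply: (eq_measurable_fun (f \o gamma')).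
  by move=> t; rewrite inE/= in_itv/= => tl; rewrite ext.
apply: measurable_funTS; apply: (measurableT_comp mf).
apply: continuous_real_borel.
by apply: (@mdist_lipschitz_continuous _ _ _ 1) => s t st; rewrite mul1r lip.
Qed.

End metric_borel.

Lemma measurable_mem d (T : measurableType d) (A : set T) : measurable A ->
  measurable_fun [set: T] (fun x => x \in A).
Proof.
move=> mA; apply: (measurable_fun_bool true); rewrite setTI.
rewrite (_ : _ @^-1` _ = A)//.
by apply/seteqP; split => x /= => [/set_mem|/mem_set].
Qed.

Section upper_gradient_localization.
Context (d : measure_display) (R : realType) (X : borelMetricType d R).
Local Notation borelX := (g_sigma_algebraType (@open X)).

(* A curve that leaves the closed ball of radius r spends a positive amount of *)
(* time outside, where the gradient is +oo.                                   *)
Lemma upper_gradient_localize (g u : X -> \bar R) (x : X) (r : R) : 0 < r ->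
  upper_gradient g u ->
  upper_gradient (fun y => if y \in (ball x r : set X) then g y else +oo%E)
    (u \_ (ball x (2 * r))).
Proof.
move=> r0 [mg g0 gu]; set g' := fun _ => _.
have mg' : measurable_fun [set: borelX] g'.
  apply: measurable_fun_ifT => //; apply: measurable_mem.
  by apply: open_borel; exact: open_mball.
have g'0 y : (0 <= g' y)%E by rewrite /g'; case: ifP.
split => // l gamma arc; have l0 : 0 < l by case: arc.
have [[t1 /andP[t10 t1l] t1r]|in_r] :=
    pselect (exists2 t, 0 <= t <= l & r < mdist x (gamma t)).
  suff -> : (\int[lebesgue_measure]_(t in `[0%R, l]) g' (gamma t) = +oo)%E.
    exact: leey.
  (* The curve is 1-Lipschitz, so it stays outside of the ball during all times closer to t1 than
     e. *)
  pose e := mdist x (gamma t1) - r; have e0 : 0 < e by rewrite subr_gt0.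
  pose s := Num.max 0 (t1 - e); pose t := Num.min l (t1 + e).
  have s0 : 0 <= s by rewrite le_max lexx.
  have tl : t <= l by rewrite ge_min lexx.
  have st : s < t by rewrite lt_min !gt_max; do ![apply/andP; split]; lra.
  apply/eqP; rewrite -leye_eq.
  apply: (@le_trans _ _ (\int[lebesgue_measure]_(t in `]s, t[) g' (gamma t))%E); last first.
    apply: ge0_subset_integral => //.
      exact: arc_measurable arc mg'.
    by apply: subset_itvW.
  rewrite (eq_integral (cst +oo%E)); last first.
    move=> z; rewrite inE/= in_itv/= lt_min gt_max => /andP[/andP[z0 tz] /andP[zl zt]].
    rewrite /g' memNset// ballEmdist/= => zr.
    have := metric_triangle x (gamma z) (gamma t1).
    have : mdist (gamma z) (gamma t1) <= `|t1 - z|.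
      have [zt1|/ltW zt1] := leP z t1.
        rewrite ger0_norm ?subr_ge0//; apply: (arc_mdist_le arc) => //; lra.
      rewrite metric_sym distrC ger0_norm ?subr_ge0//.
      by apply: (arc_mdist_le arc) => //; lra.
    have : `|t1 - z| < e by rewrite ltr_norml; apply/andP; split; lra.
    rewrite /e; lra.
  rewrite integral_cst//= lebesgue_measure_itv/= lte_fin st.
  by rewrite gt0_mulye// -EFinB lte_fin subr_gt0.
(* The curve stays in the closed ball of radius r, hence in the open ball of radius 2r, where the
   restricted function is still u. *)
have in_r' t : 0 <= t <= l -> gamma t \in (ball x (2 * r) : set X).
  move=> tl; rewrite inE ballEmdist/= ltNge; apply/negP => h; apply: in_r.
  by exists t => //; lra.
rewrite !patchE !in_r' ?lexx ?(ltW l0)//.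
apply: (le_trans (gu _ _ arc)); apply: ge0_le_integral => //.
- exact: arc_measurable arc mg.
- exact: arc_measurable arc mg'.
- by move=> t _; rewrite /g'; case: ifP => // _; exact: leey.
Qed.

End upper_gradient_localization.

Section truncation.
Context (R : realType).
Implicit Types (s t : R) (x y : \bar R).

(** The infinite values are treated apart because [fine] sends them to 0. The result is real even
    when u is not. *)
Definition truncation s t x : R :=
  if x == +oo%E then 1 else if x == -oo%E then 0 else clamp 1 ((fine x - s) / t).

Lemma truncation_EFin s t (r : R) : truncation s t r%:E = clamp 1 ((r - s) / t).
Proof. by []. Qed.

Lemma truncation_ge0 s t x : 0 <= truncation s t x.
Proof.
by case: x => [r||]//; rewrite truncation_EFin; have /andP[] := clamp_in ((r - s) / t) ler01.
Qed.

Lemma truncation_le1 s t x : truncation s t x <= 1.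
Proof.
by case: x => [r||]//; rewrite truncation_EFin; have /andP[] := clamp_in ((r - s) / t) ler01.
Qed.

Lemma truncation0 s t x : 0 < t -> (x <= s%:E)%E -> truncation s t x = 0.
Proof.
move=> t0; case: x => [r||]//.
rewrite lee_fin truncation_EFin => rs; apply: max_l.
by rewrite ge_min pmulr_lle0 ?invr_gt0// subr_le0 rs orbT.
Qed.

Lemma truncation1 s t x : 0 < t -> ((s + t)%:E <= x)%E -> truncation s t x = 1.
Proof.
move=> t0; case: x => [r||]//.
rewrite lee_fin truncation_EFin => rs; rewrite /clamp min_l ?max_r//.
by rewrite ler_pdivlMr// mul1r lerBrDl.
Qed.

(** When x or y is infinite the right-hand side is +oo, even for x = y, as [+oo - +oo] is [-oo]. *)
Lemma truncation_lipschitz s t x y : 0 < t ->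
  (`|truncation s t x - truncation s t y|%:E <= `|x - y| * t^-1%:E)%E.
Proof.
move=> t0; have it0 : (0 < t^-1%:E)%E by rewrite lte_fin invr_gt0.
case: x => [r||]; case: y => [r'||] /=; rewrite ?(gt0_mulye it0) ?leey//.
rewrite !truncation_EFin -EFinM lee_fin.
have tV : t^-1 = `|t^-1| by rewrite gtr0_norm ?invr_gt0.
rewrite [leRHS](_ : _ = `|(r - r') * t^-1|); last by rewrite normrM -tV.
rewrite [X in _ <= `|X|](_ : _ = (r - s) / t - (r' - s) / t); last by rewrite -mulrBl; congr (_ / _); lra.
exact: clamp_lipschitz.
Qed.

Lemma measurable_truncation s t : measurable_fun [set: \bar R] (truncation s t).
Proof.
have m1 (z : \bar R) : measurable_fun [set: \bar R] (fun x => x == z).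
  apply: (measurable_fun_bool true); rewrite setTI.
  rewrite (_ : _ @^-1` _ = [set z]); first exact: emeasurable_set1.
  by apply/seteqP; split => x /= /eqP.
do 2 apply: measurable_fun_ifT => //.
apply: measurable_maxr => //; apply: measurable_minr => //.
apply: measurable_funM => //; apply: measurable_funB => //.
Qed.

End truncation.

(** * Scale-invariant form of the Poincare inequality of X *)

Section mean_real.
Context d (R : realType) (X : borelMetricType d R) (mu : {measure set X -> \bar R}).
Local Open Scope ereal_scope.

Lemma mean_real (A : set X) (f : X -> \bar R) (V : R) : (0 < V)%R -> mu A = V%:E ->
  mean mu A f = (\int[mu]_(x in A) f x) * V^-1%:E.
Proof. by move=> V0 AV; rewrite /mean AV inver gt_eqF. Qed.

Lemma mean_le (A : set X) (f : X -> \bar R) (V m : R) : (0 < V)%R -> mu A = V%:E ->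
  (mean mu A f <= m%:E) = (\int[mu]_(x in A) f x <= (m * V)%:E).
Proof. by move=> V0 AV; rewrite (mean_real _ V0 AV) lee_pdivrMr// EFinM. Qed.

Lemma diameter_ball_le (x : X) (r : R) : diameter (ball x r) <= (2 * r)%:E.
Proof.
apply: ge_ereal_sup => _ [[y z] [/= xy xz] <-]; rewrite lee_fin.
move: xy xz; rewrite !ballEmdist/= => xy xz.
by have := metric_triangle y x z; rewrite (metric_sym y x); lra.
Qed.

End mean_real.

Lemma poweR_inv_le (R : realType) (x : \bar R) (q M : R) : 0 < q -> 0 <= M ->
  (0 <= x)%E -> (x <= (M `^ q)%:E)%E -> (x `^ q^-1 <= M%:E)%E.
Proof.
move=> q0 M0 x0 xM.
have -> : M%:E = ((M `^ q)%:E `^ q^-1)%E.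
  by rewrite poweR_EFin -powRrM mulfV ?gt_eqF// powRr1.
by apply: gt0_ler_poweR => //; rewrite ?invr_ge0 ?(ltW q0)// in_itv/= ?leey ?x0// lee_fin powR_ge0.
Qed.

Section poincare_local.
Context d (R : realType) (X : borelMetricType d R) (mu : {measure set X -> \bar R}).
Variables (Q CA : R).
Hypotheses (Q0 : 0 < Q) (CA1 : 1 <= CA)
  (muB : forall (x : X) (r : R), 0 < r ->
    ((CA^-1 * r `^ Q)%:E <= mu (ball x r) <= (CA * r `^ Q)%:E)%E).

Let CA0 : 0 < CA. Proof. exact: lt_le_trans ltr01 CA1. Qed.

Lemma ball_real (x : X) (r : R) : 0 < r ->
  exists V : R, [/\ mu (ball x r) = V%:E, 0 < V, CA^-1 * r `^ Q <= V & V <= CA * r `^ Q].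
Proof.
move=> r0; have := muB x r0; case: (mu _) => [V||] /andP[] // h1 h2.
exists V; rewrite !lee_fin in h1 h2; split => //.
by apply: lt_le_trans h1; rewrite mulr_gt0 ?powR_gt0// invr_gt0.
Qed.

(** The hypothesis says that g has size tau at scale r in the q-mean. [upper_gradient_localize]
    makes u globally integrable without changing u or g on the balls that matter; c is the mean of
    u. *)
Lemma poincare_local (q : R) : 0 < q -> poincare_inequality mu q ->
  exists C lam : R, [/\ 0 < C, 1 <= lam & forall (x : X) (r tau : R) (u g : X -> \bar R),
    0 < r -> 0 < tau -> (forall rho, mu.-integrable (ball x rho) u) ->
    upper_gradient g u ->
    (\int[mu]_(y in ball x (lam * r)) (g y `^ q) <= (r `^ Q * tau `^ q)%:E)%E ->
    exists c : R,
      (\int[mu]_(y in ball x r) `|u y - c%:E| <= (C * r `^ Q * (r * tau))%:E)%E].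
Proof.
move=> q0 [CP [lam [CP0 lam1 PI]]].
exists (2 * CP * CA * CA `^ q^-1), lam; split => //.
  by rewrite !mulr_gt0 ?powR_gt0.
move=> x r tau u g r0 tau0 iu gu gint.
have lr0 : 0 < lam * r by rewrite mulr_gt0//; lra.
have := PI x r _ _ r0 ((integrable_mkcond u (measurable_mball x _)).1 (iu _))
  (upper_gradient_localize x lr0 gu).
set B := ball x r; set u' := u \_ _; set g' := fun _ => _ => /= H.
have [V [VE V0 _ VC]] := ball_real x r0.
have [W [WE W0 WC _]] := ball_real x lr0.
have uE y : B y -> u' y = u y.
  move=> By; rewrite /u' patchE mem_set//; apply: (le_ball _ By).
  by rewrite (@le_trans _ _ (lam * r))//; [rewrite ler_peMl// ltW|lra].
have mfin : mean mu B u' \is a fin_num.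
  rewrite (mean_real _ V0 VE) fin_numM//; apply: integrable_fin_num => //.
    exact: measurable_mball.
  apply: (integrableS measurableT) => //; first exact: measurable_mball.
  by apply/(integrable_mkcond u (measurable_mball _ _)); exact: iu.
exists (fine (mean mu B u')); rewrite EFinN fineK//.
have -> : (\int[mu]_(y in B) `|u y - mean mu B u'| =
    \int[mu]_(y in B) `|u' y - mean mu B u'|)%E.
  by apply: eq_integral => y; rewrite inE => /uE ->.
have gE : (\int[mu]_(y in ball x (lam * r)) g' y =
    \int[mu]_(y in ball x (lam * r)) g y `^ q)%E.
  by apply: eq_integral => y yB; rewrite /g' yB.
have gm : (mean mu (ball x (lam * r)) g' `^ q^-1 <=
    (CA `^ q^-1 * tau)%:E)%E.
  apply: poweR_inv_le => //.
  - by rewrite mulr_ge0 ?powR_ge0// ltW.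
  - by rewrite (mean_real _ W0 WE) mule_ge0 ?lee_fin ?invr_ge0 ?(ltW W0)//;
      apply: integral_ge0 => y _; exact: poweR_ge0.
  rewrite (mean_le _ _ W0 WE) gE; apply: (le_trans gint); rewrite lee_fin.
  rewrite powRM ?powR_ge0 ?(ltW tau0)// -powRrM mulVf ?gt_eqF// powRr1 ?(ltW CA0)//.
  rewrite mulrAC ler_wpM2r ?powR_ge0//.
  have rW : r `^ Q <= (lam * r) `^ Q.
    by rewrite ge0_ler_powR ?nnegrE ?(ltW Q0) ?(ltW r0) ?(ltW lr0)// ler_peMl// ltW.
  apply: (le_trans rW); rewrite -(@ler_pM2l _ CA^-1) ?invr_gt0//.
  by rewrite mulrA mulVf ?mul1r// gt_eqF.
have : (mean mu B (fun y => `|u' y - mean mu B u'|) <=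
    CP%:E * (2 * r)%:E * (CA `^ q^-1 * tau)%:E)%E.
  apply: (le_trans H); apply: lee_pmul => //.
  - apply: mule_ge0; first by rewrite lee_fin ltW.
    apply: (@le_trans _ _ (mdist x x)%:E); first by rewrite mdistxx.
    by apply: ereal_sup_ubound; exists (x, x) => //; split; exact: ballxx.
  - exact: poweR_ge0.
  - by rewrite lee_pmul2l ?lte_fin// diameter_ball_le.
rewrite -!EFinM (mean_le _ _ V0 VE) => /le_trans; apply; rewrite lee_fin.
have P0 : 0 <= CP * (2 * r) * (CA `^ q^-1 * tau).
  by rewrite !mulr_ge0 ?powR_ge0 ?(ltW CP0) ?(ltW r0) ?(ltW tau0).
apply: (le_trans (ler_wpM2l P0 VC)).
by apply: eq_ler; ring.
Qed.

End poincare_local.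
(** * Truncations and logarithmic cutoffs *)

Section cutoff.
Context (d : measure_display) (R : realType) (X : borelMetricType d R).
Local Notation borelX := (g_sigma_algebraType (@open X)).

(* A curve that meets the ball where eta vanishes is controlled by psi alone, *)
(* so that the gradient of v is only needed outside of that ball.             *)
Lemma upper_gradient_cutoff (a : X) (b : R) (v eta psi : X -> R) (g : X -> \bar R) :
  (forall y, 0 <= v y <= 1) -> (forall y, 0 <= eta y <= 1) ->
  (forall y, mdist y a <= b -> eta y = 0) ->
  measurable_fun [set: borelX] psi -> (forall y, 0 <= psi y) ->
  (forall l gamma, arc_length_curve l gamma -> forall s t, 0 <= s -> s <= t -> t <= l ->
    (`|eta (gamma t) - eta (gamma s)|%:E <=
      \int[lebesgue_measure]_(x in `]s, t]) (psi (gamma x))%:E)%E) ->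
  upper_gradient g (EFin \o v) ->
  upper_gradient (fun y => (if (b < mdist y a)%R then g y else 0) + (psi y)%:E)%E
    (fun y => (v y * eta y)%:E).
Proof.
move=> v01 eta01 eta0 mpsi psi0 etapsi [mg g0 gv].
have mb : measurable_fun [set: borelX] (fun y => b < mdist y a).
  rewrite (_ : (fun _ => _) = (fun y => y \in [set y : X | b < mdist y a])); last first.
    by apply/funext => y; apply/idP/idP => [h|/set_mem]//; exact: mem_set.
  by apply: measurable_mem; apply: open_borel; exact: open_mdist_gt.
set G := fun _ => _.
have mpsiE : measurable_fun [set: borelX] (EFin \o psi) by exact/measurable_EFinP.
have G0 y : (0 <= G y)%E by rewrite /G adde_ge0 ?lee_fin//; case: ifP.
have mG : measurable_fun [set: borelX] G.
  by apply: emeasurable_funD => //; apply: measurable_fun_ifT.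
split => // l gamma arc; have l0 : 0 < l by case: arc.
have psiG s t : 0 <= s -> t <= l ->
  (\int[lebesgue_measure]_(x in `]s, t]) (psi (gamma x))%:E <=
   \int[lebesgue_measure]_(x in `[0%R, l]) G (gamma x))%E.
  move=> s0 tl.
  apply: (@le_trans _ _ (\int[lebesgue_measure]_(x in `[0%R, l]) (psi (gamma x))%:E)%E).
    apply: ge0_subset_integral => //.
    - exact: arc_measurable arc mpsiE.
    - by move=> x _; rewrite lee_fin.
    - move=> x /=; rewrite !in_itv/= => /andP[sx xt].
      by rewrite (le_trans s0 (ltW sx)) (le_trans xt tl).
  apply: ge0_le_integral => //.
  - by move=> x _; rewrite lee_fin.
  - exact: arc_measurable arc mpsiE.
  - exact: arc_measurable arc mG.
  - by move=> x _; rewrite /G leeDr//; case: ifP.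
(* If the curve meets the small ball, then [eta] at either end is at most the integral of [psi]. The
   two products have values between 0 and the respective [eta], so this bounds their difference. *)
have [[t0 /andP[t00 t0l] t0b]|out] :=
    pselect (exists2 t, 0 <= t <= l & mdist (gamma t) a <= b).
  have etal : ((eta (gamma l))%:E <= \int[lebesgue_measure]_(x in `[0%R, l]) G (gamma x))%E.
    apply: le_trans (psiG t0 l t00 (lexx _)); apply: le_trans (etapsi _ _ arc _ _ t00 t0l (lexx _)).
    by rewrite (eta0 _ t0b) subr0 lee_fin ler_norm.
  have eta0' : ((eta (gamma 0))%:E <= \int[lebesgue_measure]_(x in `[0%R, l]) G (gamma x))%E.
    apply: le_trans (psiG 0 t0 (lexx _) t0l); apply: le_trans (etapsi _ _ arc _ _ (lexx _) t00 t0l).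
    by rewrite (eta0 _ t0b) sub0r normrN lee_fin ler_norm.
  have [le|le] := leP (v (gamma 0) * eta (gamma 0)) (v (gamma l) * eta (gamma l)).
    apply: le_trans etal; rewrite -EFinB abse_EFin lee_fin distrC ger0_norm ?subr_ge0//.
    have := v01 (gamma 0); have := v01 (gamma l); have := eta01 (gamma 0); have := eta01 (gamma l).
    nra.
  apply: le_trans eta0'; rewrite -EFinB abse_EFin lee_fin ger0_norm ?subr_ge0 ?(ltW le)//.
  have := v01 (gamma 0); have := v01 (gamma l); have := eta01 (gamma 0); have := eta01 (gamma l).
  nra.
(* Otherwise the gradient is g plus [psi] all along the curve, and the product rule suffices. *)
apply: (@le_trans _ _ (`|(v (gamma 0%R))%:E - (v (gamma l))%:E| +
    `|eta (gamma l) - eta (gamma 0%R)|%:E)%E).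
  rewrite -!EFinB abse_EFin -EFinD lee_fin.
  rewrite [X in `|X| <= _](_ : _ = (v (gamma 0) - v (gamma l)) * eta (gamma 0) +
     v (gamma l) * (eta (gamma 0) - eta (gamma l))); last by ring.
  apply: (le_trans (ler_normD _ _)); rewrite !normrM [X in _ + X <= _]mulrC (distrC (eta _)).
  apply: lerD; apply: ler_piMr => //.
    by have /andP[? ?] := eta01 (gamma 0); rewrite ger0_norm.
  by have /andP[? ?] := v01 (gamma l); rewrite ger0_norm.
have GE : (\int[lebesgue_measure]_(x in `[0%R, l]) G (gamma x) =
    \int[lebesgue_measure]_(x in `[0%R, l]) g (gamma x) +
    \int[lebesgue_measure]_(x in `[0%R, l]) (psi (gamma x))%:E)%E.
  rewrite -ge0_integralD//; last 3 first.
  - exact: arc_measurable arc mg.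
  - by move=> x _; rewrite lee_fin.
  - exact: arc_measurable arc mpsiE.
  - apply: eq_integral => x; rewrite inE/= in_itv/= => xl; rewrite /G ifT//.
    by rewrite ltNge; apply/negP => h; apply: out; exists x.
rewrite GE leeD//; first exact: gv.
apply: le_trans (etapsi _ _ arc _ _ (lexx _) (ltW l0) (lexx _)) _.
apply: ge0_subset_integral => //.
- exact: arc_measurable arc mpsiE.
- by move=> x _; rewrite lee_fin.
- exact: subset_itv_oc_cc.
Qed.

Lemma upper_gradient_truncation (g u : X -> \bar R) (s t : R) : 0 < t ->
  upper_gradient g u ->
  upper_gradient (fun y => g y * t^-1%:E)%E (EFin \o truncation s t \o u).
Proof.
move=> t0 [mg g0 gu]; split.
- exact: emeasurable_funM.
- by move=> y; rewrite mule_ge0// lee_fin invr_ge0 ltW.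
move=> l gamma arc; rewrite -EFinB abse_EFin.
apply: (le_trans (truncation_lipschitz _ _ _ t0)).
rewrite ge0_integralZr//.
- by apply: lee_wpmul2r; [rewrite lee_fin invr_ge0 ltW|exact: gu].
- exact: arc_measurable arc mg.
- by rewrite lee_fin invr_ge0 ltW.
Qed.

Variables (a : X) (b : R) (n : nat).
Hypotheses (b0 : 0 < b) (n0 : (0 < n)%N).

(** Logarithmic in the distance to a: it vanishes up to distance b and equals 1 from distance
    2^(n+1) b on. Its slope is inversely proportional both to n and to b + d(y, a). *)
Definition log_cutoff (y : X) : R :=
  clamp 1 ((n%:R * ln 2)^-1 * ln ((b + mdist y a) / (2 * b))).

Definition log_cutoff_slope (y : X) : R := (n%:R * ln 2)^-1 / (b + mdist y a).

Let k := (n%:R * ln 2 : R)^-1.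

Let k0 : 0 < k.
Proof. by rewrite invr_gt0 mulr_gt0 ?ltr0n// ln_gt0// ltr1n. Qed.

Let bd y : 0 < b + mdist y a. Proof. by rewrite ltr_pwDl// mdist_ge0. Qed.

Lemma log_cutoff_bounds y : 0 <= log_cutoff y <= 1.
Proof. exact: clamp_in. Qed.

Lemma log_cutoff0 y : mdist y a <= b -> log_cutoff y = 0.
Proof.
move=> yb; rewrite /log_cutoff /clamp max_l// ge_min; apply/orP; right.
rewrite pmulr_rle0// ln_le0// ler_pdivrMr ?mulr_gt0// mul1r; lra.
Qed.

Lemma log_cutoff1 y : 2 ^+ n.+1 * b <= mdist y a -> log_cutoff y = 1.
Proof.
move=> yb; rewrite /log_cutoff /clamp min_l ?max_r//.
rewrite ler_pdivlMl ?mulr1; last by rewrite -invr_gt0.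
rewrite mulr_natl -lnXn// ler_ln ?posrE ?exprn_gt0 ?divr_gt0 ?mulr_gt0//.
rewrite ler_pdivlMr ?mulr_gt0// mulrA -exprSr; have := b0; lra.
Qed.

Lemma log_cutoff_slope_ge0 y : 0 <= log_cutoff_slope y.
Proof. by rewrite divr_ge0// ltW. Qed.

Let slope_lip x y :
  log_cutoff_slope x - log_cutoff_slope y <= k / b ^+ 2 * mdist x y.
Proof.
rewrite /log_cutoff_slope -/k.
have := bd x; have := bd y; set A := b + mdist y a; set B := b + mdist x a => A0 B0.
rewrite [leLHS](_ : _ = k * ((A - B) / (A * B))); last by field; rewrite !gt_eqF.
rewrite -mulrA ler_pM2l// [leRHS]mulrC.
have dAB : A - B <= mdist x y.
  by rewrite /A /B; have := metric_triangle y x a; rewrite (metric_sym y x); lra.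
have [AB|AB] := leP A B.
  apply: (@le_trans _ _ 0); first by rewrite pmulr_lle0 ?invr_gt0 ?mulr_gt0// subr_le0.
  by rewrite mulr_ge0 ?mdist_ge0// invr_ge0 sqr_ge0.
apply: ler_pM => //; first by rewrite subr_ge0 ltW.
  by rewrite invr_ge0 mulr_ge0// ltW.
have bA : b <= A by rewrite lerDl mdist_ge0.
have bB : b <= B by rewrite lerDl mdist_ge0.
by rewrite lef_pV2 ?posrE ?mulr_gt0// expr2 ler_pM// ltW.
Qed.

Lemma log_cutoff_slope_continuous : continuous log_cutoff_slope.
Proof. exact: lipschitz_metric_continuous slope_lip. Qed.

(** Clamping contracts, and ln p - ln q <= (p - q) / q gives the derivative of the logarithm to
    first order along the 1-Lipschitz curve; [subadditive_quadratic_le0] removes the quadratic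
    error. *)
Lemma log_cutoff_arc l gamma : arc_length_curve l gamma ->
  forall s t, 0 <= s -> s <= t -> t <= l ->
    (`|log_cutoff (gamma t) - log_cutoff (gamma s)|%:E <=
      \int[lebesgue_measure]_(x in `]s, t]) (log_cutoff_slope (gamma x))%:E)%E.
Proof.
move=> arc s t s0 st tl; have [gamma' lip ext] := arc_extension arc.
have -> : (\int[lebesgue_measure]_(x in `]s, t]) (log_cutoff_slope (gamma x))%:E =
    \int[lebesgue_measure]_(x in `]s, t]) (log_cutoff_slope (gamma' x))%:E)%E.
  apply: eq_integral => x; rewrite inE/= in_itv/= => /andP[sx xt].
  by rewrite ext// (le_trans xt tl) (le_trans s0 (ltW sx)).
rewrite -(ext t) ?(le_trans s0 st)// -(ext s) ?s0 ?(le_trans st tl)//.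
pose phi := log_cutoff_slope \o gamma'.
pose K := k / b ^+ 2; have K0 : 0 <= K by rewrite divr_ge0 ?sqr_ge0// ltW.
have phi_lip x y : x <= y -> `|phi y - phi x| <= K * (y - x).
  move=> xy; have h := ler_wpM2l K0 (lip _ _ xy).
  have h1 := slope_lip (gamma' x) (gamma' y).
  have h2 := slope_lip (gamma' y) (gamma' x); rewrite metric_sym in h2.
  rewrite -/K in h1 h2; rewrite ler_norml /phi/=; apply/andP; split; lra.
have cphi : continuous phi by apply: lipschitz_continuous phi_lip.
rewrite Rintegral_itv_EFin// lee_fin; apply: (le_trans (clamp_lipschitz _ _ _)).
rewrite -mulrBr normrM (gtr0_norm k0) -/k.
have lnE x : ln ((b + mdist (gamma' x) a) / (2 * b)) =
    ln (b + mdist (gamma' x) a) - ln (2 * b) :> R.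
  by rewrite ln_div// posrE ?mulr_gt0.
rewrite !lnE opprB addrA subrK -subr_le0.
apply: (@subadditive_quadratic_le0 _ (fun s t =>
  k * `|ln (b + mdist (gamma' t) a) - ln (b + mdist (gamma' s) a)| -
  \int[lebesgue_measure]_(x in `]s, t]) phi x) (2 * K) s t) => //.
  move=> x y z _ xy yz _; rewrite (Rintegral_itvD cphi xy yz).
  have : `|ln (b + mdist (gamma' z) a) - ln (b + mdist (gamma' x) a)| <=
      `|ln (b + mdist (gamma' z) a) - ln (b + mdist (gamma' y) a)| +
      `|ln (b + mdist (gamma' y) a) - ln (b + mdist (gamma' x) a)|.
    by apply: le_trans (ler_normD _ _); rewrite addrA subrK.
  move=> /(ler_wpM2l (ltW k0)); rewrite mulrDr; lra.
move=> x y _ xy _.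
have lnB_le p q : p <= q + (y - x) -> 0 < p -> 0 < q -> ln p - ln q <= (y - x) / q.
  move=> pq p0 q0; rewrite -ln_div ?posrE//.
  have pqE : p / q = 1 + (p / q - 1) by rewrite addrC subrK.
  rewrite pqE; apply: (@le_trans _ _ (p / q - 1)).
    by apply: le_ln1Dx; rewrite ltrBrDr addNr divr_gt0.
  rewrite -[X in _ - X](divff (lt0r_neq0 q0)) -mulrBl ler_pM2r ?invr_gt0//; lra.
have I_ge : (phi x - K * (y - x)) * (y - x) <=
    \int[lebesgue_measure]_(x0 in `]x, y]) phi x0.
  apply: Rintegral_itv_ge => // z /andP[xz zy].
  have := phi_lip _ _ xz; rewrite ler_norml => /andP[+ _].
  have := ler_wpM2l K0 (lerB zy (lexx x)); lra.
have dxy := lip _ _ xy.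
have t1 := metric_triangle (gamma' x) (gamma' y) a.
have t2 := metric_triangle (gamma' y) (gamma' x) a.
rewrite (metric_sym (gamma' y) (gamma' x)) in t2.
have yx0 : 0 <= y - x by rewrite subr_ge0.
have E1 : k * (ln (b + mdist (gamma' y) a) - ln (b + mdist (gamma' x) a)) <=
    phi x * (y - x).
  rewrite /phi/= /log_cutoff_slope -/k -mulrA (ler_pM2l k0) mulrC.
  by apply: lnB_le => //; lra.
have E2 : k * (ln (b + mdist (gamma' x) a) - ln (b + mdist (gamma' y) a)) <=
    phi y * (y - x).
  rewrite /phi/= /log_cutoff_slope -/k -mulrA (ler_pM2l k0) mulrC.
  by apply: lnB_le => //; lra.
have E3 : phi y * (y - x) <= (phi x + K * (y - x)) * (y - x).
  apply: ler_wpM2r => //; have := phi_lip _ _ xy; rewrite ler_norml => /andP[_]; lra.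
have E4 : phi x * (y - x) <= (phi x + K * (y - x)) * (y - x).
  by apply: ler_wpM2r => //; rewrite lerDl mulr_ge0.
have : k * `|ln (b + mdist (gamma' y) a) - ln (b + mdist (gamma' x) a)| <=
    (phi x + K * (y - x)) * (y - x).
  rewrite -[X in X * _](gtr0_norm k0) -normrM ler_norml; apply/andP; split; lra.
rewrite expr2; lra.
Qed.

End cutoff.

(** * Elementary bounds for powers and integrals *)

Lemma powR_ge1 (R : realType) (x r : R) : 1 <= x -> 0 <= r -> 1 <= x `^ r.
Proof.
by move=> x1 r0; rewrite -[leLHS](powRr0 x) ler_powR.
Qed.

Lemma powR_invl (R : realType) (x r : R) : 0 <= x -> x^-1 `^ r = (x `^ r)^-1.
Proof. by move=> x0; rewrite -powR_inv1// -powRrM mulN1r powRN. Qed.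

Lemma exists_nat_powR (R : realType) (A s : R) : 0 < s ->
  exists2 n : nat, (0 < n)%N & A <= n%:R `^ s.
Proof.
move=> s0; exists (Num.truncn (`|A| `^ s^-1)).+1 => //.
apply: (le_trans (ler_norm _)).
rewrite [leLHS](_ : _ = (`|A| `^ s^-1) `^ s); last first.
  by rewrite -powRrM mulVf ?powRr1// gt_eqF.
by rewrite ge0_ler_powR ?nnegrE ?powR_ge0 ?(ltW s0)// ltW// truncnS_gt.
Qed.

Lemma exists_nat_exp2 (R : realType) (A : R) : exists n : nat, A <= 2 ^+ n.
Proof.
exists (Num.truncn A).+1; apply: (@le_trans _ _ (Num.truncn A).+1%:R).
  exact/ltW/truncnS_gt.
by rewrite -natrX ler_nat ltnW// ltn_expl.
Qed.

Section integral_bounds.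
Context d (T : measurableType d) (R : realType) (mu : {measure set T -> \bar R}).
Local Open Scope ereal_scope.

Lemma ge0_integral_le_cst (A : set T) (f : T -> \bar R) (c m : R) : measurable A ->
  measurable_fun A f -> (forall x, A x -> 0 <= f x) -> (0 <= c)%R ->
  (forall x, A x -> f x <= c%:E) -> mu A <= m%:E ->
  \int[mu]_(x in A) f x <= (c * m)%:E.
Proof.
move=> mA mf f0 c0 fc Am.
apply: (@le_trans _ _ (\int[mu]_(x in A) (cst c%:E x))).
  by apply: ge0_le_integral => // x Ax; rewrite lee_fin.
by rewrite integral_cst// EFinM lee_wpmul2l// lee_fin.
Qed.

Lemma ge0_integral_setU_le (A B : set T) (f : T -> \bar R) : measurable A ->
  measurable B -> measurable_fun (A `|` B) f -> (forall x, (A `|` B) x -> 0 <= f x) ->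
  \int[mu]_(x in A `|` B) f x <= \int[mu]_(x in A) f x + \int[mu]_(x in B) f x.
Proof.
move=> mA mB mf f0.
rewrite -(setDUK (@subsetUl _ A B)) ge0_integral_setU//.
- apply: leeD => //; apply: ge0_subset_integral => //.
  + by apply: measurableD => //; exact: measurableU.
  + by apply: measurable_funS mf => //; exact: measurableU.
  + by move=> x Bx; apply: f0; right.
  + by move=> x [[]].
- by apply: measurableD => //; exact: measurableU.
- by rewrite setDUK.
- by move=> x; rewrite setDUK//; exact: f0.
- by rewrite disj_set2E setDIK.
Qed.

Lemma poweRD_le (x y : \bar R) (q : R) : (0 < q)%R -> 0 <= x -> 0 <= y ->
  (x + y) `^ q <= (2 `^ q)%:E * (x `^ q + y `^ q).
Proof.
move=> q0.
wlog xy : x y / x <= y.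
  move=> H x0 y0; have [xy|/ltW yx] := leP x y; first exact: H.
  by rewrite addeC [in leRHS]addeC; exact: H.
move=> x0 y0; apply: (@le_trans _ _ ((2%:E * y) `^ q)).
  apply: gt0_ler_poweR; rewrite ?in_itv/= ?leey ?andbT ?adde_ge0 ?mule_ge0 ?(ltW q0)//.
  by rewrite -[2%R]/(1 + 1)%R EFinD ge0_muleDl// mul1e leeD.
rewrite poweRM// poweR_EFin lee_wpmul2l// ?lee_fin ?powR_ge0//.
by rewrite leeDr// poweR_ge0.
Qed.

End integral_bounds.

(** * Poincare inequalities on annuli *)

Section annulus.
Context d (R : realType) (X : borelMetricType d R) (mu : {measure set X -> \bar R}).
Variables (Q CA : R) (a : X).
Hypotheses (Q0 : 0 < Q) (CA1 : 1 <= CA)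
  (muB : forall (x : X) (r : R), 0 < r ->
    ((CA^-1 * r `^ Q)%:E <= mu (ball x r) <= (CA * r `^ Q)%:E)%E).

Let CA0 : 0 < CA. Proof. exact: lt_le_trans ltr01 CA1. Qed.

Lemma measurable_radial (f : R -> R) : measurable_fun [set: R] f ->
  measurable_fun [set: X] (fun y => f (mdist y a)).
Proof. by move=> mf; exact: measurableT_comp mf (mdist_measurable a). Qed.

(* As q <= Q every dyadic shell contributes at most about (2^k b)^(Q - q). *)
Lemma log_energy (q b : R) (k : nat) : 0 < q -> q <= Q -> 0 < b ->
  (\int[mu]_(y in ball a (2 ^+ k * b)) ((b + mdist y a) `^ (- q))%:E <=
   (CA * 2 `^ Q * k.+1%:R * (2 ^+ k * b) `^ (Q - q))%:E)%E.
Proof.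
move=> q0 qQ b0.
have mf : measurable_fun [set: X] (fun y : X => ((b + mdist y a) `^ (- q))%:E).
  apply/measurable_EFinP; apply: (measurable_radial (f := fun t => (b + t) `^ (- q))).
  by apply: (measurableT_comp (measurable_powR _)) => //; exact: measurable_funD.
have pw_ge0 (y : X) : (0 <= ((b + mdist y a) `^ (- q))%:E)%E by rewrite lee_fin powR_ge0.
have pw_le c y : 0 < c -> c <= b + mdist y a -> (b + mdist y a) `^ (- q) <= c `^ (- q).
  move=> c0 cy; rewrite !powRN lef_pV2 ?posrE ?powR_gt0 ?(lt_le_trans c0)//.
  by rewrite ge0_ler_powR ?nnegrE ?(ltW q0) ?(ltW c0)// (le_trans (ltW c0)).
elim: k => [|k ih].
  rewrite !expr0 !mul1r mulr1.
  apply: (@le_trans _ _ (b `^ (- q) * (CA * b `^ Q))%:E).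
    apply: ge0_integral_le_cst => //.
    - exact: measurable_mball.
    - exact: measurable_funTS.
    - exact: powR_ge0.
    - by move=> y _; rewrite lee_fin pw_le// lerDl mdist_ge0.
    - by have /andP[] := muB a b0.
  rewrite lee_fin [leLHS](_ : _ = CA * b `^ (Q - q)); last first.
    by rewrite powRD ?(gt_eqF b0) ?implybT//; ring.
  rewrite ler_wpM2r ?powR_ge0// ler_peMr ?(ltW CA0)//.
  by rewrite powR_ge1 ?(ltW Q0)// ler1n.
set c := 2 ^+ k * b in ih *; have c0 : 0 < c by rewrite mulr_gt0 ?exprn_gt0.
rewrite exprS -mulrA -/c.
have -> : ball a (2 * c) = ball a c `|` (ball a (2 * c) `\` ball a c).
  by rewrite setDUK//; apply: le_ball; lra.
apply: (le_trans (ge0_integral_setU_le _ _ _ _ _)) => //.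
- exact: measurable_mball.
- by apply: measurableD; exact: measurable_mball.
- exact: measurable_funTS.
have step : (\int[mu]_(y in ball a (2 * c) `\` ball a c) ((b + mdist y a) `^ (- q))%:E <=
    (c `^ (- q) * (CA * (2 * c) `^ Q))%:E)%E.
  apply: ge0_integral_le_cst => //.
  - by apply: measurableD; exact: measurable_mball.
  - exact: measurable_funTS.
  - exact: powR_ge0.
  - move=> y [_]; rewrite ball_sphereE/= => /negP; rewrite -leNgt => cy.
    by rewrite lee_fin pw_le//; lra.
  - apply: (@le_trans _ _ (mu (ball a (2 * c)))).
      apply: le_measure; rewrite ?inE; last exact: subDsetl.
        by apply: measurableD; exact: measurable_mball.
      exact: measurable_mball.
    by have /andP[] := muB a (mulr_gt0 (ltr0Sn _ 1) c0).
apply: (le_trans (leeD ih step)); rewrite -EFinD lee_fin.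
have -> : c `^ (- q) * (CA * (2 * c) `^ Q) = CA * 2 `^ Q * c `^ (Q - q).
  by rewrite powRM ?(ltW c0)// powRD ?(gt_eqF c0) ?implybT//; ring.
rewrite [leLHS](_ : _ = CA * 2 `^ Q * k.+2%:R * c `^ (Q - q)); last first.
  by rewrite -[k.+2%:R]natr1; ring.
rewrite ler_wpM2l ?mulr_ge0 ?powR_ge0 ?(ltW CA0)//.
rewrite ge0_ler_powR ?nnegrE ?subr_ge0 ?(ltW c0) ?mulr_ge0 ?(ltW c0)//; lra.
Qed.

Variable q : R.
Hypotheses (q1 : 1 < q) (qQ : q <= Q) (X_poincare : poincare_inequality mu q).

Let q0 : 0 < q. Proof. exact: lt_trans ltr01 q1. Qed.

(** The slope contributes n^(-q) and the number of dyadic shells about n, so the energy of the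
    cutoff is of order n^(1-q), which is small as q > 1. Both sides scale like M^(Q-q), so n does
    not depend on M. *)
Lemma exists_cutoff_length (j : nat) (kappa : R) : 0 < kappa ->
  exists2 n : nat, (0 < n)%N & forall M : R, 0 < M ->
    2 `^ q * (((n%:R * ln 2)^-1) `^ q * (CA * 2 `^ Q * (n.+1 + j).+1%:R *
      (2 ^+ j * M) `^ (Q - q))) <= M `^ Q * (kappa / M) `^ q / 2.
Proof.
move=> kappa0; pose A := 2 `^ q * (ln 2)^-1 `^ q * (CA * 2 `^ Q * (j.+3)%:R * (2 ^+ j) `^ (Q - q)).
have ln20 : 0 < ln 2 :> R by rewrite ln_gt0// ltr1n.
have A0 : 0 <= A.
  by rewrite /A !mulr_ge0 ?powR_ge0// ltW.
have q10 : 0 < q - 1 by rewrite subr_gt0.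
have [n n0 hn] := exists_nat_powR (2 * A / kappa `^ q) q10.
exists n => // M M0; have nR0 : 0 < n%:R :> R by rewrite ltr0n.
have nj : (n.+1 + j).+1%:R <= n%:R * (j.+3)%:R :> R.
  rewrite -natrM ler_nat; case: n n0 {hn nR0} => // n _.
  by rewrite (_ : (n.+2 + j).+1 = j.+3 + n)%N ?mulSn ?leq_add2l ?leq_pmulr// !addSn addnC.
have kq0 : 0 < kappa `^ q by rewrite powR_gt0.
have hn' : A / n%:R `^ (q - 1) <= kappa `^ q / 2.
  rewrite ler_pdivrMr ?powR_gt0// mulrC.
  rewrite ler_pdivrMr// in hn; lra.
rewrite invfM (@powRM _ n%:R^-1) ?invr_ge0 ?(ltW nR0) ?(ltW ln20)//.
rewrite (@powRM _ (2 ^+ j) M) ?exprn_ge0 ?(ltW M0)//.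
have -> : (kappa / M) `^ q = kappa `^ q * M `^ (- q).
  by rewrite powRM ?invr_ge0 ?(ltW kappa0) ?(ltW M0)// powR_invl ?(ltW M0)// powRN.
have -> : M `^ (Q - q) = M `^ Q * M `^ (- q) by rewrite powRD// (gt_eqF M0) implybT.
have -> : n%:R^-1 `^ q = (n%:R `^ (q - 1))^-1 / n%:R.
  rewrite powR_invl ?ler0n// -invfM; congr (_^-1).
  by rewrite mulrC mulr_powRB1// ler0n.
set P := M `^ Q; set m := M `^ (- q).
have P0 : 0 <= P * m by rewrite mulr_ge0 ?powR_ge0.
have := ler_wpM2r P0 hn'; set w := (n%:R `^ (q - 1))^-1.
have w0 : 0 <= w by rewrite invr_ge0 powR_ge0.
move=> H; rewrite [leRHS](_ : _ = kappa `^ q / 2 * (P * m)); last by ring.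
apply: le_trans H; rewrite /A.
set B := 2 `^ q * (ln 2)^-1 `^ q * (CA * 2 `^ Q).
set E := (2 ^+ j) `^ (Q - q).
have B0 : 0 <= B by rewrite /B !mulr_ge0 ?powR_ge0// ltW.
have E0 : 0 <= E by rewrite powR_ge0.
rewrite [leLHS](_ : _ = B * E * w * (P * m) * ((n.+1 + j).+1%:R / n%:R)); last by rewrite /B; ring.
rewrite [leRHS](_ : _ = B * E * w * (P * m) * (j.+3)%:R); last by rewrite /B; ring.
have BEw : 0 <= B * E * w * (P * m).
  by apply: mulr_ge0 P0; apply: mulr_ge0 w0; exact: mulr_ge0.
by rewrite ler_wpM2l// ler_pdivrMr// mulrC.
Qed.

(** Otherwise t is large against M tau. Truncate u between s and s + t and multiply by the cutoff:
    the result is 0 on [E0], 1 on [E1], and has small energy although g is controlled only away from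
    a. The Poincare inequality on B(a, N M) makes it nearly constant, a contradiction. *)
Lemma weak_annulus (theta N : R) : 0 < theta -> 1 <= N ->
  exists delta C L : R, [/\ 0 < delta < 1, 0 < C, 0 < L &
   forall (M tau s t : R) (u g : X -> \bar R) (E0 E1 : set X),
    0 < M -> 0 < tau -> 0 < t -> (forall rho, mu.-integrable (ball a rho) u) ->
    upper_gradient g u -> measurable E0 -> measurable E1 ->
    E0 `|` E1 `<=` [set y | M <= mdist y a] `&` ball a (N * M) ->
    ((theta * M `^ Q)%:E <= mu E0)%E -> ((theta * M `^ Q)%:E <= mu E1)%E ->
    (forall y, E0 y -> (u y <= s%:E)%E) -> (forall y, E1 y -> ((s + t)%:E <= u y)%E) ->
    (\int[mu]_(y in ball a (L * M) `&` [set y | (delta * M < mdist y a)%R]) (g y `^ q) <=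
      (M `^ Q * tau `^ q)%:E)%E ->
    t <= C * M * tau].
Proof.
move=> theta0 N1; have N0 : 0 < N by exact: lt_le_trans ltr01 N1.
have [C1 [lam [C10 lam1 PI]]] := poincare_local Q0 CA1 muB q0 X_poincare.
(* With gradient of size kappa / M, the Poincare bound on B(a, N M) is exactly theta M^Q / 2, half
   of what [E0] and [E1] force. *)
have [kappa kappaE kappa0] : exists2 kappa, kappa = theta / (2 * C1 * N `^ Q * N) & 0 < kappa.
  by eexists; [reflexivity|rewrite divr_gt0// !mulr_gt0 ?powR_gt0].
have [j Nj] := exists_nat_exp2 (lam * N).
have [n n0 hn] := exists_cutoff_length j kappa0.
have exp0 : 0 < 2 ^+ n.+1 :> R by rewrite exprn_gt0.
have lam0 : 0 < lam by exact: lt_le_trans ltr01 lam1.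
(* The cutoff vanishes up to distance delta M and is 1 from distance M on, where [E0] and [E1] lie.
   The factor 4 / kappa leaves the truncated gradient half of the allowed energy. *)
exists (2 ^+ n.+1)^-1, (4 / kappa), (lam * N); split.
- by rewrite invr_gt0 exp0/= invf_lt1// exprn_egt1// ltr1n.
- by rewrite divr_gt0.
- by rewrite mulr_gt0.
move=> M tau s t u g E0 E1 M0 tau0 t0 iu gu mE0 mE1 E01 muE0 muE1 uE0 uE1 gint.
rewrite leNgt; apply/negP => tC.
pose b := (2 ^+ n.+1)^-1 * M; have b0 : 0 < b by rewrite mulr_gt0// invr_gt0.
have bM : 2 ^+ n.+1 * b = M by rewrite mulrA mulfV ?mul1r// gt_eqF.
pose v := truncation s t \o u; pose eta := log_cutoff a b n.
pose psi := log_cutoff_slope a b n.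
have v01 y : 0 <= v y <= 1 by rewrite truncation_ge0 truncation_le1.
have eta01 y : 0 <= eta y <= 1 by exact: log_cutoff_bounds.
have gG := upper_gradient_cutoff v01 eta01 (log_cutoff0 b0 n0)
  (continuous_borel_real (log_cutoff_slope_continuous b0 n0))
  (log_cutoff_slope_ge0 a b0 n0) (log_cutoff_arc a b0 n0) (upper_gradient_truncation s t0 gu).
set f := fun y : X => (v y * eta y)%:E in gG; set G := fun y : X => _ in gG.
have f01 y : 0 <= v y * eta y <= 1.
  have /andP[? ?] := v01 y; have /andP[? ?] := eta01 y.
  by rewrite mulr_ge0//= mulr_ile1.
have NM0 : 0 < N * M by rewrite mulr_gt0.
have meta : measurable_fun [set: X] eta.
  rewrite /eta /log_cutoff; apply: (measurable_radial (f := fun r => clamp 1 (_ * ln ((b + r) / _)))).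
  apply: measurable_maxr => //; apply: measurable_minr => //; apply: measurable_funM => //.
  apply: measurableT_comp => //; apply: measurable_funM => //; exact: measurable_funD.
have If rho : mu.-integrable (ball a rho) f.
  have [rho0|rho0] := ltP 0 rho; last first.
    rewrite (_ : ball a rho = set0) ?integrable_set0//.
    apply/seteqP; split => // y; rewrite ballEmdist/= => /lt_le_trans/(_ rho0).
    by rewrite ltNge mdist_ge0.
  apply/integrableP; split.
    apply/measurable_EFinP; apply: measurable_funM; last exact: measurable_funTS.
    apply: measurableT_comp; first exact: measurable_truncation.
    by have /integrableP[] := iu rho.
  apply: (@le_lt_trans _ _ (1 * (CA * rho `^ Q))%:E); last exact: ltry.
  apply: ge0_integral_le_cst => //.
  - exact: measurable_mball.
  - apply: measurableT_comp => //; apply/measurable_EFinP.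
    apply: measurable_funM; last exact: measurable_funTS.
    apply: measurableT_comp; first exact: measurable_truncation.
    by have /integrableP[] := iu rho.
  - move=> y _; rewrite /f abse_EFin lee_fin ger0_norm; by have /andP[] := f01 y.
  - by have /andP[] := muB a rho0.
have mP : measurable [set y : X | b < mdist y a] by exact: measurable_mdist_gt.
have mB r : measurable (ball a r : set X) by exact: measurable_mball.
have [mg g0 _] := gu.
have mgq : measurable_fun [set: X] (fun y => (g y `^ q)%E).
  exact: (measurableT_comp (measurable_poweR q) (borel_measurable_fun mg)).
have mpsi : measurable_fun [set: X] (fun y : X => ((b + mdist y a) `^ (- q))%:E).
  apply/measurable_EFinP; apply: (measurable_radial (f := fun t => (b + t) `^ (- q))).
  by apply: (measurableT_comp (measurable_powR _)) => //; exact: measurable_funD.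
have Gint : (\int[mu]_(y in ball a (lam * (N * M))) (G y `^ q) <=
    ((N * M) `^ Q * (kappa / M) `^ q)%:E)%E.
  pose k := (n%:R * ln 2 : R)^-1.
  have k0 : 0 <= k by rewrite invr_ge0 mulr_ge0// ln_ge0// ler1n.
  pose h1 y := ((fun y => g y `^ q) \_ [set y : X | (b < mdist y a)%R] y)%E.
  pose h2 (y : X) := ((b + mdist y a) `^ (- q))%:E.
  have h10 y : (0 <= h1 y)%E by rewrite /h1 patchE; case: ifP => // _; exact: poweR_ge0.
  have h20 y : (0 <= h2 y)%E by rewrite lee_fin powR_ge0.
  have mh1 : measurable_fun [set: X] h1.
    exact: (measurable_restrictT _ mP).1 (measurable_funTS mgq).
  apply: (@le_trans _ _ (\int[mu]_(y in ball a (lam * (N * M)))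
      ((2 `^ q)%:E * (((t^-1) `^ q)%:E * h1 y + (k `^ q)%:E * h2 y)))%E).
    apply: ge0_le_integral => //.
    - by move=> y _; exact: poweR_ge0.
    - apply: measurable_funTS; case: gG => mG _ _.
      exact: (measurableT_comp (measurable_poweR q) (borel_measurable_fun mG)).
    - apply: measurable_funTS; apply: emeasurable_funM => //.
      by apply: emeasurable_funD; apply: emeasurable_funM.
    move=> y _; rewrite /G.
    have psiq : ((log_cutoff_slope a b n y)%:E `^ q = (k `^ q)%:E * h2 y)%E.
      rewrite poweR_EFin /log_cutoff_slope -/k (powRM _ k0) ?invr_ge0 ?addr_ge0 ?(ltW b0) ?mdist_ge0//.
      rewrite /h2 -EFinM; congr (_ * _)%:E.
      by rewrite powR_invl ?powRN// addr_ge0 ?(ltW b0) ?mdist_ge0.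
    rewrite -psiq.
    have -> : (((t^-1) `^ q)%:E * h1 y = (if (b < mdist y a)%R then g y * (t^-1)%:E else 0) `^ q)%E.
      rewrite /h1 patchE; have -> : (y \in [set y : X | b < mdist y a]) = (b < mdist y a).
        by apply/idP/idP => [/set_mem//|h]; exact: mem_set.
      case: ifP => _; last by rewrite mule0 poweR0r// gt_eqF.
      by rewrite poweRM ?lee_fin ?invr_ge0 ?(ltW t0)// poweR_EFin muleC.
    apply: poweRD_le => //; last by rewrite lee_fin log_cutoff_slope_ge0.
    by case: ifP => // _; rewrite mule_ge0// lee_fin invr_ge0 ltW.
  have I1 : (\int[mu]_(y in ball a (lam * (N * M))) h1 y <= (M `^ Q * tau `^ q)%:E)%E.
    by rewrite -integral_mkcondr mulrA.
  have I2 : (\int[mu]_(y in ball a (lam * (N * M))) h2 y <=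
      (CA * 2 `^ Q * (n.+1 + j).+1%:R * (2 ^+ j * M) `^ (Q - q))%:E)%E.
    have E : 2 ^+ (n.+1 + j) * b = 2 ^+ j * M by rewrite exprD mulrAC bM mulrC.
    rewrite -E; apply: le_trans (log_energy (n.+1 + j) q0 qQ b0).
    apply: ge0_subset_integral => //; first exact: measurable_funTS.
    by rewrite E mulrA; apply: le_ball; rewrite ler_pM2r.
  rewrite ge0_integralZl_EFin ?powR_ge0//; last 2 first.
  - by move=> y _; rewrite adde_ge0// mule_ge0// lee_fin powR_ge0.
  - by apply: measurable_funTS; apply: emeasurable_funD; apply: emeasurable_funM.
  rewrite ge0_integralD//; last 4 first.
  - by move=> y _; rewrite mule_ge0// lee_fin powR_ge0.
  - by apply: measurable_funTS; apply: emeasurable_funM.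
  - by move=> y _; rewrite mule_ge0// lee_fin powR_ge0.
  - by apply: measurable_funTS; apply: emeasurable_funM.
  rewrite !ge0_integralZl_EFin ?powR_ge0//; do ?exact: measurable_funTS.
  apply: (@le_trans _ _ (2 `^ q * (t^-1 `^ q * (M `^ Q * tau `^ q) +
    k `^ q * (CA * 2 `^ Q * (n.+1 + j).+1%:R * (2 ^+ j * M) `^ (Q - q))))%:E).
    rewrite EFinM lee_wpmul2l ?lee_fin ?powR_ge0// EFinD !EFinM.
    by apply: leeD; rewrite lee_wpmul2l ?lee_fin ?powR_ge0// -?EFinM.
  rewrite lee_fin mulrDr.
  have H2 := hn M M0; rewrite -/k in H2.
  have H1 : 2 `^ q * (t^-1 `^ q * (M `^ Q * tau `^ q)) <= M `^ Q * (kappa / M) `^ q / 2.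
    rewrite [leLHS](_ : _ = M `^ Q * (2 * t^-1 * tau) `^ q); last first.
      by rewrite !powRM ?mulr_ge0 ?invr_ge0 ?(ltW t0) ?(ltW tau0)//; ring.
    rewrite -[leRHS]mulrA ler_wpM2l ?powR_ge0//.
    apply: (@le_trans _ _ ((kappa / M * 2^-1) `^ q)).
      rewrite ge0_ler_powR ?nnegrE ?(ltW q0) ?mulr_ge0 ?invr_ge0 ?(ltW t0) ?(ltW tau0) ?(ltW kappa0) ?(ltW M0)//.
      rewrite mulrAC ler_pdivrMr//.
      have : kappa / M * 2^-1 * (4 / kappa * M * tau) <= kappa / M * 2^-1 * t.
        by rewrite ler_wpM2l ?(ltW tC)// !mulr_ge0 ?invr_ge0 ?(ltW kappa0) ?(ltW M0).
      rewrite [X in X <= _ -> _](_ : _ = 2 * tau)//.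
      by field; rewrite !gt_eqF.
    rewrite powRM ?mulr_ge0 ?invr_ge0 ?(ltW kappa0) ?(ltW M0)// ler_wpM2l ?powR_ge0//.
    by rewrite ge1r_powR ?(ltW q1)// invr_gt0 ltr0Sn/= invf_le1// ler1n.
  apply: (le_trans (lerD H1 H2)); rewrite -splitr.
  rewrite ler_wpM2r ?powR_ge0// ge0_ler_powR ?nnegrE ?(ltW Q0) ?(ltW M0) ?(ltW NM0)//.
  by rewrite ler_peMl// ltW.
have [c Hc] := PI a (N * M) (kappa / M) f G NM0 (divr_gt0 kappa0 M0) If gG Gint.
have f0 y : E0 y -> f y = 0%E.
  by move=> /uE0 ?; rewrite /f /v/= truncation0// mul0r.
have f1 y : E1 y -> f y = 1%E.
  move=> E1y; rewrite /f /v/= truncation1 ?uE1// mul1r /eta log_cutoff1//.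
  by rewrite bM; have [] := E01 y (or_intror E1y).
have mfc : measurable_fun (ball a (N * M)) (fun y => `|f y - c%:E|)%E.
  apply: measurableT_comp => //; apply: emeasurable_funB => //.
  by have /integrableP[] := If (N * M).
(* Whatever c is, [|c| + |1 - c|] is at least 1, and the product is 0 on [E0] and 1 on [E1]. *)
have low : ((theta * M `^ Q)%:E <= \int[mu]_(y in ball a (N * M)) `|f y - c%:E|)%E.
  apply: (@le_trans _ _ (\int[mu]_(y in E0 `|` E1) `|f y - c%:E|)%E); last first.
    apply: ge0_subset_integral => //; first exact: measurableU.
    by move=> y /E01[].
  have EB : E0 `|` E1 `<=` ball a (N * M) by move=> y /E01[].
  rewrite ge0_integral_setU//; last 2 first.
  - by apply: measurable_funS mfc.
  - rewrite disj_set2E; apply/eqP/seteqP; split => // y [/uE0 h1 /uE1 h2].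
    have := le_trans h2 h1; rewrite lee_fin; lra.
  rewrite (eq_integral (cst `|c|%:E)); last first.
    by move=> y /set_mem/f0 ->; rewrite sub0e abseN.
  rewrite [X in (_ <= _ + X)%E](eq_integral (cst `|1 - c|%:E)); last first.
    by move=> y /set_mem/f1 ->; rewrite -EFinB.
  rewrite !integral_cst//=.
  apply: (@le_trans _ _ (`|c|%:E * (theta * M `^ Q)%:E + `|1 - c|%:E * (theta * M `^ Q)%:E)%E).
    rewrite -!EFinM -EFinD lee_fin -mulrDl ler_peMl ?mulr_ge0 ?powR_ge0 ?(ltW theta0)//.
    by have := ler_norm c; have := ler_norm (1 - c); lra.
  by apply: leeD; rewrite lee_wpmul2l// lee_fin.
have := le_trans low Hc; rewrite lee_fin powRM ?(ltW N0) ?(ltW M0)//.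
rewrite [leRHS](_ : _ = theta / 2 * M `^ Q); last first.
  by rewrite kappaE; field; rewrite !gt_eqF// powR_gt0.
have : 0 < M `^ Q by rewrite powR_gt0.
have : 0 < theta by [].
nra.
Qed.

End annulus.

(** * Coverings by balls, and comparison of approximating constants *)

Section cover.
Context d (R : realType) (X : borelMetricType d R) (mu : {measure set X -> \bar R}).
Variables (Q CA : R) (a : X).
Hypotheses (Q0 : 0 < Q) (CA1 : 1 <= CA)
  (muB : forall (x : X) (r : R), 0 < r ->
    ((CA^-1 * r `^ Q)%:E <= mu (ball x r) <= (CA * r `^ Q)%:E)%E).

Let CA0 : 0 < CA. Proof. exact: lt_le_trans ltr01 CA1. Qed.

Definition ball_cover (r : R) (s : seq X) : set X := [set y | has (fun x => mdist y x < r) s].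

Lemma ball_cover_cons r x s : ball_cover r (x :: s) = ball x r `|` ball_cover r s.
Proof. by rewrite ball_sphereE; apply/seteqP; split => y /= /orP. Qed.

Lemma ball_cover_nil r : ball_cover r [::] = set0.
Proof. by apply/seteqP; split. Qed.

Lemma measurable_ball_cover r s : measurable (ball_cover r s).
Proof.
elim: s => [|x s ih]; first by rewrite ball_cover_nil.
by rewrite ball_cover_cons; apply: measurableU => //; exact: measurable_mball.
Qed.

Lemma separated_measure_ge r s : 0 < r -> pairwise (fun x y => r <= mdist x y) s ->
  (((size s)%:R * (CA^-1 * (r / 2) `^ Q))%:E <= mu (ball_cover (r / 2) s))%E.
Proof.
move=> r0; elim: s => [|x s ih] /=; first by rewrite mul0r measure_ge0.
move=> /andP[/allP xs ps]; rewrite ball_cover_cons measureU//.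
- rewrite -natr1 addrC mulrDl mul1r EFinD leeD ?ih//.
  by have /andP[] := muB x (divr_gt0 r0 (ltr0Sn R 1)).
- exact: measurable_mball.
- exact: measurable_ball_cover.
apply/seteqP; split => // y [/=]; rewrite ball_sphereE/= => yx /hasP[z zs yz].
have := xs z zs; have := metric_triangle x y z; rewrite (metric_sym x y).
by lra.
Qed.

(** Points at mutual distance at least r have disjoint balls of radius r/2, so Ahlfors regularity
    bounds their number. Without a cover of this kind one could pick separated points for ever. *)
Lemma finite_ball_cover (D : set X) (r r1 : R) : 0 < r -> 0 < r1 ->
  D `<=` ball a r1 -> exists s : seq X, [/\ forall x, x \in s -> D x,
    D `<=` ball_cover r s & (size s)%:R <= CA ^+ 2 * ((r1 + r) / (r / 2)) `^ Q].
Proof.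
move=> r0 r10 Dr1; have r20 : 0 < r / 2 by rewrite divr_gt0.
have bound s : pairwise (fun x y => r <= mdist x y) s -> (forall x, x \in s -> D x) ->
    (size s)%:R <= CA ^+ 2 * ((r1 + r) / (r / 2)) `^ Q.
  move=> ps sD; have := separated_measure_ge r0 ps.
  have sub : ball_cover (r / 2) s `<=` ball a (r1 + r).
    move=> y /hasP[x xs yx]; have := Dr1 _ (sD _ xs); rewrite !ball_sphereE/=.
    by have := metric_triangle y x a; lra.
  have r1r : 0 < r1 + r by rewrite addr_gt0.
  move=> /le_trans/(_ (le_measure _ _ _ sub)).
  rewrite !inE => /(_ (measurable_ball_cover _ _) (measurable_mball _ _)).
  have /andP[_ h] := muB a r1r; move=> /le_trans/(_ h); rewrite lee_fin.
  rewrite powRM ?invr_ge0 ?(ltW r1r) ?(ltW r20)// powR_invl ?(ltW r20)// => H.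
  have P0 : 0 < (r / 2) `^ Q by rewrite powR_gt0.
  rewrite mulrA ler_pdivlMr// -(@ler_pM2l _ CA^-1) ?invr_gt0//.
  rewrite [leRHS](_ : _ = CA * (r1 + r) `^ Q); last by field; rewrite gt_eqF.
  by rewrite mulrCA.
apply: contrapT => nex.
have grow n : exists s : seq X, [/\ size s = n,
    pairwise (fun x y => r <= mdist x y) s & forall x, x \in s -> D x].
  elim: n => [|n [s [sn ps sD]]]; first by exists [::].
  have [y Dy ys] : exists2 y, D y & ~ ball_cover r s y.
    apply: contrapT => H; apply: nex; exists s; split => //; last exact: bound.
    by move=> y Dy; apply: contrapT => ys; apply: H; exists y.
  exists (y :: s); split => /=; first by rewrite sn.
    rewrite ps andbT; apply/allP => x xs; rewrite leNgt; apply/negP => yx.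
    by apply: ys; apply/hasP; exists x.
  by move=> x; rewrite in_cons => /predU1P[->|/sD].
have [s [sn ps sD]] := grow (Num.truncn (CA ^+ 2 * ((r1 + r) / (r / 2)) `^ Q)).+1.
have := bound s ps sD; rewrite sn leNgt => /negP; apply; exact: truncnS_gt.
Qed.

Lemma integral_ball_cover_le (f : X -> \bar R) (r : R) (s : seq X) (B : R) :
  measurable_fun [set: X] f -> (forall y, (0 <= f y)%E) ->
  (forall x, x \in s -> (\int[mu]_(y in ball x r) f y <= B%:E)%E) ->
  (\int[mu]_(y in ball_cover r s) f y <= ((size s)%:R * B)%:E)%E.
Proof.
move=> mf f0; elim: s => [|x s ih] H.
  by rewrite ball_cover_nil integral_set0 mul0r.
rewrite ball_cover_cons; apply: le_trans (ge0_integral_setU_le _ _ _ _ _) _ => //.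
- exact: measurable_mball.
- exact: measurable_ball_cover.
- exact: measurable_funTS.
rewrite /= -nat1r mulrDl mul1r EFinD; apply: leeD.
  by apply: H; exact: mem_head.
by apply: ih => y ys; apply: H; rewrite in_cons ys orbT.
Qed.

Lemma locally_integrable_measurable (u : X -> \bar R) :
  (forall rho, mu.-integrable (ball a rho) u) -> measurable_fun [set: X] u.
Proof.
move=> iu; have -> : [set: X] = \bigcup_n ball a n%:R.
  apply/seteqP; split => // y _; exists (Num.truncn (mdist y a)).+1 => //.
  by rewrite ball_sphereE/= truncnS_gt.
apply/measurable_fun_bigcup; first by move=> n; exact: measurable_mball.
by move=> n; have /integrableP[] := iu n%:R.
Qed.

End cover.

Lemma measurable_gradient_power d (R : realType) (X : borelMetricType d R)
    (g u : X -> \bar R) (p : R) :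
  upper_gradient g u -> measurable_fun [set: X] (fun y => (g y `^ p)%E).
Proof.
move=> [mg _ _].
exact: (measurableT_comp (measurable_poweR p) (borel_measurable_fun mg)).
Qed.

Section dist_const.
Context d (T : measurableType d) (R : realType) (mu : {measure set T -> \bar R}).
Local Open Scope ereal_scope.

Lemma measurable_dist_cst (A : set T) (u : T -> \bar R) (c : R) :
  measurable_fun A u -> measurable_fun A (fun y => `|u y - c%:E|).
Proof. by move=> mu_; apply: measurableT_comp => //; exact: emeasurable_funB. Qed.

Lemma integral_dist_change (A : set T) (u : T -> \bar R) (c c' B m : R) :
  measurable A -> measurable_fun A u -> mu A <= m%:E ->
  \int[mu]_(y in A) `|u y - c%:E| <= B%:E ->
  \int[mu]_(y in A) `|u y - c'%:E| <= (B + `|c - c'| * m)%:E.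
Proof.
move=> mA mu_ Am H.
have md (k : R) := measurable_dist_cst k mu_.
apply: (@le_trans _ _ (\int[mu]_(y in A) (`|u y - c%:E| + (cst `|c - c'|%:E) y))).
  apply: ge0_le_integral => //.
  - by apply: emeasurable_funD.
  - move=> y _; rewrite -[`|c - c'|%:E]/(`|(c - c')%:E|).
    case: (u y) => [r||] //=; rewrite lee_fin.
    by apply: le_trans (ler_normD _ _); rewrite addrA subrK.
rewrite [leRHS](_ : _ = B%:E + `|c - c'|%:E * m%:E)//.
rewrite ge0_integralD//; last by move=> y _; rewrite lee_fin.
apply: leeD => //; rewrite integral_cst//.
by rewrite lee_wpmul2l// lee_fin.
Qed.

Lemma dist_const_le (A : set T) (u : T -> \bar R) (c c' B B' m : R) :
  measurable A -> measurable_fun A u -> m%:E <= mu A ->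
  \int[mu]_(y in A) `|u y - c%:E| <= B%:E ->
  \int[mu]_(y in A) `|u y - c'%:E| <= B'%:E -> (`|c - c'| * m <= B + B')%R.
Proof.
move=> mA mu_ Am H H'.
have md (k : R) := measurable_dist_cst k mu_.
rewrite -lee_fin EFinD; apply: le_trans (leeD H H').
rewrite -ge0_integralD//.
apply: (@le_trans _ _ (\int[mu]_(y in A) (cst `|c - c'|%:E y))).
  by rewrite integral_cst// EFinM lee_wpmul2l// lee_fin.
apply: ge0_le_integral => //.
- by move=> y _; rewrite lee_fin.
- by apply: emeasurable_funD.
- move=> y _ /=; case: (u y) => [r||] /=; rewrite ?leey// lee_fin.
  rewrite (_ : c - c' = - (r - c) + (r - c'))%R; last by ring.
  by rewrite -(normrN (r - c)%R) ler_normD.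
Qed.

End dist_const.
Section annulus_poincare.
Context d (R : realType) (X : borelMetricType d R) (mu : {measure set X -> \bar R}).
Variables (Q CA : R) (a : X) (q : R).
Hypotheses (Q0 : 0 < Q) (CA1 : 1 <= CA)
  (muB : forall (x : X) (r : R), 0 < r ->
    ((CA^-1 * r `^ Q)%:E <= mu (ball x r) <= (CA * r `^ Q)%:E)%E)
  (q1 : 1 < q) (qQ : q <= Q) (X_poincare : poincare_inequality mu q).

Let CA0 : 0 < CA. Proof. exact: lt_le_trans ltr01 CA1. Qed.
Let q0 : 0 < q. Proof. exact: lt_trans ltr01 q1. Qed.

Definition annulus (r r' : R) : set X := ball a r' `&` [set y | r <= mdist y a].

Lemma measurable_annulus r r' : measurable (annulus r r').
Proof. by apply: measurableI; [exact: measurable_mball|exact: measurable_mdist_ge]. Qed.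

(* Markov's inequality and weak_annulus compare the means over any two balls of *)
(* radius eps M centred in the annulus, and finitely many such balls cover it.  *)
Lemma annulus_poincare (N : R) : 1 <= N -> exists delta C L : R,
  [/\ 0 < delta < 1, 0 < C, 0 < L & forall (M tau : R) (u g : X -> \bar R),
    0 < M -> 0 < tau -> (forall x rho, mu.-integrable (ball x rho) u) ->
    upper_gradient g u ->
    (\int[mu]_(y in ball a (L * M) `&` [set y | (delta * M < mdist y a)%R]) (g y `^ q) <=
      (M `^ Q * tau `^ q)%:E)%E ->
    exists c : R, (\int[mu]_(y in annulus M (N * M)) `|u y - c%:E| <=
      (C * M `^ Q * (M * tau))%:E)%E].
Proof.
move=> N1; have N0 : 0 < N by exact: lt_le_trans ltr01 N1.
have [C1 [lam [C10 lam1 PI]]] := poincare_local Q0 CA1 muB q0 X_poincare.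
have lam0 : 0 < lam by exact: lt_le_trans ltr01 lam1.
(* With r = eps M the enlarged ball has radius lam r = M/4, so around a point of the annulus it
   stays away from a. *)
have [eps epsE eps0] : exists2 eps, eps * (4 * lam) = 1 & 0 < eps.
  by exists (4 * lam)^-1; rewrite ?mulVf ?invr_gt0 ?mulr_gt0// gt_eqF// mulr_gt0.
have eps1 : eps <= 1 / 4 by nra.
(* Converts the energy M^Q tau^q to the scale r = eps M, where it is r^Q (e1 tau)^q; likewise [e2]
   below for the scale M/2. *)
have [e1 e10 e1E] : exists2 e1, 0 < e1 & e1 `^ q = (eps `^ Q)^-1.
  exists (eps^-1 `^ (Q / q)); first by rewrite powR_gt0 ?invr_gt0.
  by rewrite -powRrM divfK ?gt_eqF// powR_invl ?(ltW eps0).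
have [e2 e20 e2E] : exists2 e2, 0 < e2 & e2 `^ q = 2 `^ Q.
  by exists (2 `^ (Q / q)); rewrite ?powR_gt0// -powRrM divfK ?gt_eqF.
have epsQ0 : 0 < eps `^ Q by rewrite powR_gt0.
have [C2 C2E C20] : exists2 C2, C2 = C1 * eps `^ Q * eps * e1 & 0 < C2.
  by eexists; [reflexivity|rewrite !mulr_gt0].
have [theta thetaE theta0] : exists2 theta, theta = eps `^ Q / (2 * CA) & 0 < theta.
  by eexists; [reflexivity|rewrite divr_gt0// mulr_gt0].
have N1' : 1 <= 2 * (N + 1) by lra.
have [delta [C3 [L [/andP[delta0 delta1] C30 L0 weak]]]] :=
  weak_annulus a Q0 CA1 muB q1 qQ X_poincare theta0 N1'.
(* By Markov's inequality, the points of a ball of radius r where u is further than A M tau from its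
   constant fill at most a quarter of the lower bound for the volume of the ball; this is also why
   [theta] works. *)
have [A AE A0] : exists2 A, A = 4 * C2 * CA / eps `^ Q & 0 < A.
  by eexists; [reflexivity|rewrite divr_gt0// !mulr_gt0].
have [A' A'E A'0] : exists2 A', A' = 2 * A + C3 * e2 & 0 < A'.
  by eexists; [reflexivity|rewrite addr_gt0 ?mulr_gt0].
have [k0 k0E k00] : exists2 k0, k0 = CA ^+ 2 * ((N + eps) / (eps / 2)) `^ Q & 0 <= k0.
  by eexists; [reflexivity|rewrite mulr_ge0 ?sqr_ge0 ?powR_ge0].
exists (delta / 2), (k0 * (C2 + A' * CA) + 1), (Num.max (L / 2) (N + 1)); split.
- by apply/andP; split; lra.
- by rewrite ltr_wpDl// mulr_ge0// addr_ge0 ?mulr_ge0// ltW.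
- by rewrite lt_max; apply/orP; right; lra.
move=> M tau u g M0 tau0 iu gu gint.
have mu_u : measurable_fun [set: X] u by exact: (locally_integrable_measurable (iu a)).
have [mg g0 _] := gu.
have mgq : measurable_fun [set: X] (fun y => (g y `^ q)%E).
  exact: (measurableT_comp (measurable_poweR q) (borel_measurable_fun mg)).
pose W := ball a (Num.max (L / 2) (N + 1) * M) `&` [set y : X | delta / 2 * M < mdist y a].
have mW : measurable W.
  by apply: measurableI; [exact: measurable_mball|exact: measurable_mdist_gt].
have intW (D : set X) : measurable D -> D `<=` W ->
    (\int[mu]_(y in D) g y `^ q <= (M `^ Q * tau `^ q)%:E)%E.
  move=> mD DW; apply: le_trans gint; apply: ge0_subset_integral => //.
    exact: measurable_funTS.
  by move=> y _; exact: poweR_ge0.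
pose D := annulus M (N * M).
have [r rE r0] : exists2 r, r = eps * M & 0 < r.
  by eexists; [reflexivity|rewrite mulr_gt0].
have rQ : r `^ Q = eps `^ Q * M `^ Q by rewrite rE powRM ?(ltW eps0) ?(ltW M0).
have MQ0 : 0 < M `^ Q by rewrite powR_gt0.
have Mt0 : 0 < M * tau by rewrite mulr_gt0.
have lamr : lam * r = M / 4 by rewrite rE; nra.
have local (x : X) : D x -> exists c : R,
    (\int[mu]_(y in ball x r) `|u y - c%:E| <= (C2 * M `^ Q * (M * tau))%:E)%E.
  move=> [xN xM].
  have [|c Hc] := PI x r (e1 * tau) u g r0 (mulr_gt0 e10 tau0) (iu x) gu.
    rewrite lamr powRM ?(ltW e10) ?(ltW tau0)// e1E rQ.
    rewrite [X in (_ <= X%:E)%E](_ : _ = M `^ Q * tau `^ q); last by field; rewrite gt_eqF.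
    apply: intW; first exact: measurable_mball.
    move=> y; rewrite /W !ball_sphereE/= => yx; rewrite /= ball_sphereE/= in xN xM *.
    have t1 := metric_triangle y x a; have t2 := metric_triangle x y a.
    rewrite (metric_sym x y) in t2; split.
      apply: (@lt_le_trans _ _ ((N + 1) * M)); first by nra.
      by rewrite ler_pM2r// le_max lexx orbT.
    by nra.
  exists c; apply: (le_trans Hc); rewrite lee_fin rQ C2E rE.
  by apply: eq_ler; ring.
pose E c (x : X) := ball x r `&` [set y | (`|u y - c%:E| < (A * (M * tau))%:E)%E].
have mdc c : measurable_fun [set: X] (fun y => u y - c%:E)%E.
  exact: emeasurable_funB.
have mF c : measurable [set y | ((A * (M * tau))%:E <= `|u y - c%:E|)%E].
  rewrite -[X in measurable X]setTI; apply: emeasurable_fun_c_infty => //.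
  exact: measurableT_comp.
have EE c x : E c x = ball x r `\` [set y | ((A * (M * tau))%:E <= `|u y - c%:E|)%E].
  apply/seteqP; split => y [xy /= h]; split => //=; first by apply/negP; rewrite -ltNge.
  by rewrite ltNge; exact/negP.
have mE c x : measurable (E c x).
  by rewrite EE; apply: measurableD => //; exact: measurable_mball.
have muE (x : X) c : (\int[mu]_(y in ball x r) `|u y - c%:E| <= (C2 * M `^ Q * (M * tau))%:E)%E ->
    ((theta * (M / 2) `^ Q)%:E <= mu (E c x))%E.
  move=> H; have At0 : 0 < A * (M * tau) by rewrite mulr_gt0.
  have := le_integral_abse mu (measurable_mball x r) (measurable_funTS (mdc c)) At0.
  move=> /le_trans/(_ H); set F := _ `&` _ => HF.
  have [V [VE V0 V1 V2]] := ball_real CA1 muB x r0.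
  have mF' : measurable F by apply: measurableI => //; exact: measurable_mball.
  have FV : (mu F <= V%:E)%E.
    by rewrite -VE; apply: le_measure; rewrite ?inE//; [exact: measurable_mball|move=> y []].
  have Ffin : mu F \is a fin_num by rewrite ge0_fin_numE// (le_lt_trans FV)// ltry.
  have -> : mu (E c x) = (V%:E - mu F)%E.
    rewrite EE -VE measureD//; first exact: measurable_mball.
    by apply: (@le_lt_trans _ _ V%:E); [rewrite -VE|rewrite ltry].
  rewrite -(fineK Ffin) -EFinB lee_fin; rewrite -(fineK Ffin) -EFinM lee_fin in HF.
  have HF' : fine (mu F) <= C2 * M `^ Q / A.
    by rewrite ler_pdivlMr// -(ler_pM2r Mt0); apply: le_trans HF; apply: eq_ler; ring.
  have HA : C2 * M `^ Q / A = eps `^ Q * M `^ Q / (4 * CA).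
    by rewrite AE; field; rewrite !gt_eqF.
  have HV : V >= 4 * (eps `^ Q * M `^ Q / (4 * CA)).
    apply: le_trans V1; rewrite rQ; apply: eq_ler.
    by field; rewrite gt_eqF.
  have Hth : theta * (M / 2) `^ Q <= 2 * (eps `^ Q * M `^ Q / (4 * CA)).
    rewrite [leRHS](_ : _ = theta * M `^ Q); last by rewrite thetaE; field; rewrite gt_eqF.
    rewrite ler_pM2l// ge0_ler_powR ?nnegrE ?(ltW Q0) ?(ltW M0) ?divr_ge0 ?(ltW M0)//.
    by rewrite ler_pdivrMr// ler_peMr ?(ltW M0)// ler1n.
  have K0 : 0 <= eps `^ Q * M `^ Q / (4 * CA).
    by rewrite divr_ge0 ?mulr_ge0 ?powR_ge0// ltW.
  rewrite HA in HF'; clear - HF' HV Hth K0; lra.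
have cmp (x x' : X) c c' : D x -> D x' ->
    (\int[mu]_(y in ball x r) `|u y - c%:E| <= (C2 * M `^ Q * (M * tau))%:E)%E ->
    (\int[mu]_(y in ball x' r) `|u y - c'%:E| <= (C2 * M `^ Q * (M * tau))%:E)%E ->
    c' - c <= A' * (M * tau).
  (* On the good part of the first ball u is at most c + A M tau; on that of the second it is at
     least c' - A M tau, that is t more. *)
  move=> Dx Dx' Hc Hc'; pose t := c' - c - 2 * (A * (M * tau)).
  have [t0|t0] := leP t 0.
    have : 0 <= C3 * e2 * (M * tau) by rewrite !mulr_ge0// ltW.
    rewrite /t in t0; rewrite A'E; lra.
  suff : t <= C3 * (M / 2) * (e2 * tau).
    have : 0 <= C3 * e2 * (M * tau) by rewrite !mulr_ge0// ltW.
    rewrite /t A'E; lra.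
  have sub z cz : D z -> E cz z `<=` [set y | M / 2 <= mdist y a] `&` ball a (2 * (N + 1) * (M / 2)).
    rewrite /D /annulus /E !ball_sphereE => -[/= zN zM] y [/= yz _].
    have t1 := metric_triangle y z a; have t2 := metric_triangle z y a.
    rewrite (metric_sym z y) in t2; rewrite rE in yz; clear - t1 t2 yz zN zM M0 eps0 eps1 N1; split; nra.
  (* The scale is M/2 since the balls may reach slightly inside of the annulus. *)
  apply: (weak (M / 2) (e2 * tau) (c + A * (M * tau)) t u g (E c x) (E c' x')) => //.
  - by rewrite divr_gt0.
  - by rewrite mulr_gt0.
  - by move=> y [] /sub; apply.
  - exact: muE.
  - exact: muE.
  - move=> y [_ /=]; case: (u y) => [v||]//=; rewrite ?lte_fin ?lee_fin ltr_norml => /andP[_].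
    lra.
  - move=> y [_ /=]; case: (u y) => [v||]//=; rewrite ?lte_fin ?lee_fin ltr_norml => /andP[+ _].
    rewrite /t; lra.
  - rewrite (@powRM _ e2 tau) ?(ltW e20) ?(ltW tau0)// e2E (@powRM _ M) ?(ltW M0)//.
    rewrite powR_invl// [X in (_ <= X%:E)%E](_ : _ = M `^ Q * tau `^ q); last first.
      by field; rewrite gt_eqF ?powR_gt0.
    apply: intW.
      by apply: measurableI; [exact: measurable_mball|exact: measurable_mdist_gt].
    rewrite /W !ball_sphereE => y [/= y1 y2]; split => /=; last by lra.
    apply: (lt_le_trans y1); rewrite mulrCA mulrC ler_pM2r//.
    by rewrite le_max lexx.
have Dsub : D `<=` ball a (N * M) by move=> y [].
have [s [sD Ds sk]] := finite_ball_cover CA1 muB r0 (mulr_gt0 N0 M0) Dsub.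
have k0r : CA ^+ 2 * ((N * M + r) / (r / 2)) `^ Q = k0.
  rewrite k0E rE; congr (_ * _ `^ _); field; rewrite !gt_eqF//.
rewrite k0r in sk.
have mD : measurable D by exact: measurable_annulus.
case: s sD Ds sk => [_ Ds _|x0 s sD Ds sk].
  exists 0; rewrite -/D (_ : D = set0) ?integral_set0.
    by rewrite lee_fin !mulr_ge0 ?powR_ge0 ?(ltW M0) ?(ltW tau0)// addr_ge0 ?mulr_ge0 ?addr_ge0 ?mulr_ge0// ltW.
  by apply/seteqP; split => // y /Ds; rewrite ball_cover_nil.
have [c Hc] := local x0 (sD _ (mem_head _ _)).
exists c.
have mabs : measurable_fun [set: X] (fun y => `|u y - c%:E|)%E by exact: measurableT_comp.
have bnd (x : X) : x \in x0 :: s -> (\int[mu]_(y in ball x r) `|u y - c%:E| <=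
    ((C2 + A' * CA) * M `^ Q * (M * tau))%:E)%E.
  move=> xs; have [c' Hc'] := local x (sD _ xs).
  have [V [VE V0 V1 V2]] := ball_real CA1 muB x r0.
  have VEle : (mu (ball x r) <= V%:E)%E by rewrite VE.
  apply: le_trans (integral_dist_change c (measurable_mball x r) (measurable_funTS mu_u) VEle Hc') _.
  rewrite lee_fin 2!mulrDl lerD2l.
  have cc : `|c' - c| <= A' * (M * tau).
    rewrite ler_norml; apply/andP; split.
      by rewrite lerNl opprB; exact: cmp (sD _ xs) (sD _ (mem_head _ _)) Hc' Hc.
    exact: cmp (sD _ (mem_head _ _)) (sD _ xs) Hc Hc'.
  have V3 : V <= CA * M `^ Q.
    apply: (le_trans V2); rewrite ler_pM2l// ge0_ler_powR ?nnegrE ?(ltW Q0) ?(ltW r0) ?(ltW M0)//.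
    rewrite rE ler_piMl ?(ltW M0)//; apply: (le_trans eps1).
    by rewrite ler_pdivrMr// mul1r ler1n.
  apply: (le_trans (ler_pM _ (ltW V0) cc V3)) => //.
  by apply: eq_ler; ring.
apply: (@le_trans _ _ (\int[mu]_(y in ball_cover r (x0 :: s)) `|u y - c%:E|)%E).
  apply: ge0_subset_integral => //; first exact: measurable_ball_cover.
  exact: measurable_funTS.
apply: (le_trans (integral_ball_cover_le mabs _ bnd)) => //.
rewrite lee_fin.
set G := M `^ Q * (M * tau); have G0 : 0 <= G by rewrite mulr_ge0// ltW.
rewrite -[X in _ * X]mulrA -[leRHS]mulrA -/G.
have P0 : 0 <= (C2 + A' * CA) * G by rewrite mulr_ge0// addr_ge0 ?mulr_ge0// ltW.
apply: (le_trans (ler_wpM2r P0 sk)); lra.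
Qed.

End annulus_poincare.
(** * Poincare inequalities near infinity *)

Lemma poweR_interpolate (R : realType) (x : \bar R) (p q tau : R) : 0 < q -> q <= p ->
  0 < tau -> (0 <= x)%E ->
  (x `^ q <= (tau `^ q)%:E + (tau `^ (q - p))%:E * x `^ p)%E.
Proof.
move=> q0 qp tau0; have p0 : 0 < p by exact: lt_le_trans qp.
case: x => [r||]//; last first.
  move=> _; rewrite !poweRyr ?gt_eqF// gt0_muley ?lte_fin ?powR_gt0//.
rewrite lee_fin !poweR_EFin -EFinM -EFinD lee_fin => r0.
have [rt|tr] := leP r tau.
  apply: ler_wpDr; first by rewrite mulr_ge0 ?powR_ge0.
  by rewrite ge0_ler_powR ?nnegrE ?(ltW q0) ?(ltW tau0).
apply: ler_wpDl; first exact: powR_ge0.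
have r0' : 0 < r by exact: lt_trans tr.
have -> : r `^ q = r `^ (q - p) * r `^ p.
  by rewrite -powRD ?subrK// (gt_eqF r0') implybT.
rewrite ler_wpM2r ?powR_ge0// -(opprB p q) !powRN lef_pV2 ?posrE ?powR_gt0//.
by rewrite ge0_ler_powR ?nnegrE ?subr_ge0 ?(ltW tau0) ?(ltW r0') ?(ltW tr).
Qed.

(** Plays the role of Hölder's inequality: where g <= tau bound g^q by tau^q, elsewhere by tau^(q-p)
    g^p. *)
Lemma integral_power_le d (T : measurableType d) (R : realType)
    (mu : {measure set T -> \bar R}) (D : set T) (g : T -> \bar R) (p q tau V V' : R) :
  measurable D -> measurable_fun D g -> (forall x, (0 <= g x)%E) ->
  0 < q -> q <= p -> 0 < tau -> (mu D <= V%:E)%E ->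
  (\int[mu]_(x in D) g x `^ p <= (V' * tau `^ p)%:E)%E ->
  (\int[mu]_(x in D) g x `^ q <= ((V + V') * tau `^ q)%:E)%E.
Proof.
move=> mD mg g0 q0 qp tau0 DV H.
have mgr r : measurable_fun D (fun x => g x `^ r)%E.
  exact: (measurableT_comp (measurable_poweR r) mg).
apply: (@le_trans _ _ (\int[mu]_(x in D)
    (cst (tau `^ q)%:E x + (tau `^ (q - p))%:E * g x `^ p))%E).
  apply: ge0_le_integral => //.
  - by move=> x _; exact: poweR_ge0.
  - by apply: emeasurable_funD => //; exact: emeasurable_funM.
  - by move=> x _; exact: poweR_interpolate.
rewrite ge0_integralD//; last 3 first.
- by move=> x _; rewrite lee_fin powR_ge0.
- by move=> x _; rewrite mule_ge0 ?lee_fin ?powR_ge0 ?poweR_ge0.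
- exact: emeasurable_funM.
rewrite integral_cst// ge0_integralZl_EFin ?powR_ge0//; last by move=> x _; exact: poweR_ge0.
rewrite mulrDl EFinD; apply: leeD.
  by rewrite mulrC EFinM lee_wpmul2l// lee_fin powR_ge0.
rewrite (_ : V' * tau `^ q = tau `^ (q - p) * (V' * tau `^ p)); last first.
  by rewrite mulrCA -powRD ?subrK// (gt_eqF tau0) implybT.
by rewrite EFinM lee_wpmul2l// lee_fin powR_ge0.
Qed.

(** Sum a geometric series over the annuli and pass to the limit by monotone convergence. *)
Lemma integral_geometric_annuli d (R : realType) (X : borelMetricType d R)
    (mu : {measure set X -> \bar R}) (a : X) (K M theta A : R) (f : X -> \bar R) :
  1 < K -> 0 < M -> measurable_fun [set: X] f -> (forall x, (0 <= f x)%E) ->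
  0 < theta -> theta < 1 ->
  (forall k, (\int[mu]_(x in annulus a (K ^+ k * M) (K * (K ^+ k * M))) f x <=
    (A * theta ^+ k)%:E)%E) ->
  (\int[mu]_(x in [set x | (M <= mdist x a)%R]) f x <= (A / (1 - theta))%:E)%E.
Proof.
move=> K1 M0 mf f0 t0 t1 H; have K0 : 0 < K by exact: lt_trans K1.
have t1' : 0 < 1 - theta by rewrite subr_gt0.
have A0 : 0 <= A.
  have := H 0%N; rewrite expr0 mulr1 -lee_fin; apply: le_trans.
  by apply: integral_ge0.
pose Mk k := K ^+ k * M.
have Mk0 k : 0 < Mk k by rewrite mulr_gt0 ?exprn_gt0.
have MkS k : Mk k.+1 = K * Mk k by rewrite /Mk exprS mulrA.
have MMk k : M <= Mk k by rewrite ler_peMl ?(ltW M0)// exprn_ege1// ltW.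
have step n : (\int[mu]_(x in annulus a M (Mk n)) f x <=
    (A / (1 - theta) * (1 - theta ^+ n))%:E)%E.
  elim: n => [|n ih].
    rewrite /Mk expr0 mul1r subrr mulr0 (_ : annulus a M M = set0) ?integral_set0//.
    by apply/seteqP; split => // x []; rewrite ball_sphereE/= ltNge => /negP.
  have -> : annulus a M (Mk n.+1) = annulus a M (Mk n) `|` annulus a (Mk n) (K * Mk n).
    rewrite /annulus !ball_sphereE MkS; apply/seteqP; split => x /=.
      by move=> [h1 h2]; have [h|h] := ltP (mdist x a) (Mk n); [left|right].
    move=> [[h1 h2]|[h1 h2]]; split => //; last exact: le_trans h2.
    by apply: (lt_le_trans h1); rewrite ler_peMl ?(ltW (Mk0 n))// ltW.
  apply: le_trans (ge0_integral_setU_le _ _ _ _ _) _ => //.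
  - exact: measurable_annulus.
  - exact: measurable_annulus.
  - exact: measurable_funTS.
  apply: (le_trans (leeD ih (H n))).
  rewrite -EFinD lee_fin exprS; apply: eq_ler; field.
  exact: lt0r_neq0.
have -> : [set x | M <= mdist x a] = \bigcup_n annulus a M (Mk n).
  apply/seteqP; split => x /=; last by move=> [n _ []].
  move=> Mx; pose k := Num.truncn ((mdist x a / M) / (K - 1)); exists k.+1 => //; split => //.
  (* Bernoulli's inequality K^n >= n (K - 1) puts every point in some annulus. *)
  rewrite ball_sphereE/= /Mk -ltr_pdivrMr//.
  have Ktail n : n%:R * (K - 1) <= K ^+ n.
    elim: n => [|n ih]; first by rewrite mul0r expr0.
    rewrite exprS -natr1; have : 1 <= K ^+ n by rewrite exprn_ege1// ltW.
    have := K1; nra.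
  apply: lt_le_trans (Ktail _); rewrite -ltr_pdivrMr ?subr_gt0//.
  exact: truncnS_gt.
have cv : (\int[mu]_(x in annulus a M (Mk n)) f x)%E @[n --> \oo] -->
    (\int[mu]_(x in \bigcup_n annulus a M (Mk n)) f x)%E.
  apply: ge0_nondecreasing_set_cvg_integral => //.
  - apply/nondecreasing_seqP => n; apply/subsetPset; rewrite /annulus !ball_sphereE => x [/= h1 h2].
    by split => //=; apply: (lt_le_trans h1); rewrite MkS ler_peMl ?(ltW (Mk0 n))// ltW.
  - by move=> n; exact: measurable_annulus.
  - by move=> n; exact: measurable_funTS.
rewrite -(cvg_lim _ cv)//; apply: lime_le; first by apply/cvg_ex; eexists; exact: cv.
apply: nearW => n; apply: (le_trans (step n)); rewrite lee_fin.
by rewrite ler_piMr ?divr_ge0 ?(ltW t1')// lerBlDr lerDl exprn_ge0// ltW.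
Qed.

(** The drift of u at scale M grows with exponent 1 - Q/p, which is at most half the exponent 2p - Q
    with which the weighted mass decays. For p > Q use p (2p - Q) >= 2p - Q >= 2 (p - Q). *)
Lemma exponent_gap (R : realFieldType) (Q p : R) : 0 < Q -> 1 < p -> Q < 2 * p ->
  1 - Q / p <= (2 * p - Q) / 2.
Proof.
move=> Q0 p1 Q2p; have p0 : 0 < p by exact: lt_trans p1.
rewrite -(ler_pM2r p0) mulrBl mul1r divfK ?gt_eqF//.
have [pQ|Qp] := leP p Q.
  apply: (@le_trans _ _ 0); first by rewrite subr_le0.
  by rewrite mulr_ge0 ?(ltW p0)// divr_ge0// subr_ge0 ltW.
have h : 0 <= (p - 1) * (2 * p - Q) by rewrite mulr_ge0// ltW// subr_gt0.
nra.
Qed.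

Section exterior.
Context d (R : realType) (X : borelMetricType d R) (mu : {measure set X -> \bar R}).
Variables (Q CA : R) (a : X) (p q : R).
Hypotheses (Q0 : 0 < Q) (CA1 : 1 <= CA)
  (muB : forall (x : X) (r : R), 0 < r ->
    ((CA^-1 * r `^ Q)%:E <= mu (ball x r) <= (CA * r `^ Q)%:E)%E)
  (q1 : 1 < q) (qQ : q <= Q) (qp : q <= p) (Q2p : Q < 2 * p)
  (X_poincare : poincare_inequality mu q).

Let CA0 : 0 < CA. Proof. exact: lt_le_trans ltr01 CA1. Qed.
Let q0 : 0 < q. Proof. exact: lt_trans ltr01 q1. Qed.
Let p1 : 1 < p. Proof. exact: lt_le_trans q1 qp. Qed.

(** K^Q = 2 [CA]^2 makes the outer ball at least twice as large as the upper bound for the inner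
    one. *)
Lemma annulus_ratio : exists2 K : R, 1 < K & forall (x : X) (M : R), 0 < M ->
  ((CA * M `^ Q)%:E <= mu (annulus x M (K * M)))%E.
Proof.
pose K := (2 * CA ^+ 2) `^ Q^-1.
have CA2 : 1 <= CA ^+ 2 by rewrite exprn_ege1.
have K1 : 1 < K.
  have h1 : (1 : R) `^ Q^-1 = 1 by rewrite powR1.
  rewrite -[ltLHS]h1 gt0_ltr_powR ?nnegrE ?invr_gt0//; last by lra.
  by rewrite mulr_ge0 ?sqr_ge0.
have K0 : 0 < K by exact: lt_trans K1.
have KQ : K `^ Q = 2 * CA ^+ 2.
  by rewrite -powRrM mulVf ?gt_eqF// powRr1// mulr_ge0 ?sqr_ge0.
exists K => // x M M0; have KM0 : 0 < K * M by rewrite mulr_gt0.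
have [V [VE V0 V1 _]] := ball_real CA1 muB x KM0.
have [W [WE W0 _ W1]] := ball_real CA1 muB x M0.
have -> : annulus x M (K * M) = ball x (K * M) `\` ball x M.
  rewrite /annulus !ball_sphereE; apply/seteqP; split => y [/= h1 h2]; split => //=.
    by apply/negP; rewrite -leNgt.
  by rewrite leNgt; exact/negP.
rewrite measureD; [|exact: measurable_mball|exact: measurable_mball|].
  have -> : ball x (K * M) `&` ball x M = ball x M.
    by apply/setIidr; apply: le_ball; rewrite ler_peMl// ltW.
  apply: (@le_trans _ _ (V%:E - W%:E)%E); last by rewrite -VE -WE.
  rewrite -EFinB lee_fin; have : 2 * (CA * M `^ Q) <= V.
    apply: le_trans V1; rewrite powRM ?(ltW K0) ?(ltW M0)// KQ.
    by apply: eq_ler; field; rewrite gt_eqF.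
  lra.
by apply: (@le_lt_trans _ _ V%:E); [rewrite -VE|rewrite ltry].
Qed.

(* Strictly below the decay exponent 2p - Q of the measure of the shells, so *)
(* that the telescoping sum below converges.                                 *)
Let tau0 := (2 * p - Q) / 2.

Let tau0_gt0 : 0 < tau0. Proof. by rewrite /tau0 divr_gt0// subr_gt0. Qed.

Let tau0_ge : 1 - Q / p <= tau0. Proof. exact: exponent_gap. Qed.

Definition exterior_weight (x : X) : \bar R := ((mdist x a) `^ (- (2 * p)))%:E.

(** A p-energy y^p at scale M corresponds to a gradient of size t = M^(-Q/p) y. [integral_power_le]
    turns it into q-energy, at the cost of a factor e >= 1, absorbed since e <= e^q. *)
Lemma annulus_poincare_p (N : R) : 1 <= N -> exists delta C : R,
  [/\ 0 < delta < 1, 0 < C & forall (M y : R) (u g : X -> \bar R),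
    0 < M -> 0 < y -> (forall x rho, mu.-integrable (ball x rho) u) ->
    upper_gradient g u ->
    (\int[mu]_(x in [set x | (delta * M < mdist x a)%R]) (g x `^ p) <= (y `^ p)%:E)%E ->
    exists c : R, (\int[mu]_(x in annulus a M (N * M)) `|u x - c%:E| <=
      (C * M `^ Q * (M `^ (1 - Q / p) * y))%:E)%E].
Proof.
move=> N1; have p0 : 0 < p by exact: lt_trans p1.
have [delta [C [L [d01 C0 L0 H]]]] := annulus_poincare a Q0 CA1 muB q1 qQ X_poincare N1.
have [e eE e1] : exists2 e, e = CA * L `^ Q + 1 & 1 <= e.
  by eexists; [reflexivity|rewrite lerDr mulr_ge0 ?powR_ge0// ltW].
have e0 : 0 < e by exact: lt_le_trans e1.
exists delta, (C * e); split => //; first by rewrite mulr_gt0.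
move=> M y u g M0 y0 iu gu gint; have [mg g0 _] := gu.
have [t tE t0] : exists2 t, t = M `^ (- (Q / p)) * y & 0 < t.
  by eexists; [reflexivity|rewrite mulr_gt0 ?powR_gt0].
have tp : M `^ Q * t `^ p = y `^ p.
  rewrite tE powRM ?powR_ge0 ?(ltW y0)// -powRrM mulNr divfK ?gt_eqF//.
  by rewrite mulrA -powRD ?subrr ?powRr0 ?mul1r// (gt_eqF M0) implybT.
have LM0 : 0 < L * M by rewrite mulr_gt0.
have mDp : measurable [set x : X | delta * M < mdist x a] by exact: measurable_mdist_gt.
have mD : measurable (ball a (L * M) `&` [set x : X | delta * M < mdist x a]).
  by apply: measurableI => //; exact: measurable_mball.
have mgT := borel_measurable_fun mg.
have [|c Hc] := H M (e * t) u g M0 (mulr_gt0 e0 t0) iu gu.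
  have DV : (mu (ball a (L * M) `&` [set x : X | (delta * M < mdist x a)%R]) <=
      (CA * L `^ Q * M `^ Q)%:E)%E.
    apply: (@le_trans _ _ (mu (ball a (L * M)))).
      by apply: le_measure; rewrite ?inE//; exact: measurable_mball.
    have /andP[_] := muB a LM0; by rewrite powRM ?(ltW L0) ?(ltW M0)// mulrA.
  apply: (le_trans (integral_power_le mD (measurable_funTS mgT) g0 q0 qp t0 DV (V' := M `^ Q) _)).
    rewrite tp; apply: le_trans gint; apply: ge0_subset_integral => //.
    - apply: measurable_funTS; exact: (measurableT_comp (measurable_poweR p) mgT).
    - by move=> x _; exact: poweR_ge0.
  rewrite lee_fin powRM ?(ltW e0) ?(ltW t0)//.
  rewrite (_ : CA * L `^ Q * M `^ Q + M `^ Q = M `^ Q * e); last by rewrite eE; ring.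
  rewrite -mulrA ler_wpM2l ?powR_ge0// ler_wpM2r ?powR_ge0//.
  by rewrite le1r_powR// ltW.
exists c; apply: (le_trans Hc); rewrite lee_fin.
rewrite (@powRD _ M 1 (- (Q / p))); last by rewrite (gt_eqF M0) implybT.
rewrite powRr1 ?(ltW M0)// tE; apply: eq_ler; ring.
Qed.

(** On annuli of ratio K^2 starting at K^k M, u is close to constants c(k). Consecutive annuli
    overlap, which bounds c(k) - c(k+1), hence the drift from c(0); against the decaying weight the
    sum over k converges. *)
Lemma exterior_poincare : exists delta C : R, [/\ 0 < delta < 1, 0 < C &
  forall (M y : R) (u g : X -> \bar R), 0 < M -> 0 < y ->
    (forall x rho, mu.-integrable (ball x rho) u) -> upper_gradient g u ->
    (\int[mu]_(x in [set x | (delta * M < mdist x a)%R]) (g x `^ p) <= (y `^ p)%:E)%E ->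
    exists c : R, (\int[mu]_(x in [set x | (M <= mdist x a)%R])
        (`|u x - c%:E| * exterior_weight x) <=
      (C * M `^ (Q - 2 * p) * (M `^ (1 - Q / p) * y))%:E)%E].
Proof.
have p0 : 0 < p by exact: lt_trans p1.
have [K K1 annK] := annulus_ratio; have K0 : 0 < K by exact: lt_trans K1.
have N1 : 1 <= K ^+ 2 by rewrite exprn_ege1// ltW.
have [delta [C2 [/andP[d0 d1] C20 H]]] := annulus_poincare_p N1.
(* The drift grows at most like kap^k while the weighted mass decays exactly like kap^(-2k). *)
have [kap kapE kap1] : exists2 kap, kap = K `^ tau0 & 1 < kap.
  eexists; first reflexivity.
  rewrite -[ltLHS](powRr0 K) lt_neqAle ler_powR ?(ltW K1) ?(ltW tau0_gt0)// andbT.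
  rewrite powRr0 eq_sym powR_eq1 !negb_or gt_eqF//= -leNgt (ltW K0)/= gt_eqF//.
have kap0 : 0 < kap by exact: lt_trans kap1.
have KQ0 : 0 < K `^ Q by rewrite powR_gt0.
have [C3 C3E C30] : exists2 C3, C3 = C2 * (1 + K `^ Q * kap) & 0 < C3.
  by eexists; [reflexivity|rewrite mulr_gt0// addr_gt0// mulr_gt0].
have kap1' : 0 < kap - 1 by rewrite subr_gt0.
(* From the geometric sum: C3 (1 + kap + ... + kap^(k-1)) is at most D kap^k. *)
have [D DE D0] : exists2 D, D = C3 / (kap - 1) & 0 < D.
  by eexists; [reflexivity|rewrite divr_gt0].
have [C4 C4E C40] : exists2 C4, C4 = C2 + D * CA * (K ^+ 2) `^ Q & 0 < C4.
  by eexists; [reflexivity|rewrite addr_gt0// !mulr_gt0// powR_gt0 ?exprn_gt0].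
have [C5 C5E C50] : exists2 C5, C5 * (1 - kap^-1) = C4 & 0 < C5.
  have h : 0 < 1 - kap^-1 by rewrite subr_gt0 invf_lt1.
  by exists (C4 / (1 - kap^-1)); rewrite ?divfK ?gt_eqF// divr_gt0.
exists delta, C5; split => //; first by rewrite d0.
move=> M y u g M0 y0 iu gu gint; have [mg g0 _] := gu.
have mu_u : measurable_fun [set: X] u by exact: (locally_integrable_measurable (iu a)).
have mabs (c : R) := measurable_dist_cst c mu_u.
have mgp := measurable_gradient_power p gu.
pose Mk k := K ^+ k * M.
have Kk0 k : 0 < K ^+ k by rewrite exprn_gt0.
have Mk0 k : 0 < Mk k by rewrite mulr_gt0.
have MkS k : Mk k.+1 = K * Mk k by rewrite /Mk exprS mulrA.
have MMk k : M <= Mk k by rewrite ler_peMl ?(ltW M0)// exprn_ege1// ltW.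
have powK k x : (K ^+ k) `^ x = (K `^ x) ^+ k.
  by rewrite -powR_mulrn ?(ltW K0)// -powRrM mulrC powRrM powR_mulrn// powR_ge0.
have [T TE T0] : exists2 T, T = M `^ (1 - Q / p) * y & 0 < T.
  by eexists; [reflexivity|rewrite mulr_gt0 ?powR_gt0].
have stepA k : exists c : R, (\int[mu]_(x in annulus a (Mk k) (K ^+ 2 * Mk k))
    `|u x - c%:E| <= (C2 * Mk k `^ Q * (kap ^+ k * T))%:E)%E.
  have [|c Hc] := H (Mk k) y u g (Mk0 k) y0 iu gu.
    apply: le_trans gint; apply: ge0_subset_integral => //.
    - exact: measurable_mdist_gt.
    - exact: measurable_mdist_gt.
    - exact: measurable_funTS.
    - by move=> x _; exact: poweR_ge0.
    - by move=> x /=; apply: le_lt_trans; rewrite ler_pM2l.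
  exists c; apply: (le_trans Hc); rewrite lee_fin ler_wpM2l ?mulr_ge0 ?powR_ge0 ?(ltW C20)//.
  rewrite TE mulrA ler_wpM2r ?(ltW y0)// /Mk powRM ?(ltW M0) ?(ltW (Kk0 k))//.
  rewrite ler_wpM2r ?powR_ge0// powK kapE lerXn2r ?nnegrE ?powR_ge0//.
  by rewrite ler_powR// ltW.
have [c Hc] := choice stepA.
have stepB k : `|c k - c k.+1| <= C3 * (kap ^+ k * T).
  (* The overlap of the annuli of index k and k + 1. *)
  pose A := annulus a (Mk k.+1) (K * Mk k.+1).
  have mA : measurable A by exact: measurable_annulus.
  have HA : (\int[mu]_(x in A) `|u x - (c k)%:E| <= (C2 * Mk k `^ Q * (kap ^+ k * T))%:E)%E.
    apply: le_trans (Hc k); apply: ge0_subset_integral => //.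
    - exact: measurable_annulus.
    - exact: measurable_funTS.
    - move=> x []; rewrite /annulus !ball_sphereE MkS/= mulrA -expr2 => h1 h2; split => //=.
      by apply: le_trans h2; rewrite ler_peMl ?(ltW (Mk0 k))// ltW.
  have HA' : (\int[mu]_(x in A) `|u x - (c k.+1)%:E| <=
      (C2 * Mk k.+1 `^ Q * (kap ^+ k.+1 * T))%:E)%E.
    apply: le_trans (Hc k.+1); apply: ge0_subset_integral => //.
    - exact: measurable_annulus.
    - exact: measurable_funTS.
    - move=> x []; rewrite /annulus !ball_sphereE/= => h1 h2; split => //=.
      by apply: (lt_le_trans h1); rewrite ler_pM2r// expr2 ler_peMl ?(ltW K0)// ltW.
  have muA : ((Mk k `^ Q)%:E <= mu A)%E.
    apply: le_trans (annK a _ (Mk0 _)); rewrite lee_fin -[leLHS]mul1r ler_pM ?powR_ge0//.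
    by rewrite ge0_ler_powR ?nnegrE ?(ltW Q0) ?(ltW (Mk0 _))// MkS ler_peMl ?(ltW (Mk0 k))// ltW.
  have := dist_const_le mA (measurable_funTS mu_u) muA HA HA'.
  have -> : C2 * Mk k `^ Q * (kap ^+ k * T) + C2 * Mk k.+1 `^ Q * (kap ^+ k.+1 * T) =
      C3 * (kap ^+ k * T) * Mk k `^ Q.
    by rewrite C3E MkS powRM ?(ltW K0) ?(ltW (Mk0 k))// exprS; ring.
  by rewrite ler_pM2r// powR_gt0.
have stepC k : `|c k - c 0| <= D * (kap ^+ k * T).
  elim: k => [|k ih]; first by rewrite subrr normr0 expr0 mul1r mulr_ge0// ltW.
  have -> : c k.+1 - c 0 = - (c k - c k.+1) + (c k - c 0) by ring.
  apply: (le_trans (ler_normD _ _)); rewrite normrN.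
  apply: (le_trans (lerD (stepB k) ih)).
  have -> : C3 = D * (kap - 1) by rewrite DE divfK// gt_eqF.
  by rewrite exprS; apply: eq_ler; ring.
have mw : measurable_fun [set: X] exterior_weight.
  apply/measurable_EFinP; apply: (measurable_radial a (f := fun t => t `^ (- (2 * p)))).
  exact: measurable_powR.
pose f x := (`|u x - (c 0)%:E| * exterior_weight x)%E.
have mf : measurable_fun [set: X] f by exact: emeasurable_funM.
have f0 x : (0 <= f x)%E by rewrite mule_ge0// lee_fin powR_ge0.
pose G := M `^ (Q - 2 * p) * T.
have stepD k : (\int[mu]_(x in annulus a (Mk k) (K * Mk k)) f x <=
    (C4 * G * kap^-1 ^+ k)%:E)%E.
  have KMk0 : 0 < K ^+ 2 * Mk k by rewrite mulr_gt0 ?exprn_gt0.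
  have muA : (mu (annulus a (Mk k) (K ^+ 2 * Mk k)) <= (CA * (K ^+ 2 * Mk k) `^ Q)%:E)%E.
    apply: (@le_trans _ _ (mu (ball a (K ^+ 2 * Mk k)))).
      apply: le_measure; rewrite ?inE; last exact: subIsetl.
        exact: measurable_annulus.
      exact: measurable_mball.
    by have /andP[] := muB a KMk0.
  have := integral_dist_change (c 0) (measurable_annulus _ _ _) (measurable_funTS mu_u) muA (Hc k).
  set B := _ + _ => HB.
  apply: (@le_trans _ _ (\int[mu]_(x in annulus a (Mk k) (K * Mk k))
      (`|u x - (c 0)%:E| * (Mk k `^ (- (2 * p)))%:E))%E).
    apply: ge0_le_integral => //.
    - exact: measurable_annulus.
    - exact: measurable_funTS.
    - by apply: measurable_funTS; apply: emeasurable_funM.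
    - move=> x [_ /= xM]; rewrite lee_wpmul2l// lee_fin !powRN lef_pV2 ?posrE ?powR_gt0//.
        have p20 : 0 <= 2 * p by rewrite mulr_ge0// ltW.
        by rewrite ge0_ler_powR ?nnegrE ?p20 ?(ltW (Mk0 k)) ?mdist_ge0.
      exact: lt_le_trans xM.
  rewrite ge0_integralZr//; last 3 first.
  - exact: measurable_annulus.
  - exact: measurable_funTS.
  - by rewrite lee_fin powR_ge0.
  apply: (@le_trans _ _ (B%:E * (Mk k `^ (- (2 * p)))%:E)%E).
    rewrite lee_wpmul2r ?lee_fin ?powR_ge0//; apply: le_trans HB.
    apply: ge0_subset_integral => //.
    - exact: measurable_annulus.
    - exact: measurable_annulus.
    - exact: measurable_funTS.
    - move=> x []; rewrite /annulus !ball_sphereE/= => h1 h2; split => //=.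
      by apply: (lt_le_trans h1); rewrite ler_pM2r// expr2 ler_peMl ?(ltW K0)// ltW.
  rewrite -EFinM lee_fin.
  apply: (@le_trans _ _ (C4 * Mk k `^ Q * (kap ^+ k * T) * Mk k `^ (- (2 * p)))).
    rewrite ler_wpM2r ?powR_ge0// /B C4E 2!mulrDl lerD2l.
    apply: (le_trans (ler_wpM2r _ (stepC k))).
      by rewrite mulr_ge0 ?powR_ge0 ?(ltW CA0).
    rewrite powRM ?exprn_ge0 ?(ltW K0) ?(ltW (Mk0 k))//.
    by apply: eq_ler; ring.
  have MkE : Mk k `^ Q * Mk k `^ (- (2 * p)) = M `^ (Q - 2 * p) * (kap^-1 ^+ k) ^+ 2.
    rewrite -powRD; last by rewrite (gt_eqF (Mk0 k)) implybT.
    rewrite /Mk powRM ?(ltW M0) ?(ltW (Kk0 k))// mulrC; congr (_ * _).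
    rewrite powK -exprM mulnC exprM; congr (_ ^+ _).
    rewrite kapE exprVn -powR_mulrn ?powR_ge0// -powRrM -powRN; congr (_ `^ _).
    by rewrite /tau0; field.
  have -> : C4 * Mk k `^ Q * (kap ^+ k * T) * Mk k `^ (- (2 * p)) =
      C4 * (Mk k `^ Q * Mk k `^ (- (2 * p))) * (kap ^+ k * T) by ring.
  rewrite MkE /G exprVn; apply: eq_ler; field.
  by rewrite expf_neq0// gt_eqF.
exists (c 0); apply: (le_trans (integral_geometric_annuli K1 M0 mf f0 _ _ stepD)).
- by rewrite invr_gt0.
- by rewrite invf_lt1.
rewrite lee_fin; apply: eq_ler; rewrite -C5E /G TE; field.
by rewrite ?(gt_eqF kap1') ?(gt_eqF kap0).
Qed.

End exterior.

(** * The weight near infinity *)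

Lemma powR_gt1 (R : realType) (x y : R) : 1 < x -> 0 < y -> 1 < x `^ y.
Proof.
move=> x1 y0; have h : (1 : R) `^ y = 1 by rewrite powR1.
by rewrite -[ltLHS]h gt0_ltr_powR ?nnegrE// ltW// (lt_trans _ x1).
Qed.

Section infinity.
Context d (R : realType) (X : borelMetricType d R) (mu : {measure set X -> \bar R}).
Variables (Q CA : R) (a : X) (p : R).
Hypotheses (Q0 : 0 < Q) (CA1 : 1 <= CA)
  (muB : forall (x : X) (r : R), 0 < r ->
    ((CA^-1 * r `^ Q)%:E <= mu (ball x r) <= (CA * r `^ Q)%:E)%E)
  (p1 : 1 < p) (Q2p : Q < 2 * p).

(** The distance from x to the point at infinity, and the square root of the conformal factor. *)
Definition infdist (x : X) : R := (1 + mdist x a)^-1.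

Let CA0 : 0 < CA. Proof. exact: lt_le_trans ltr01 CA1. Qed.
Let p0 : 0 < p. Proof. exact: lt_trans p1. Qed.
Let p20 : 0 < 2 * p. Proof. by rewrite mulr_gt0. Qed.

Lemma infdist_gt0 (x : X) : 0 < infdist x.
Proof. by rewrite invr_gt0 ltr_pwDl// mdist_ge0. Qed.

Lemma infdist_le1 (x : X) : infdist x <= 1.
Proof. by rewrite invf_le1 ?lerDl ?mdist_ge0// ltr_pwDl// mdist_ge0. Qed.

Lemma sph_weightE (x : X) : sph_weight a p x = (infdist x `^ (2 * p))%:E.
Proof.
by rewrite /sph_weight /infdist powR_invl ?powRN// addr_ge0// mdist_ge0.
Qed.

Lemma measurable_sph_weight : measurable_fun [set: X] (sph_weight a p).
Proof.
apply/measurable_EFinP; apply: (measurable_radial a (f := fun t => (1 + t) `^ (- (2 * p)))).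
apply: (measurableT_comp (measurable_powR _)); exact: measurable_funD.
Qed.

Lemma sph_weight_ge0 (x : X) : (0 <= sph_weight a p x)%E.
Proof. by rewrite lee_fin powR_ge0. Qed.

Lemma sph_weight_le1 (x : X) : (sph_weight a p x <= 1)%E.
Proof.
have h : (1 : R) `^ (2 * p) = 1 by rewrite powR1.
rewrite sph_weightE lee_fin -[leRHS]h.
by rewrite ge0_ler_powR ?nnegrE ?(ltW p20) ?(ltW (infdist_gt0 _)) ?infdist_le1.
Qed.

Lemma sph_weight_le_exterior (x : X) : 0 < mdist x a ->
  (sph_weight a p x <= exterior_weight a p x)%E.
Proof.
move=> xa; rewrite lee_fin !powRN lef_pV2 ?posrE ?powR_gt0 ?addr_gt0//.
by rewrite ge0_ler_powR ?nnegrE ?(ltW p20) ?lerDr ?addr_ge0 ?mdist_ge0.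
Qed.

Lemma measurable_exterior_weight : measurable_fun [set: X] (exterior_weight a p).
Proof.
apply/measurable_EFinP; apply: (measurable_radial a (f := fun t => t `^ (- (2 * p)))).
exact: measurable_powR.
Qed.

(** The dyadic shell at 2^k M has weighted mass of order (2^k M)^(Q-2p), a geometric sequence of
    ratio 2^(Q-2p) < 1. *)
Lemma exterior_measure : exists2 C : R, 0 < C & forall M : R, 0 < M ->
  (\int[mu]_(x in [set x | (M <= mdist x a)%R]) exterior_weight a p x <=
    (C * M `^ (Q - 2 * p))%:E)%E.
Proof.
have [t tE /andP[t0 t1]] : exists2 t : R, t = 2 `^ (Q - 2 * p) & 0 < t < 1.
  eexists; first reflexivity; rewrite powR_gt0//=.
  by rewrite -(opprB (2 * p)) powRN invf_lt1 ?powR_gt0// powR_gt1 ?subr_gt0// ltr1n.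
have t1' : 0 < 1 - t by rewrite subr_gt0.
exists (CA * 2 `^ Q / (1 - t)); first by rewrite divr_gt0// mulr_gt0// powR_gt0.
move=> M M0.
have w0 x : (0 <= exterior_weight a p x)%E by rewrite lee_fin powR_ge0.
have step k : (\int[mu]_(x in annulus a (2 ^+ k * M) (2 * (2 ^+ k * M)))
    exterior_weight a p x <= (CA * 2 `^ Q * M `^ (Q - 2 * p) * t ^+ k)%:E)%E.
  have N0 : 0 < 2 ^+ k * M by rewrite mulr_gt0 ?exprn_gt0.
  have N20 : 0 < 2 * (2 ^+ k * M) by rewrite mulr_gt0.
  apply: (@le_trans _ _ ((2 ^+ k * M) `^ (- (2 * p)) * (CA * (2 * (2 ^+ k * M)) `^ Q))%:E).
    apply: ge0_integral_le_cst => //.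
    - exact: measurable_annulus.
    - apply: measurable_funTS; exact: measurable_exterior_weight.
    - exact: powR_ge0.
    - move=> x [_ /= xM]; rewrite lee_fin !powRN lef_pV2 ?posrE ?powR_gt0//.
        by rewrite ge0_ler_powR ?nnegrE ?(ltW p20) ?(ltW N0) ?mdist_ge0.
      exact: lt_le_trans xM.
    - apply: (@le_trans _ _ (mu (ball a (2 * (2 ^+ k * M))))).
        apply: le_measure; rewrite ?inE; [exact: measurable_annulus|exact: measurable_mball|].
        exact: subIsetl.
      by have /andP[] := muB a N20.
  rewrite lee_fin (@powRM _ 2 (2 ^+ k * M)) ?(ltW N0)//.
  have -> : (2 ^+ k * M) `^ (- (2 * p)) * (CA * (2 `^ Q * (2 ^+ k * M) `^ Q)) =
    CA * 2 `^ Q * ((2 ^+ k * M) `^ Q * (2 ^+ k * M) `^ (- (2 * p))) by ring.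
  rewrite -powRD; last by rewrite (gt_eqF N0) implybT.
  rewrite (@powRM _ (2 ^+ k) M) ?exprn_ge0 ?(ltW M0)// -powR_mulrn// -powRrM tE.
  rewrite -[in leRHS]powR_mulrn ?powR_ge0// -powRrM (mulrC k%:R).
  by apply: eq_ler; ring.
apply: (le_trans (integral_geometric_annuli (ltr1n _ 2) M0 measurable_exterior_weight w0 t0 t1 step)).
by rewrite lee_fin; apply: eq_ler; field; rewrite gt_eqF.
Qed.

Lemma infdist_ltE (rho : R) : 0 < rho ->
  [set x | infdist x < rho] = [set x | rho^-1 - 1 < mdist x a].
Proof.
move=> r0; have E x : (infdist x < rho) = (rho^-1 - 1 < mdist x a).
  by rewrite ltrBlDl invf_plt ?posrE// ltr_pwDl// mdist_ge0.
by apply/seteqP; split => x /=; rewrite E.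
Qed.

Lemma measurable_infdist_lt (rho : R) : 0 < rho -> measurable [set x | infdist x < rho].
Proof. by move=> r0; rewrite infdist_ltE//; exact: measurable_mdist_gt. Qed.

Lemma infdist_lt_far (rho : R) : 0 < rho -> rho <= 2^-1 ->
  [set x | infdist x < rho] `<=` [set x | (2 * rho)^-1 <= mdist x a].
Proof.
move=> r0 r2 x; rewrite infdist_ltE//= => h; apply/ltW; apply: le_lt_trans h.
have : 1 <= (2 * rho)^-1 by rewrite invf_ge1; lra.
have -> : rho^-1 = 2 * (2 * rho)^-1 by field; rewrite gt_eqF.
lra.
Qed.

Section weighted.
Variables (f : X -> \bar R) (f0 : forall x, (0 <= f x)%E)
  (mf : measurable_fun [set: X] f).

Let fw0 x : (0 <= f x * sph_weight a p x)%E.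
Proof. by rewrite mule_ge0// sph_weight_ge0. Qed.

Let mfw : measurable_fun [set: X] (fun x => f x * sph_weight a p x)%E.
Proof. by apply: emeasurable_funM => //; exact: measurable_sph_weight. Qed.

Lemma integral_sph_weight_far (D : set X) (M : R) : 0 < M -> measurable D ->
  D `<=` [set x | M <= mdist x a] ->
  (\int[mu]_(x in D) (f x * sph_weight a p x) <=
   \int[mu]_(x in [set x | (M <= mdist x a)%R]) (f x * exterior_weight a p x))%E.
Proof.
move=> M0 mD DM; have mM := measurable_mdist_ge a M.
apply: (@le_trans _ _ (\int[mu]_(x in [set x | (M <= mdist x a)%R]) (f x * sph_weight a p x))%E).
  by apply: ge0_subset_integral => //; exact: measurable_funTS.
apply: ge0_le_integral => //.
- exact: measurable_funTS.
- by apply: measurable_funTS; apply: emeasurable_funM => //; exact: measurable_exterior_weight.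
- move=> x /= Mx; apply: lee_wpmul2l => //; apply: sph_weight_le_exterior.
  exact: lt_le_trans Mx.
Qed.

Lemma integral_sph_weight_le (D : set X) : measurable D ->
  (\int[mu]_(x in D) (f x * sph_weight a p x) <= \int[mu]_(x in D) f x)%E.
Proof.
move=> mD; apply: ge0_le_integral => //.
- exact: measurable_funTS.
- exact: measurable_funTS.
- by move=> x _; rewrite -[leRHS]mule1 lee_wpmul2l// sph_weight_le1.
Qed.

Lemma integral_sph_weight_split :
  (\int[mu]_x (f x * sph_weight a p x) <= \int[mu]_(x in ball a 1) f x +
   \int[mu]_(x in [set x | (1 <= mdist x a)%R]) (f x * exterior_weight a p x))%E.
Proof.
have -> : [set: X] = ball a 1 `|` [set x | 1 <= mdist x a].
  apply/seteqP; split => // x _; rewrite ball_sphereE/=.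
  by have [h|h] := ltP (mdist x a) 1; [left|right].
have mB := measurable_mball a (1 : R); have mM := measurable_mdist_ge a 1.
apply: (le_trans (ge0_integral_setU_le _ mB mM (measurable_funTS mfw) (fun x _ => fw0 x))).
by apply: leeD; [exact: integral_sph_weight_le|exact: integral_sph_weight_far].
Qed.

End weighted.

(** For rho <= 1/2 the set lies outside of B(a, 1/(2 rho)). For larger rho the finite total mass
    suffices, as [min rho 1] is at least 1/2. *)
Lemma sph_measure_le : exists2 C : R, 0 < C & forall rho : R, 0 < rho ->
  (\int[mu]_(x in [set x | (infdist x < rho)%R]) sph_weight a p x <=
    (C * (Num.min rho 1) `^ (2 * p - Q))%:E)%E.
Proof.
have [C C0 H] := exterior_measure.
have e0 : 0 < 2 * p - Q by rewrite subr_gt0.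
have e20 : 0 < 2 `^ (2 * p - Q) :> R by rewrite powR_gt0.
exists ((CA + C) * 2 `^ (2 * p - Q)); first by rewrite mulr_gt0// addr_gt0.
move=> rho r0.
have one x : sph_weight a p x = (cst 1%E x * sph_weight a p x)%E by rewrite mul1e.
have onee x : exterior_weight a p x = (cst 1%E x * exterior_weight a p x)%E by rewrite mul1e.
have m1 : measurable_fun [set: X] (cst 1%E : X -> \bar R) by [].
have [r2|r2] := leP rho 2^-1.
  have r20 : 0 < 2 * rho by rewrite mulr_gt0.
  have M0 : 0 < (2 * rho)^-1 by rewrite invr_gt0.
  under eq_integral do rewrite one.
  apply: (le_trans (integral_sph_weight_far _ m1 M0 (measurable_infdist_lt r0)
    (infdist_lt_far r0 r2))) => //.
  under eq_integral do rewrite -onee.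
  apply: (le_trans (H _ M0)); rewrite lee_fin.
  rewrite -(opprB (2 * p)) powRN powR_invl ?(ltW r20)// invrK powRM ?(ltW r0)//.
  have -> : Num.min rho 1 = rho by apply/min_idPl; lra.
  by rewrite mulrA ler_wpM2r ?powR_ge0// ler_wpM2r ?(ltW e20)// lerDr ltW.
apply: (@le_trans _ _ (CA + C)%:E).
  apply: (@le_trans _ _ (\int[mu]_x sph_weight a p x)%E).
    apply: ge0_subset_integral => //.
    - exact: measurable_infdist_lt.
    - exact: measurable_sph_weight.
    - by move=> x _; exact: sph_weight_ge0.
  under eq_integral do rewrite one.
  apply: (le_trans (integral_sph_weight_split _ m1)) => //.
  under [X in (_ + X)%E]eq_integral do rewrite -onee.
  rewrite EFinD; apply: leeD; last by have := H 1 ltr01; rewrite powR1 mulr1.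
  rewrite integral_cst ?mul1e; last exact: measurable_mball.
  by have /andP[_] := muB a ltr01; rewrite powR1 mulr1.
rewrite lee_fin -mulrA ler_peMr ?addr_ge0 ?(ltW CA0) ?(ltW C0)//.
have m2 : 2^-1 <= Num.min rho 1 by rewrite le_min (ltW r2)/= invf_le1 ?ler1n.
rewrite -powRM//; last by apply: le_trans m2.
by rewrite powR_ge1 ?(ltW e0)//; lra.
Qed.

End infinity.

(** * Poincare inequality on neighbourhoods of infinity *)

Section infinity_poincare.
Context d (R : realType) (X : borelMetricType d R) (mu : {measure set X -> \bar R}).
Variables (Q CA : R) (a : X) (p q : R).
Hypotheses (Q0 : 0 < Q) (CA1 : 1 <= CA)
  (muB : forall (x : X) (r : R), 0 < r ->
    ((CA^-1 * r `^ Q)%:E <= mu (ball x r) <= (CA * r `^ Q)%:E)%E)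
  (q1 : 1 < q) (qQ : q <= Q) (qp : q <= p) (Q2p : Q < 2 * p)
  (X_poincare : poincare_inequality mu q).

Let CA0 : 0 < CA. Proof. exact: lt_le_trans ltr01 CA1. Qed.
Let q0 : 0 < q. Proof. exact: lt_trans ltr01 q1. Qed.
Let p1 : 1 < p. Proof. exact: lt_le_trans q1 qp. Qed.
Let p0 : 0 < p. Proof. exact: lt_trans p1. Qed.

(** Glues the exterior of the unit ball to a ball of radius K around a: the two constants are
    compared on the annulus between radii 1 and K, which has measure at least [CA]. *)
Lemma whole_poincare : exists2 C : R, 0 < C & forall (y : R) (u g : X -> \bar R), 0 < y ->
  (forall x rho, mu.-integrable (ball x rho) u) -> upper_gradient g u ->
  (\int[mu]_x (g x `^ p) <= (y `^ p)%:E)%E ->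
  exists c : R, (\int[mu]_x (`|u x - c%:E| * sph_weight a p x) <= (C * y)%:E)%E.
Proof.
have [K K1 annK] := annulus_ratio Q0 CA1 muB; have K0 : 0 < K by exact: lt_trans K1.
have [delta [C1 [d01 C10 H1]]] := exterior_poincare a Q0 CA1 muB q1 qQ qp Q2p X_poincare.
have [C2 [lam [C20 lam1 H2]]] := poincare_local Q0 CA1 muB q0 X_poincare.
have lK0 : 0 < lam * K by rewrite mulr_gt0//; exact: lt_le_trans lam1.
have [e eE e1] : exists2 e, e = CA * (lam * K) `^ Q + 1 & 1 <= e.
  by eexists; [reflexivity|rewrite lerDr mulr_ge0 ?powR_ge0// ltW].
have e0 : 0 < e by exact: lt_le_trans e1.
have KQ1 : 1 <= K `^ Q by rewrite powR_ge1// ltW.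
have [C3 C3E C30] : exists2 C3, C3 = C2 * K `^ Q * (K * e) & 0 < C3.
  by eexists; [reflexivity|rewrite !mulr_gt0// powR_gt0].
have [C4 C4E C40] : exists2 C4, C4 = K `^ (2 * p) * C1 & 0 < C4.
  by eexists; [reflexivity|rewrite mulr_gt0// powR_gt0].
have C50 : 0 < C3 + (C3 + C4) * (CA * K `^ Q) by rewrite !(addr_gt0, mulr_gt0, powR_gt0).
exists (C3 + (C3 + C4) * (CA * K `^ Q) + C1); first by rewrite addr_gt0.
move=> y u g y0 iu gu gint; have [mg g0 _] := gu.
have mu_u : measurable_fun [set: X] u by exact: (locally_integrable_measurable (iu a)).
have mabs (c : R) := measurable_dist_cst c mu_u.
have mgT := borel_measurable_fun mg.
have mgp := measurable_gradient_power p gu.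
have gD (D : set X) : measurable D -> (\int[mu]_(x in D) (g x `^ p) <= (y `^ p)%:E)%E.
  move=> mD; apply: le_trans gint; apply: ge0_subset_integral => //.
  by move=> x _; exact: poweR_ge0.
have [|c1 Hc1] := H1 1 y u g ltr01 y0 iu gu; first exact: gD (measurable_mdist_gt _ _).
rewrite !powR1 mulr1 mul1r in Hc1.
have [|c2 Hc2] := H2 a K (e * y) u g K0 (mulr_gt0 e0 y0) (iu a) gu.
  have /andP[_ DV] := muB a lK0.
  apply: (le_trans (integral_power_le (measurable_mball _ _) (measurable_funTS mgT) g0 q0 qp y0
    DV (V' := 1) _)).
    by rewrite mul1r; exact: gD (measurable_mball _ _).
  rewrite -eE lee_fin powRM ?(ltW e0) ?(ltW y0)// mulrA ler_wpM2r ?powR_ge0//.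
  rewrite -[leLHS]mul1r ler_pM// ?(ltW e0)//.
  by rewrite -[leLHS]powRr1 ?(ltW e0)// ler_powR// ltW.
rewrite (_ : C2 * K `^ Q * (K * (e * y)) = C3 * y) in Hc2; last by rewrite C3E; ring.
have mA : measurable (annulus a 1 (K * 1)) by exact: measurable_annulus.
have ew1 : measurable_fun [set: X] (exterior_weight a p) by exact: measurable_exterior_weight.
have ew0 x : (0 <= exterior_weight a p x)%E by rewrite lee_fin powR_ge0.
have HA1 : (\int[mu]_(x in annulus a 1 (K * 1)) `|u x - c1%:E| <= (C4 * y)%:E)%E.
  apply: (@le_trans _ _ (\int[mu]_(x in annulus a 1 (K * 1))
    ((K `^ (2 * p))%:E * (`|u x - c1%:E| * exterior_weight a p x)))%E).
    apply: ge0_le_integral => //.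
    - exact: measurable_funTS.
    - by apply: measurable_funTS; apply: emeasurable_funM => //; exact: emeasurable_funM.
    - move=> x [/= xK x1]; rewrite muleC -muleA -[leLHS]mule1 lee_wpmul2l//.
      rewrite -EFinM lee_fin powRN mulrC ler_pdivlMr ?mul1r; last first.
        by rewrite powR_gt0//; exact: lt_le_trans x1.
      rewrite ball_sphereE/= mulr1 in xK.
      by rewrite ge0_ler_powR ?nnegrE ?mulr_ge0 ?(ltW p0) ?(ltW K0) ?mdist_ge0 ?(ltW xK).
  rewrite ge0_integralZl_EFin ?powR_ge0//; last 2 first.
  - by move=> x _; rewrite mule_ge0.
  - by apply: measurable_funTS; exact: emeasurable_funM.
  rewrite C4E -mulrA EFinM lee_wpmul2l ?lee_fin ?powR_ge0//; apply: le_trans Hc1.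
  apply: ge0_subset_integral => //.
  - exact: measurable_mdist_ge.
  - by apply: measurable_funTS; exact: emeasurable_funM.
  - by move=> x _; rewrite mule_ge0.
  - by move=> x [].
have HA2 : (\int[mu]_(x in annulus a 1 (K * 1)) `|u x - c2%:E| <= (C3 * y)%:E)%E.
  apply: le_trans Hc2; apply: ge0_subset_integral => //.
  - exact: measurable_mball.
  - exact: measurable_funTS.
  - by rewrite mulr1; exact: subIsetl.
have c12 : `|c2 - c1| <= (C3 + C4) * y.
  have := dist_const_le mA (measurable_funTS mu_u) (annK a 1 ltr01) HA2 HA1.
  rewrite powR1 mulr1 -mulrDl; apply: le_trans; exact: ler_peMr.
exists c1; apply: (le_trans (integral_sph_weight_split mu a p1 _ (mabs c1))) => //.
rewrite mulrDl EFinD; apply: leeD Hc1.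
apply: (@le_trans _ _ (\int[mu]_(x in ball a K) `|u x - c1%:E|)%E).
  apply: ge0_subset_integral => //; [exact: measurable_mball|exact: measurable_mball| |].
    exact: measurable_funTS.
  by apply: le_ball; exact: ltW.
have /andP[_ muK] := muB a K0.
apply: (le_trans (integral_dist_change c1 (measurable_mball _ _) (measurable_funTS mu_u) muK Hc2)).
rewrite lee_fin [leRHS]mulrDl lerD2l mulrAC ler_wpM2r//.
by rewrite mulr_ge0 ?powR_ge0 ?(ltW CA0).
Qed.

(** For rho <= 1/2 this is [exterior_poincare] with M = 1/(2 rho), otherwise [whole_poincare]. *)
Lemma infinity_poincare : exists Lam C : R, [/\ 1 <= Lam, 0 < C &
  forall (rho y : R) (u g : X -> \bar R), 0 < rho -> 0 < y ->
    (forall x rho, mu.-integrable (ball x rho) u) -> upper_gradient g u ->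
    (\int[mu]_(x in [set x | (infdist a x < Lam * rho)%R]) (g x `^ p) <= (y `^ p)%:E)%E ->
    exists c : R, (\int[mu]_(x in [set x | (infdist a x < rho)%R])
        (`|u x - c%:E| * sph_weight a p x) <=
      (C * (Num.min rho 1) `^ (2 * p - Q - (1 - Q / p)) * y)%:E)%E].
Proof.
have [delta [C1 [/andP[d0 d1] C10 H1]]] := exterior_poincare a Q0 CA1 muB q1 qQ qp Q2p X_poincare.
have [C2 C20 H2] := whole_poincare.
have [s sE s0] : exists2 s, s = 2 * p - Q - (1 - Q / p) & 0 <= s.
  eexists; first reflexivity; have := exponent_gap Q0 p1 Q2p.
  have : 0 < 2 * p - Q by rewrite subr_gt0.
  lra.
have ts0 : 0 < 2 `^ s :> R by rewrite powR_gt0.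
(* Points with d(x, a) > delta M satisfy h(x) < 2 rho / delta. For rho > 1/2 the enlarged
   neighbourhood is all of X, since h <= 1. *)
exists (4 / delta), ((C1 + C2) * 2 `^ s); split.
- by rewrite ler_pdivlMr// mul1r; lra.
- by rewrite mulr_gt0// addr_gt0.
move=> rho y u g r0 y0 iu gu gint; have [mg g0 _] := gu; rewrite -sE.
have mu_u : measurable_fun [set: X] u by exact: (locally_integrable_measurable (iu a)).
have mabs (c : R) := measurable_dist_cst c mu_u.
have mgp := measurable_gradient_power p gu.
have gD (D : set X) : measurable D -> D `<=` [set x | infdist a x < 4 / delta * rho] ->
    (\int[mu]_(x in D) (g x `^ p) <= (y `^ p)%:E)%E.
  move=> mD DL; apply: le_trans gint; apply: ge0_subset_integral => //.
  - by apply: measurable_infdist_lt; rewrite mulr_gt0// divr_gt0.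
  - exact: measurable_funTS.
  - by move=> x _; exact: poweR_ge0.
have h1 x : 0 < 1 + mdist x a by rewrite ltr_pwDl// mdist_ge0.
have [r2|r2] := leP rho 2^-1.
  have M0 : 0 < (2 * rho)^-1 by rewrite invr_gt0 mulr_gt0.
  have [|c Hc] := H1 _ y u g M0 y0 iu gu.
    apply: gD; first exact: measurable_mdist_gt.
    move=> x /=; rewrite /infdist => xM.
    have xM' : delta * (2 * rho)^-1 < 1 + mdist x a by apply: (lt_trans xM); rewrite ltrDr.
    have L0 : 0 < 4 / delta * rho by rewrite mulr_gt0// divr_gt0.
    rewrite -[ltRHS]invrK ltf_pV2 ?posrE ?invr_gt0//; apply: lt_trans xM'.
    have -> : (4 / delta * rho)^-1 = delta / (2 * rho) / 2.
      by field; rewrite !gt_eqF.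
    have : 0 < delta / (2 * rho) by rewrite divr_gt0// mulr_gt0.
    lra.
  exists c; apply: (le_trans (integral_sph_weight_far mu p1 _ (mabs c) M0 _ (infdist_lt_far r0 r2))) => //.
    exact: measurable_infdist_lt.
  apply: (le_trans Hc); rewrite lee_fin !mulrA ler_wpM2r ?(ltW y0)//.
  have -> : Num.min rho 1 = rho by apply/min_idPl; lra.
  rewrite -mulrA -powRD; last by rewrite (gt_eqF M0) implybT.
  rewrite (_ : Q - 2 * p + (1 - Q / p) = - s); last by rewrite sE; ring.
  rewrite powRN powR_invl ?mulr_ge0 ?(ltW r0)// invrK powRM ?(ltW r0)// mulrA.
  by rewrite ler_wpM2r ?powR_ge0// ler_wpM2r ?(ltW ts0)// lerDl ltW.
have [|c Hc] := H2 y u g y0 iu gu.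
  apply: gD => // x _ /=; apply: (le_lt_trans (infdist_le1 a x)).
  rewrite mulrAC ltr_pdivlMr// mul1r; lra.
exists c; apply: (@le_trans _ _ (\int[mu]_x (`|u x - c%:E| * sph_weight a p x))%E).
  apply: ge0_subset_integral => //.
  - exact: measurable_infdist_lt.
  - by apply: emeasurable_funM => //; exact: measurable_sph_weight.
  - by move=> x _; rewrite mule_ge0// sph_weight_ge0.
apply: (le_trans Hc); rewrite lee_fin ler_wpM2r ?(ltW y0)//.
have m2 : 2^-1 <= Num.min rho 1 by rewrite le_min (ltW r2)/= invf_le1 ?ler1n.
rewrite -mulrA -powRM//; last by apply: le_trans m2.
have m3 : 1 <= (2 * Num.min rho 1) `^ s by rewrite powR_ge1//; lra.
by rewrite -[leLHS]mulr1 ler_pM ?(ltW C20)// lerDr ltW.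
Qed.

End infinity_poincare.
(** * The metric of the sphericalization *)

Section sph_metric.
Context d (R : realType) (X : borelMetricType d R) (a : X).
Local Notation hX := (sphericalization a).

Definition height (x : hX) : R := if x is Some x then infdist a x else 0.

Lemma height_ge0 (x : hX) : 0 <= height x.
Proof. by case: x => [x|]//=; rewrite ltW// infdist_gt0. Qed.

Lemma height_le1 (x : hX) : height x <= 1.
Proof. by case: x => [x|]//=; rewrite infdist_le1. Qed.

Let one_mdist (x : X) : 0 < 1 + mdist x a.
Proof. by rewrite ltr_pwDl// mdist_ge0. Qed.

Lemma sph_da_SomeE (x y : X) :
  @sph_da d R X a (Some x) (Some y) = mdist x y * (infdist a x * infdist a y).
Proof. by rewrite /= -invfM. Qed.

Lemma heightB_le_da (x y : hX) : height x - height y <= sph_da x y.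
Proof.
case: x y => [x|] [y|]; rewrite ?subr0 ?subrr//; last first.
  by rewrite /= sub0r (@le_trans _ _ 0) ?oppr_le0 ?invr_ge0 ?ltW// infdist_gt0.
rewrite sph_da_SomeE /=.
have -> : infdist a x - infdist a y =
    (mdist y a - mdist x a) * (infdist a x * infdist a y).
  by rewrite /infdist; field; rewrite !gt_eqF.
rewrite ler_wpM2r ?mulr_ge0 ?(ltW (infdist_gt0 _ _))//.
by have := metric_triangle y x a; rewrite (metric_sym y x) lerBlDr.
Qed.

Lemma sph_da_le_heightD (x y : hX) : sph_da x y <= height x + height y.
Proof.
case: x y => [x|] [y|]; rewrite ?addr0 ?add0r//.
rewrite sph_da_SomeE /=.
have -> : infdist a x + infdist a y =
    (2 + mdist x a + mdist y a) * (infdist a x * infdist a y).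
  by rewrite /infdist; field; rewrite !gt_eqF.
rewrite ler_wpM2r ?mulr_ge0 ?(ltW (infdist_gt0 _ _))//.
by have := metric_triangle x a y; rewrite (metric_sym a y); lra.
Qed.

Lemma sph_chain_length_cons (x y : hX) s :
  sph_chain_length x (y :: s) = sph_da x y + sph_chain_length y s.
Proof. by rewrite /sph_chain_length/= big_cons. Qed.

Lemma sph_dist_le (x y : hX) s : last x s = y -> mdist x y <= sph_chain_length x s.
Proof.
rewrite sph_mdistE => xsy; apply: inf_lbound; last by exists s.
exists 0 => _ [t _ <-]; elim: t x {xsy} => [|z t ih] x.
  by rewrite /sph_chain_length big_nil.
rewrite sph_chain_length_cons addr_ge0//; case: x z {ih} => [x|] [z|] //=;
  by rewrite ?invr_ge0 ?divr_ge0 ?mulr_ge0 ?mdist_ge0 ?(ltW (one_mdist _)).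
Qed.

Lemma sph_dist_ge (x y : hX) (c : R) :
  (forall s, last x s = y -> c <= sph_chain_length x s) -> c <= mdist x y.
Proof.
rewrite sph_mdistE => H; apply: lb_le_inf; last by move=> _ [s /H ? <-].
by exists (sph_chain_length x [:: y]), [:: y].
Qed.

Lemma sph_dist_le_da (x y : hX) : mdist x y <= sph_da x y.
Proof.
apply: le_trans (sph_dist_le (erefl : last x [:: y] = y)) _.
by rewrite sph_chain_length_cons /sph_chain_length big_nil addr0.
Qed.

(** A chain shorter than h(x) - c never goes below height c, and there [chain_length_ge] bounds its
    length from below. *)
Lemma heightB_le_chain (x z : hX) s : z \in x :: s ->
  height x - height z <= sph_chain_length x s.
Proof.
elim: s x => [|y s ih] x.
  by rewrite inE => /eqP ->; rewrite subrr /sph_chain_length big_nil.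
rewrite in_cons => /predU1P[->|/ih {}ih].
  rewrite subrr; apply: le_trans (sph_dist_le erefl); exact: mdist_ge0.
by rewrite sph_chain_length_cons; have := heightB_le_da x y; lra.
Qed.

Lemma heightB_le (x y : hX) : height x - height y <= mdist x y.
Proof.
apply: sph_dist_ge => s <-; apply: heightB_le_chain; exact: mem_last.
Qed.

(* A chain that stays in the region height >= c never visits None. *)
Lemma chain_length_ge (c : R) (x : X) (y : X) s : 0 < c ->
  (forall z, z \in Some x :: s -> c <= height z) -> last (Some x : hX) s = Some y ->
  mdist x y * c ^+ 2 <= sph_chain_length (Some x : hX) s.
Proof.
move=> c0; elim: s x => [|[z|] s ih] x H.
- by case=> ->; rewrite mdistxx mul0r /sph_chain_length big_nil.
- move=> /= /ih H'; rewrite sph_chain_length_cons.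
  have {}H' : mdist z y * c ^+ 2 <= sph_chain_length (Some z : hX) s.
    by apply: H' => w ws; apply: H; rewrite in_cons ws orbT.
  have cx : c <= infdist a x by apply: (H (Some x)); rewrite mem_head.
  have cz : c <= infdist a z by apply: (H (Some z)); rewrite !inE eqxx orbT.
  have : mdist x z * c ^+ 2 <= sph_da (Some x : hX) (Some z).
    by rewrite sph_da_SomeE ler_wpM2l ?mdist_ge0// expr2 ler_pM// ltW.
  have := ler_wpM2r (sqr_ge0 c) (metric_triangle x z y); rewrite mulrDl; lra.
- by have := H None; rewrite !inE eqxx orbT => /(_ isT)/=; rewrite leNgt c0.
Qed.

(** Let h(x) be the larger height. A chain of length at least h(x)/2 is long enough, since d_a <=
    h(x) + h(y). A shorter one stays at height at least h(x)/2, where each link costs at least d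
    times h(x)^2 / 4. *)
Lemma sph_dist_ge_da (x y : X) :
  mdist x y * (infdist a x * infdist a y) <= 4 * mdist (Some x : hX) (Some y).
Proof.
wlog xy : x y / infdist a y <= infdist a x.
  move=> H; have [|/ltW] := leP (infdist a y) (infdist a x); first exact: H.
  by move=> /H; rewrite (metric_sym y) mulrA mulrAC -mulrA (metric_sym (Some y : hX)).
have hx0 := infdist_gt0 a x; rewrite -ler_pdivrMl//; apply: sph_dist_ge => s sy.
rewrite ler_pdivrMl//.
have [hL|Lh] := leP (infdist a x / 2) (sph_chain_length (Some x : hX) s).
  have := sph_da_le_heightD (Some x : hX) (Some y); rewrite sph_da_SomeE /=; lra.
have : mdist x y * (infdist a x / 2) ^+ 2 <= sph_chain_length (Some x : hX) s.
  apply: chain_length_ge sy; first by rewrite divr_gt0.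
  by move=> z /heightB_le_chain /=; lra.
have : mdist x y * (infdist a x * infdist a y) <= mdist x y * (infdist a x * infdist a x).
  by rewrite ler_wpM2l ?mdist_ge0// ler_pM2l.
have -> : mdist x y * (infdist a x / 2) ^+ 2 =
  mdist x y * (infdist a x * infdist a x) / 4 by field.
lra.
Qed.

(** Upper bound: the one-link chain, with h(y) <= h(x) + d. Lower bound: for d >= 1 it is trivial;
    otherwise a chain shorter than h(x)^2 d stays at height at least h(x) (1 - d), so it has length
    at least d h(x)^2 (1 - d)^2. *)
Lemma sph_dist_conformal (x y : X) :
  `|mdist (Some x : hX) (Some y) - infdist a x ^+ 2 * mdist x y| <= 2 * mdist x y ^+ 2.
Proof.
have hx0 := infdist_gt0 a x; have hx1 := infdist_le1 a x; have d0 := mdist_ge0 x y.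
have hy0 := infdist_gt0 a y; have hy1 := infdist_le1 a y.
have hxd : infdist a x * mdist x y <= mdist x y by rewrite ler_piMl.
have hxx : infdist a x ^+ 2 <= 1 by rewrite expr_le1// ltW.
have dd0 := sqr_ge0 (mdist x y).
rewrite ler_norml; apply/andP; split.
  rewrite lerBrDl addrC.
  have [d1|d1] := leP 1 (mdist x y).
    apply: le_trans (mdist_ge0 _ _); rewrite addrC subr_le0.
    apply: (@le_trans _ _ (1 * mdist x y)); first by rewrite ler_wpM2r.
    by rewrite mul1r expr2 mulrA ler_peMl//; lra.
  apply: sph_dist_ge => s sy.
  have [//|Lh] := leP (- (2 * mdist x y ^+ 2) + infdist a x ^+ 2 * mdist x y)
    (sph_chain_length (Some x : hX) s).
  exfalso; have Lh' : sph_chain_length (Some x : hX) s < infdist a x ^+ 2 * mdist x y by lra.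
  have : mdist x y * (infdist a x * (1 - mdist x y)) ^+ 2 <= sph_chain_length (Some x : hX) s.
    apply: chain_length_ge sy; first by rewrite mulr_gt0// subr_gt0.
    move=> z /heightB_le_chain /=.
    have : infdist a x ^+ 2 * mdist x y <= infdist a x * mdist x y.
      by rewrite ler_wpM2r// expr2 ler_piMr// ltW.
    lra.
  have : 0 <= mdist x y ^+ 2 * (1 - infdist a x ^+ 2) by rewrite mulr_ge0// subr_ge0.
  have : 0 <= mdist x y * (infdist a x * mdist x y) ^+ 2 by rewrite mulr_ge0// sqr_ge0.
  rewrite !exprMn; nra.
rewrite lerBlDr; apply: le_trans (sph_dist_le_da _ _) _; rewrite sph_da_SomeE.
have : infdist a y - infdist a x <= mdist x y.
  apply: (le_trans (heightB_le (Some y) (Some x))).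
  by rewrite metric_sym; exact: sph_dist_le_mdist.
have : 0 <= mdist x y * infdist a x by rewrite mulr_ge0// ltW.
nra.
Qed.

Lemma upper_gradient_sph (g u : hX -> \bar R) : upper_gradient g u ->
  upper_gradient (fun x => g (Some x) * (infdist a x ^+ 2)%:E)%E (fun x => u (Some x)).
Proof.
have lip (x y : X) : infdist a x ^+ 2 - infdist a y ^+ 2 <= 2 * mdist x y.
  have := heightB_le (Some x : hX) (Some y); have := sph_dist_le_mdist a x y; rewrite /=.
  have := infdist_gt0 a x; have := infdist_le1 a x; have := mdist_ge0 x y.
  by have := infdist_gt0 a y; have := infdist_le1 a y; nra.
apply: (upper_gradient_conformal (iota := Some : X -> hX) (K := 2)) => //.
- by move=> x; rewrite exprn_gt0// infdist_gt0.
- by move=> x; rewrite expr_le1// ?infdist_le1// ltW// infdist_gt0.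
- exact: sph_dist_conformal.
- exact: sph_Some_continuous.
- exact: lipschitz_metric_continuous lip.
Qed.

End sph_metric.
(** * Measure of balls of the sphericalization *)

Lemma powR_comparable (R : realType) (u v k s : R) : 0 < u -> 0 < v -> 1 <= k ->
  u <= k * v -> v <= k * u -> u `^ s <= k `^ `|s| * v `^ s.
Proof.
move=> u0 v0 k1 uv vu; have k0 : 0 < k by exact: lt_le_trans k1.
have [s0|s0] := leP 0 s.
  rewrite ger0_norm// -powRM ?(ltW k0) ?(ltW v0)//.
  by rewrite ge0_ler_powR ?nnegrE ?mulr_ge0 ?(ltW k0) ?(ltW v0) ?(ltW u0).
rewrite ltr0_norm// -[in u `^ s](opprK s) -[in v `^ s](opprK s) !(powRN _ (- s)).
rewrite mulrC ler_pdivlMl ?powR_gt0// ler_pdivrMr ?powR_gt0//.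
rewrite -powRM ?(ltW k0) ?(ltW u0)//.
by rewrite ge0_ler_powR ?nnegrE ?oppr_ge0 ?mulr_ge0 ?(ltW k0) ?(ltW v0) ?(ltW u0) ?(ltW s0).
Qed.

Lemma ge0_integral_ge_cst d (T : measurableType d) (R : realType)
    (mu : {measure set T -> \bar R}) (A : set T) (f : T -> \bar R) (c m : R) :
  measurable A -> measurable_fun A f -> 0 <= c -> (forall x, A x -> (c%:E <= f x)%E) ->
  (m%:E <= mu A)%E -> ((c * m)%:E <= \int[mu]_(x in A) f x)%E.
Proof.
move=> mA mf c0 cf mA'; apply: (@le_trans _ _ (\int[mu]_(x in A) (cst c%:E x))%E).
  by rewrite integral_cst// EFinM lee_wpmul2l// lee_fin.
by apply: ge0_le_integral => // x Ax; apply: le_trans (cf x Ax); rewrite lee_fin.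
Qed.

Lemma infdist_comparable d (R : realType) (X : borelMetricType d R) (a x y : X) :
  mdist x y * infdist a x <= 2^-1 ->
  infdist a y <= 2 * infdist a x /\ infdist a x <= 2 * infdist a y.
Proof.
have hx := infdist_gt0 a x; have hy := infdist_gt0 a y => H.
have := heightB_le_da (Some x : sphericalization a) (Some y).
have := heightB_le_da (Some y : sphericalization a) (Some x).
rewrite !sph_da_SomeE (metric_sym y) /=.
have := ler_wpM2r (ltW hy) H; split; lra.
Qed.

Section sph_volume.
Context d (R : realType) (X : borelMetricType d R) (mu : {measure set X -> \bar R}).
Variables (Q CA : R) (a : X) (p : R).
Hypotheses (Q0 : 0 < Q) (CA1 : 1 <= CA)
  (muB : forall (x : X) (r : R), 0 < r ->
    ((CA^-1 * r `^ Q)%:E <= mu (ball x r) <= (CA * r `^ Q)%:E)%E)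
  (p1 : 1 < p) (Q2p : Q < 2 * p).
Local Notation hX := (sphericalization a).
Local Notation hmu := (sph_measure a mu p).

Let CA0 : 0 < CA. Proof. exact: lt_le_trans ltr01 CA1. Qed.
Let p0 : 0 < p. Proof. exact: lt_trans p1. Qed.
Let p20 : 0 < 2 * p. Proof. by rewrite mulr_gt0. Qed.
Let e0 : 0 < 2 * p - Q. Proof. by rewrite subr_gt0. Qed.

(* Up to constants, the measure of the ball of radius r about x in hX. *)
Definition sph_volume (x : hX) (r : R) : R :=
  Num.max (height x) (Num.min r 1) `^ (2 * p - 2 * Q) * Num.min r 1 `^ Q.

Let min_gt0 (r : R) : 0 < r -> 0 < Num.min r 1.
Proof. by move=> r0; rewrite lt_min r0 ltr01. Qed.

Let max_gt0 (x : hX) (r : R) : 0 < r -> 0 < Num.max (height x) (Num.min r 1).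
Proof. by move=> r0; rewrite lt_max min_gt0// orbT. Qed.

Lemma sph_volume_gt0 (x : hX) (r : R) : 0 < r -> 0 < sph_volume x r.
Proof. by move=> r0; rewrite mulr_gt0// powR_gt0 ?max_gt0 ?min_gt0. Qed.

Lemma sph_volume_scale (l : R) (x : hX) (r : R) : 1 <= l -> 0 < r ->
  sph_volume x (l * r) <= l `^ (`|2 * p - 2 * Q| + Q) * sph_volume x r.
Proof.
move=> l1 r0; have l0 : 0 < l by exact: lt_le_trans l1.
have lr0 : 0 < l * r by rewrite mulr_gt0.
have rlr : r <= l * r by rewrite ler_peMl// ltW.
have s1 : Num.min r 1 <= Num.min (l * r) 1.
  by rewrite le_min !ge_min rlr lexx !orbT.
have s2 : Num.min (l * r) 1 <= l * Num.min r 1.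
  by have [|] := leP r 1; rewrite ge_min ?lexx// mulr1 l1 orbT.
have t1 : Num.max (height x) (Num.min r 1) <= Num.max (height x) (Num.min (l * r) 1).
  by rewrite ge_max !le_max lexx s1 orbT.
have t2 : Num.max (height x) (Num.min (l * r) 1) <= l * Num.max (height x) (Num.min r 1).
  rewrite ge_max; apply/andP; split.
    apply: (@le_trans _ _ (Num.max (height x) (Num.min r 1))); first by rewrite le_max lexx.
    by rewrite ler_peMl// ltW// max_gt0.
  by apply: (le_trans s2); rewrite ler_pM2l// le_max lexx orbT.
rewrite powRD; last by rewrite (gt_eqF l0) implybT.
rewrite /sph_volume mulrACA; apply: ler_pM; rewrite ?powR_ge0//.
  apply: powR_comparable; rewrite ?max_gt0//.
  by apply: (le_trans t1); rewrite ler_peMl// ltW// max_gt0.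
rewrite -powRM ?(ltW l0) ?(ltW (min_gt0 r0))//.
by rewrite ge0_ler_powR ?nnegrE ?(ltW Q0) ?mulr_ge0 ?(ltW l0) ?(ltW (min_gt0 _)).
Qed.

(** Volumes decay by a definite power of e: for 2p >= 2Q the first factor can only help and e^Q
    remains; for 2p < 2Q it costs at most e^(2p-2Q), leaving e^(2p-Q). *)
Lemma sph_volume_shrink (e : R) (x : hX) (r : R) : 0 < e <= 1 -> 0 < r ->
  sph_volume x (e * Num.min r 1) <= e `^ (Num.min Q (2 * p - Q)) * sph_volume x r.
Proof.
move=> /andP[ep e1] r0; have s0 := min_gt0 r0.
have s1 : Num.min r 1 <= 1 by rewrite ge_min lexx orbT.
have es1 : e * Num.min r 1 <= 1.
  by rewrite (le_trans _ s1)// ler_piMl// ltW.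
have es0 : 0 < e * Num.min r 1 by rewrite mulr_gt0.
have sE : Num.min (e * Num.min r 1) 1 = e * Num.min r 1 by apply/min_idPl.
rewrite /sph_volume sE; set s := Num.min r 1 in s0 s1 es1 es0 sE *.
set t := Num.max _ s; set t' := Num.max _ _.
have t0 : 0 < t by rewrite /t lt_max s0 orbT.
have tt' : t' <= t.
  by rewrite /t' /t ge_max !le_max lexx/= ler_piMl ?orbT// ltW.
have t't : e * t <= t'.
  rewrite /t'; rewrite le_max /t; have [hs|sh] := leP (height x) s.
    by rewrite lexx orbT.
  by rewrite ler_piMl// height_ge0.
have t'0 : 0 < t' by apply: lt_le_trans t't; rewrite mulr_gt0.
rewrite powRM ?(ltW ep) ?(ltW s0)// !mulrA ler_wpM2r ?powR_ge0//.
have ege (u v : R) : u <= v -> e `^ v <= e `^ u.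
  move=> uv; rewrite -(opprK u) -(opprK v) !(powRN _ (- _)).
  by rewrite -!powR_invl ?(ltW ep)// ler_powR ?lerN2// invf_ge1.
have [al|al] := leP 0 (2 * p - 2 * Q).
  rewrite mulrC ler_pM ?powR_ge0//; last by rewrite ge0_ler_powR ?nnegrE ?(ltW t0) ?(ltW t'0).
  by apply: ege; rewrite ge_min lexx.
apply: (@le_trans _ _ ((e * t) `^ (2 * p - 2 * Q) * e `^ Q)).
  rewrite ler_wpM2r ?powR_ge0//.
  rewrite -(opprB (2 * Q)) !(powRN _ (2 * Q - 2 * p)) lef_pV2 ?posrE ?powR_gt0// ?mulr_gt0//.
  by rewrite ge0_ler_powR ?nnegrE ?(ltW t'0) ?mulr_ge0 ?(ltW ep) ?(ltW t0)//; lra.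
rewrite powRM ?(ltW ep) ?(ltW t0)// mulrAC -powRD; last by rewrite (gt_eqF ep) implybT.
rewrite ler_wpM2r ?powR_ge0//; apply: ege; rewrite ge_min; apply/orP; right; lra.
Qed.

Lemma measurable_Some : measurable_fun [set: X] (Some : X -> hX).
Proof.
move=> _ A; rewrite [X in X -> _]/measurable/= /sph_measurable /image_set_system/= setTI.
exact.
Qed.

Lemma measurable_Some_ball (x : hX) (r : R) : measurable ((Some : X -> hX) @^-1` ball x r).
Proof. by rewrite -[X in measurable X]setTI; apply: measurable_Some => //; exact: measurable_mball. Qed.

Lemma sph_measure_ge_cst (D : set X) (c m : R) : measurable D -> 0 <= c ->
  (forall x, D x -> c <= infdist a x) -> (m%:E <= mu D)%E ->
  ((c `^ (2 * p) * m)%:E <= \int[mu]_(x in D) sph_weight a p x)%E.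
Proof.
move=> mD c0 cD mDm; apply: ge0_integral_ge_cst => //.
- by apply: measurable_funTS; exact: measurable_sph_weight.
- exact: powR_ge0.
- move=> x Dx; rewrite sph_weightE lee_fin ge0_ler_powR ?nnegrE ?(ltW p20)//; last exact: cD.
  exact: ltW (infdist_gt0 _ _).
Qed.

Lemma sph_measure_mono (D : set X) (A : set hX) : measurable D -> measurable A ->
  (forall x, D x -> A (Some x)) ->
  (\int[mu]_(x in D) sph_weight a p x <= hmu A)%E.
Proof.
move=> mD mA DA; apply: ge0_subset_integral => //.
- by rewrite -[X in measurable X]setTI; exact: measurable_Some.
- by apply: measurable_funTS; exact: measurable_sph_weight.
- by move=> x _; exact: sph_weight_ge0.
Qed.

(** For r <= h(x) the ball contains the ball of X of radius r / (2 h(x)^2), on which h varies by at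
    most a factor 2. *)
Let small_ball_ge : exists2 c : R, 0 < c & forall (x : X) (r : R),
  0 < r -> r <= infdist a x ->
  ((c * (infdist a x `^ (2 * p - 2 * Q) * r `^ Q))%:E <= hmu (ball (Some x : hX) r))%E.
Proof.
exists (2^-1 `^ (2 * p) * (CA^-1 * 2^-1 `^ Q)).
  by rewrite !mulr_gt0 ?powR_gt0 ?invr_gt0.
move=> x r r0 rh; have h0 := infdist_gt0 a x; set h := infdist a x in rh h0 *.
have [R' RE R0] : exists2 R', R' = r / h ^+ 2 / 2 & 0 < R'.
  by eexists; [reflexivity|rewrite divr_gt0// divr_gt0// exprn_gt0].
have near y : mdist y x < R' -> mdist x y * h <= 2^-1.
  rewrite metric_sym RE => /ltW /(ler_wpM2r (ltW h0)) => xy; apply: (le_trans xy).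
  have -> : r / h ^+ 2 / 2 * h = r / h * 2^-1 by field; rewrite gt_eqF.
  by rewrite -[leRHS]mul1r ler_wpM2r// ler_pdivrMr// mul1r.
apply: le_trans (sph_measure_mono (measurable_mball x R') (measurable_mball _ _) _); last first.
  move=> y; rewrite !ball_sphereE/= => yx; have [hy _] := infdist_comparable (near _ yx).
  rewrite metric_sym; apply: (le_lt_trans (sph_dist_le_da _ _)).
  rewrite sph_da_SomeE -/h.
  apply: (@le_lt_trans _ _ (mdist x y * (h * (2 * h)))).
    by rewrite ler_wpM2l ?mdist_ge0// ler_pM2l.
  have -> : r = R' * (h * (2 * h)) by rewrite RE; field; rewrite gt_eqF.
  by rewrite ltr_pM2r ?mulr_gt0// metric_sym.
have /andP[muR _] := muB x R0.
apply: le_trans (sph_measure_ge_cst (measurable_mball _ _) (_ : 0 <= h / 2) _ muR); last first.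
- move=> y; rewrite ball_sphereE/= => yx; have [_] := infdist_comparable (near _ yx).
  by rewrite -/h; lra.
- by rewrite divr_ge0// ltW.
rewrite lee_fin (@powRM _ h) ?(ltW h0)// RE.
rewrite (@powRM _ _ 2^-1) ?divr_ge0 ?exprn_ge0 ?(ltW r0) ?(ltW h0)//.
rewrite (@powRM _ r) ?invr_ge0 ?exprn_ge0 ?(ltW r0) ?(ltW h0)//.
rewrite -(powR_mulrn 2 (ltW h0)) (@powR_invl _ (h `^ 2%:R)) ?powR_ge0// -powRrM.
rewrite powRD; last by rewrite (gt_eqF h0) implybT.
rewrite (powRN _ (2 * Q)).
  by apply: eq_ler; ring.
by rewrite addr_ge0// mdist_ge0.
Qed.

(** The ball contains an annulus of X at scale 2 / min(r, 1): there h < r/2, and two points are at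
    distance at most the sum of their heights. *)
Let large_ball_ge : exists2 c : R, 0 < c & forall (x : hX) (r : R),
  0 < r -> 4 * height x <= r ->
  ((c * Num.min r 1 `^ (2 * p - Q))%:E <= hmu (ball x r))%E.
Proof.
have [K K1 annK] := annulus_ratio Q0 CA1 muB; have K0 : 0 < K by exact: lt_trans K1.
exists ((4 * K)^-1 `^ (2 * p) * (CA * 2 `^ Q)).
  by rewrite !mulr_gt0 ?powR_gt0 ?invr_gt0 ?mulr_gt0.
move=> x r r0 hr; have s0 := min_gt0 r0.
have s1 : Num.min r 1 <= 1 by rewrite ge_min lexx orbT.
have sr : Num.min r 1 <= r by rewrite ge_min lexx.
set s := Num.min r 1 in s0 s1 sr *.
have [M ME M0] : exists2 M, M = 2 / s & 0 < M.
  by eexists; [reflexivity|rewrite divr_gt0].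
have M2 : 2 <= M by rewrite ME ler_pdivlMr//; lra.
have sM : s = 2 * M^-1 by rewrite ME invf_div mulrCA divff ?mulr1// gt_eqF.
apply: le_trans (sph_measure_mono (measurable_annulus a M (K * M)) (measurable_mball _ _) _); last first.
  move=> y [_ /= My]; rewrite ball_sphereE/=.
  have hy : infdist a y < s / 2.
    rewrite sM mulrAC divff ?mul1r ?gt_eqF// /infdist ltf_pV2 ?posrE//.
      by apply: (le_lt_trans My); rewrite ltrDr.
    by rewrite ltr_pwDl// mdist_ge0.
  rewrite metric_sym; apply: (le_lt_trans (sph_dist_le_da _ _)).
  by apply: (le_lt_trans (sph_da_le_heightD _ _)) => /=; lra.
apply: le_trans (sph_measure_ge_cst (measurable_annulus _ _ _) (_ : 0 <= (2 * (K * M))^-1) _ (annK a M M0)); last first.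
- move=> y [yK _]; rewrite ball_sphereE/= in yK.
  rewrite /infdist lef_pV2 ?posrE ?mulr_gt0//; last by rewrite ltr_pwDl// mdist_ge0.
  have : M <= K * M by rewrite ler_peMl ?(ltW M0)// ltW.
  lra.
- by rewrite invr_ge0 !mulr_ge0 ?(ltW K0) ?(ltW M0).
rewrite lee_fin (_ : (2 * (K * M))^-1 = (4 * K)^-1 * s); last first.
  by rewrite sM; field; rewrite !gt_eqF.
rewrite (_ : M = 2 * s^-1)// powRM ?invr_ge0 ?mulr_ge0 ?(ltW K0) ?(ltW s0)//.
rewrite (@powRM _ 2) ?invr_ge0 ?(ltW s0)// (@powR_invl _ s) ?(ltW s0)//.
rewrite powRD ?powRN; last by rewrite (gt_eqF s0) implybT.
by apply: eq_ler; ring.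
Qed.

Lemma sph_ball_ge : exists2 c : R, 0 < c & forall (x : hX) (r : R), 0 < r ->
  ((c * sph_volume x r)%:E <= hmu (ball x r))%E.
Proof.
have [c1 c10 H1] := small_ball_ge; have [c2 c20 H2] := large_ball_ge.
have F0 : 0 < 4 `^ (2 * p - Q) :> R by rewrite powR_gt0.
have F1 : 1 <= 4 `^ (2 * p - Q) :> R by rewrite powR_ge1 ?(ltW e0)// ler1n.
have [c cE [c0 cc1 cc2]] : exists2 c, c = Num.min (c1 / 4 `^ (2 * p - Q)) c2 &
    [/\ 0 < c, c * 4 `^ (2 * p - Q) <= c1 & c <= c2].
  eexists; first reflexivity; rewrite lt_min c20 divr_gt0// ge_min lexx orbT; split => //.
  by rewrite -ler_pdivlMr// ge_min lexx.
have cc1' : c <= c1 by apply: le_trans cc1; rewrite ler_peMr// ltW.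
exists c => // x r r0; have s0 := min_gt0 r0.
have sr : Num.min r 1 <= r by rewrite ge_min lexx.
have volE : height x <= Num.min r 1 -> sph_volume x r = Num.min r 1 `^ (2 * p - Q).
  move=> /max_idPr hs; rewrite /sph_volume hs -powRD; last by rewrite (gt_eqF s0) implybT.
  by congr (_ `^ _); ring.
have hle1 := height_le1 x.
have [hr|rh] := leP (4 * height x) r.
  have hs : height x <= Num.min r 1.
    by rewrite le_min hle1 andbT; have := height_ge0 x; lra.
  apply: le_trans (H2 _ _ r0 hr); rewrite lee_fin volE//.
  by rewrite ler_wpM2r ?powR_ge0.
case: x volE hle1 rh => [x|] /= volE h1 rh; last by exfalso; lra.
have h0 := infdist_gt0 a x.
have [rh'|hr] := leP r (infdist a x).
  apply: le_trans (H1 _ _ r0 rh'); rewrite lee_fin /sph_volume /=.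
  have -> : Num.min r 1 = r by apply/min_idPl; exact: le_trans h1.
  by rewrite (max_idPl rh') ler_wpM2r// mulr_ge0 ?powR_ge0.
(* In the remaining range h(x) < r < 4 h(x), shrink the radius to h(x). *)
apply: (@le_trans _ _ (hmu (ball (Some x : hX) (infdist a x)))); last first.
  apply: le_measure; rewrite ?inE; [exact: measurable_mball|exact: measurable_mball|].
  by apply: le_ball; exact: ltW.
apply: le_trans (H1 _ _ h0 (lexx _)); rewrite lee_fin volE; last by rewrite le_min (ltW hr).
rewrite -powRD; last by rewrite (gt_eqF h0) implybT.
rewrite (_ : 2 * p - 2 * Q + Q = 2 * p - Q); last by ring.
apply: (@le_trans _ _ (c * (4 `^ (2 * p - Q) * infdist a x `^ (2 * p - Q)))).
  rewrite ler_pM2l// -powRM ?(ltW h0)//.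
  rewrite ge0_ler_powR ?nnegrE ?(ltW e0) ?(ltW s0) ?mulr_ge0 ?(ltW h0)//.
  by apply: (le_trans sr); exact: ltW.
by rewrite mulrA ler_wpM2r ?powR_ge0.
Qed.

(** Heights vary by at most r < h(x)/8, so d h(x)^2 is at most 8/7 of d_a, hence below 32 r / 7 < 5
    r by [sph_dist_ge_da]. *)
Lemma small_ball_sub (x : X) (r : R) : 8 * r < infdist a x ->
  (Some : X -> hX) @^-1` ball (Some x : hX) r `<=` ball x (5 * r / infdist a x ^+ 2).
Proof.
have h0 := infdist_gt0 a x => rh y; rewrite !ball_sphereE/= => yx.
have hy : 7 / 8 * infdist a x <= infdist a y.
  have := heightB_le (Some x : hX) (Some y); rewrite metric_sym/=; lra.
have := sph_dist_ge_da a x y; rewrite (metric_sym (Some x : hX)) (metric_sym x y) => H.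
rewrite ltr_pdivlMr ?exprn_gt0//.
have : mdist y x * (infdist a x * (7 / 8 * infdist a x)) <=
    mdist y x * (infdist a x * infdist a y).
  by rewrite ler_wpM2l ?mdist_ge0// ler_pM2l.
have : 0 <= mdist (Some y : hX) (Some x) by exact: mdist_ge0.
have -> : mdist y x * (infdist a x * (7 / 8 * infdist a x)) =
  7 / 8 * (mdist y x * infdist a x ^+ 2) by ring.
lra.
Qed.

Lemma small_ball_infdist (x y : X) (r : R) : 8 * r < infdist a x ->
  ball (Some x : hX) r (Some y) -> infdist a y <= 2 * infdist a x.
Proof.
have h0 := infdist_gt0 a x; rewrite ball_sphereE/= => rh yx.
by have := heightB_le (Some y : hX) (Some x); rewrite /=; lra.
Qed.

(** If h(x) <= 8 r the ball lies in the set h < 9 r, measured by [sph_measure_le]. Otherwise it lies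
    in a ball of X of radius 5 r / h(x)^2, where the weight is at most (2 h(x))^(2p). *)
Lemma sph_ball_le : exists2 C : R, 0 < C & forall (x : hX) (r : R), 0 < r ->
  (hmu (ball x r) <= (C * sph_volume x r)%:E)%E.
Proof.
have [C1 C10 H1] := sph_measure_le a CA1 muB p1 Q2p.
have [C2 C2E C20] : exists2 C2, C2 = 2 `^ (2 * p) * (CA * 5 `^ Q) & 0 < C2.
  by eexists; [reflexivity|rewrite !mulr_gt0 ?powR_gt0].
have [C3 C3E C30] : exists2 C3, C3 = C1 * 9 `^ (2 * p - Q) * 8 `^ `|2 * p - 2 * Q| & 0 < C3.
  by eexists; [reflexivity|rewrite !mulr_gt0 ?powR_gt0].
exists (C2 + C3) => [|x r r0]; first by rewrite addr_gt0.
have s0 := min_gt0 r0; have V0 := sph_volume_gt0 x r0.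
have [hr|rh] := leP (height x) (8 * r).
  have r90 : 0 < 9 * r by rewrite mulr_gt0.
  apply: (@le_trans _ _ (\int[mu]_(y in [set y | (infdist a y < 9 * r)%R]) sph_weight a p y)%E).
    apply: ge0_subset_integral => //.
    - exact: measurable_Some_ball.
    - exact: measurable_infdist_lt.
    - by apply: measurable_funTS; exact: measurable_sph_weight.
    - by move=> y _; exact: sph_weight_ge0.
    - move=> y; rewrite /preimage/= ball_sphereE/= => yx.
      by have := heightB_le (Some y : hX) x; rewrite /=; lra.
  apply: (le_trans (H1 _ r90)); rewrite lee_fin (mulrDl C2 C3) ler_wpDl ?(mulr_ge0 (ltW C20) (ltW V0))//.
  rewrite C3E -!mulrA ler_pM2l//.
  apply: (@le_trans _ _ (9 `^ (2 * p - Q) * Num.min r 1 `^ (2 * p - Q))).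
    rewrite -powRM ?(ltW s0)// ge0_ler_powR ?nnegrE ?(ltW e0) ?(ltW (min_gt0 r90)) ?mulr_ge0 ?(ltW s0)//.
    by have [|] := leP r 1; rewrite ge_min ?lexx// mulr1 ler1n orbT.
  rewrite ler_wpM2l ?powR_ge0// /sph_volume mulrA.
  rewrite (_ : 2 * p - Q = 2 * p - 2 * Q + Q); last by ring.
  rewrite powRD; last by rewrite (gt_eqF s0) implybT.
  rewrite ler_wpM2r ?powR_ge0//; apply: powR_comparable => //; first exact: max_gt0.
  - by rewrite ler1n.
  - by have := max_gt0 x r0; have : Num.min r 1 <= Num.max (height x) (Num.min r 1);
      [rewrite le_max lexx orbT|lra].
  - rewrite ge_max; apply/andP; split; last by lra.
    have := height_le1 x; have [|] := leP r 1; lra.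
case: x rh V0 => [x|] /= rh V0; last by exfalso; lra.
have h0 := infdist_gt0 a x; have h1 := infdist_le1 a x.
have R0 : 0 < 5 * r / infdist a x ^+ 2 by rewrite divr_gt0 ?mulr_gt0 ?exprn_gt0.
have /andP[_ muR] := muB x R0.
apply: (@le_trans _ _ ((2 * infdist a x) `^ (2 * p) * (CA * (5 * r / infdist a x ^+ 2) `^ Q))%:E).
  apply: ge0_integral_le_cst => //.
  - exact: measurable_Some_ball.
  - by apply: measurable_funTS; exact: measurable_sph_weight.
  - by move=> y _; exact: sph_weight_ge0.
  - exact: powR_ge0.
  - move=> y yx; rewrite sph_weightE lee_fin.
    rewrite ge0_ler_powR ?nnegrE ?(ltW p20) ?mulr_ge0 ?(ltW h0) ?(ltW (infdist_gt0 _ _))//.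
    exact: small_ball_infdist yx.
  - apply: le_trans muR; apply: le_measure; rewrite ?inE; [exact: measurable_Some_ball|exact: measurable_mball|].
    exact: small_ball_sub.
rewrite lee_fin (mulrDl C2 C3) ler_wpDr ?(mulr_ge0 (ltW C30) (ltW V0))//.
have r1 : r <= 1 by lra.
rewrite /sph_volume (min_idPl r1) (max_idPl (_ : r <= infdist a x)); last by lra.
rewrite (@powRM _ 2) ?(ltW h0)// (@powRM _ (5 * r)) ?mulr_ge0 ?invr_ge0 ?exprn_ge0 ?(ltW h0) ?(ltW r0)//.
rewrite (@powRM _ 5) ?(ltW r0)// -(powR_mulrn 2 (ltW h0)) (@powR_invl _ (infdist a x `^ 2%:R)) ?powR_ge0// -powRrM.
rewrite [in leRHS]powRD ?(powRN _ (2 * Q)) ?C2E; last by rewrite (gt_eqF h0) implybT.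
by apply: eq_ler; ring.
Qed.

Lemma sph_ball_scale (l : R) : 1 <= l -> exists2 C : R, 0 < C & forall (x : hX) (r : R),
  0 < r -> (hmu (ball x (l * r)) <= C%:E * hmu (ball x r))%E.
Proof.
have [C C0 HC] := sph_ball_le; have [c c0 Hc] := sph_ball_ge => l1.
have l0 : 0 < l by exact: lt_le_trans l1.
have L0 : 0 < l `^ (`|2 * p - 2 * Q| + Q) by rewrite powR_gt0.
exists (C * l `^ (`|2 * p - 2 * Q| + Q) / c) => [|x r r0]; first by rewrite divr_gt0// mulr_gt0.
have lr0 : 0 < l * r by rewrite mulr_gt0.
apply: (le_trans (HC _ _ lr0)).
apply: (@le_trans _ _ ((C * l `^ (`|2 * p - 2 * Q| + Q) / c)%:E * (c * sph_volume x r)%:E)%E); last first.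
  by rewrite lee_wpmul2l ?Hc// lee_fin divr_ge0 ?mulr_ge0 ?(ltW C0) ?(ltW c0) ?(ltW L0).
rewrite -EFinM lee_fin.
have -> : C * l `^ (`|2 * p - 2 * Q| + Q) / c * (c * sph_volume x r) =
  C * (l `^ (`|2 * p - 2 * Q| + Q) * sph_volume x r) by field; rewrite gt_eqF.
rewrite ler_pM2l//; exact: sph_volume_scale.
Qed.

Lemma sph_doubling : doubling_measure hmu.
Proof.
have [C C0 H] := sph_ball_scale (ler1n _ 2).
have [c c0 Hc] := sph_ball_ge.
exists C => // x r r0; split.
- have r20 : 0 < 2 * r by rewrite mulr_gt0.
  by apply: lt_le_trans (Hc _ _ r20); rewrite lte_fin mulr_gt0// sph_volume_gt0.
- exact: H.
- have [C' C'0 H'] := sph_ball_le.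
  apply: (@le_lt_trans _ _ (C%:E * (C' * sph_volume x r)%:E)%E); last by rewrite -EFinM ltry.
  by rewrite lee_wpmul2l ?H'// lee_fin ltW.
Qed.

(** If no point of the ball were at distance e min(r, 1) from its centre, the ball would be
    contained in a much smaller one, whose measure is too small by [sph_volume_shrink]. *)
Lemma sph_diameter : exists2 c : R, 0 < c & forall (x : hX) (r : R), 0 < r ->
  ((c * Num.min r 1)%:E <= diameter (ball x r))%E.
Proof.
have [C C0 HC] := sph_ball_le; have [c c0 Hc] := sph_ball_ge.
have k0 : 0 < Num.min Q (2 * p - Q) by rewrite lt_min Q0 e0.
have [e e01 eC] : exists2 e : R, 0 < e <= 1 & C * e `^ (Num.min Q (2 * p - Q)) < c.
  have q0 : 0 < Num.min 1 (c / (2 * C)) by rewrite lt_min ltr01 divr_gt0// mulr_gt0.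
  exists (Num.min 1 (c / (2 * C)) `^ (Num.min Q (2 * p - Q))^-1).
    rewrite powR_gt0//=; have h : (1 : R) `^ (Num.min Q (2 * p - Q))^-1 = 1 by rewrite powR1.
    by rewrite -[leRHS]h ge0_ler_powR ?nnegrE ?invr_ge0 ?(ltW k0) ?(ltW q0)// ge_min lexx.
  rewrite -powRrM mulVf ?gt_eqF// powRr1 ?(ltW q0)//.
  apply: (@le_lt_trans _ _ (C * (c / (2 * C)))); first by rewrite ler_pM2l// ge_min lexx orbT.
  have -> : C * (c / (2 * C)) = c / 2 by field; rewrite gt_eqF.
  lra.
have /andP[ep e1] := e01.
exists e => // x r r0; have s0 := min_gt0 r0; have es0 : 0 < e * Num.min r 1 by rewrite mulr_gt0.
have [[y yx ye]|H] := pselect (exists2 y, ball x r y & e * Num.min r 1 <= mdist y x).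
  apply: (@le_trans _ _ (mdist y x)%:E); first by rewrite lee_fin.
  apply: ereal_sup_ubound; exists (y, x) => //=; split => //; exact: ballxx.
exfalso; have : (hmu (ball x r) <= hmu (ball x (e * Num.min r 1)%R))%E.
  apply: le_measure; rewrite ?inE; [exact: measurable_mball|exact: measurable_mball|].
  move=> y yx; rewrite ball_sphereE/= ltNge; apply/negP => ye; apply: H.
  by exists y.
move=> /(le_trans (Hc _ _ r0)) /le_trans/(_ (HC _ _ es0)); rewrite lee_fin.
have V0 := sph_volume_gt0 x r0.
move=> /le_trans/(_ (ler_wpM2l (ltW C0) (sph_volume_shrink x e01 r0))).
rewrite [leRHS]mulrA ler_pM2r// leNgt eC//.
Qed.

End sph_volume.
(** * Poincare inequality on the sphericalization *)

Section mean_dist.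
Context d (T : measurableType d) (R : realType) (mu : {measure set T -> \bar R}).

(** The mean is at most twice as bad as any other constant. *)
Lemma integral_dist_mean_le (A : set T) (u : T -> \bar R) (c H V : R) :
  measurable A -> mu A = V%:E -> 0 < V -> mu.-integrable A u ->
  (\int[mu]_(y in A) `|u y - c%:E| <= H%:E)%E ->
  exists2 m : R, (\int[mu]_(x in A) u x)%E = (m * V)%:E &
    (\int[mu]_(y in A) `|u y - m%:E| <= (2 * H)%:E)%E.
Proof.
move=> mA AV V0 iu Hc.
have fI : (\int[mu]_(x in A) u x)%E \is a fin_num by exact: integrable_fin_num.
exists (fine (\int[mu]_(x in A) u x)%E / V); first by rewrite divfK ?gt_eqF// fineK.
set m := _ / V.
have Iu : (\int[mu]_(x in A) u x)%E = (m * V)%:E by rewrite /m divfK ?gt_eqF// fineK.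
have [mu_ _] := integrableP _ _ _ iu.
have ic : mu.-integrable A (cst c%:E).
  apply/integrableP; split => //; rewrite /= integral_cst// AV -EFinM; exact: ltry.
have cm : `|c - m| * V <= H.
  rewrite -lee_fin; apply: le_trans Hc.
  have -> : (`|c - m| * V)%:E = `|\int[mu]_(y in A) (u y - cst c%:E y)|%E.
    rewrite integralB// Iu integral_cst// AV -EFinM -EFinB /= -mulrBl normrM (gtr0_norm V0).
    by rewrite distrC.
  apply: le_abse_integral => //; exact: emeasurable_funB.
have Am : (mu A <= V%:E)%E by rewrite AV.
apply: (le_trans (integral_dist_change m mA mu_ Am Hc)); rewrite lee_fin; lra.
Qed.

End mean_dist.

Section sph_poincare.
Context d (R : realType) (X : borelMetricType d R) (mu : {measure set X -> \bar R}).
Variables (Q CA : R) (a : X) (p q : R).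
Hypotheses (Q0 : 0 < Q) (CA1 : 1 <= CA)
  (muB : forall (x : X) (r : R), 0 < r ->
    ((CA^-1 * r `^ Q)%:E <= mu (ball x r) <= (CA * r `^ Q)%:E)%E)
  (q1 : 1 < q) (qQ : q <= Q) (qp : q <= p) (Q2p : Q < 2 * p)
  (X_poincare : poincare_inequality mu q).
Local Notation hX := (sphericalization a).
Local Notation hmu := (sph_measure a mu p).

Let CA0 : 0 < CA. Proof. exact: lt_le_trans ltr01 CA1. Qed.
Let q0 : 0 < q. Proof. exact: lt_trans ltr01 q1. Qed.
Let p1 : 1 < p. Proof. exact: lt_le_trans q1 qp. Qed.
Let p0 : 0 < p. Proof. exact: lt_trans p1. Qed.
Let p20 : 0 < 2 * p. Proof. by rewrite mulr_gt0. Qed.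

Let locally_integrable (u : X -> \bar R) := forall x rho, mu.-integrable (ball x rho) u.

(** Radius times V (y^p / V)^(1/p), where V is the volume and y^p the energy: a Poincare bound
    multiplied by V. *)
Let sph_bound (x : hX) (r y : R) : R :=
  Num.min r 1 * (sph_volume Q p x r `^ (1 - p^-1) * y).

(** The ball is nearly a ball of X of radius 5 r / h(x)^2 on which the weight is at most a multiple
    of h(x)^(2p). The Poincare inequality of X at this scale is combined with
    [integral_power_le]. *)
Lemma local_sph_poincare : exists l Lam C : R, [/\ 1 <= l, 1 <= Lam, 0 < C &
  forall (x : X) (r y : R) (u g : X -> \bar R), 0 < r -> 0 < y ->
    l * r <= infdist a x -> locally_integrable u -> upper_gradient g u ->
    (\int[mu]_(z in (Some : X -> hX) @^-1` ball (Some x : hX) (Lam * r)) (g z `^ p) <=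
      (y `^ p)%:E)%E ->
    exists c : R, (\int[mu]_(z in (Some : X -> hX) @^-1` ball (Some x : hX) r)
      (`|u z - c%:E| * sph_weight a p z) <= (C * sph_bound (Some x) r y)%:E)%E].
Proof.
have [C2 [lam [C20 lam1 H2]]] := poincare_local Q0 CA1 muB q0 X_poincare.
have lam0 : 0 < lam by exact: lt_le_trans lam1.
have [e eE e1] : exists2 e, e = CA * lam `^ Q + 1 & 1 <= e.
  by eexists; [reflexivity|rewrite lerDr mulr_ge0 ?powR_ge0// ltW].
have e0 : 0 < e by exact: lt_le_trans e1.
(* Power of the radius rho in X: Q from the volume, 1 from the diameter, -Q/p from normalizing the
   energy. *)
have [b bE] : exists b, b = Q + 1 - Q / p by eexists; reflexivity.
exists (10 * lam), (10 * lam), (2 `^ (2 * p) * (C2 * e * 5 `^ b)); split; [lra|lra| |].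
  by rewrite !mulr_gt0 ?powR_gt0.
move=> x r y u g r0 y0 rh iu gu gint; have [mg g0 _] := gu.
have mu_u : measurable_fun [set: X] u by exact: (locally_integrable_measurable (iu a)).
have mabs (c : R) := measurable_dist_cst c mu_u.
have mgT := borel_measurable_fun mg.
have mgp := measurable_gradient_power p gu.
have h0 := infdist_gt0 a x; have h1 := infdist_le1 a x.
have r8 : 8 * r < infdist a x by nra.
have [rho rhoE rho0] : exists2 rho, rho = 5 * r / infdist a x ^+ 2 & 0 < rho.
  by eexists; [reflexivity|rewrite divr_gt0 ?mulr_gt0 ?exprn_gt0].
have [t tE t0] : exists2 t, t = rho `^ (- (Q / p)) * y & 0 < t.
  by eexists; [reflexivity|rewrite mulr_gt0 ?powR_gt0].
have tp : rho `^ Q * t `^ p = y `^ p.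
  rewrite tE powRM ?powR_ge0 ?(ltW y0)// -powRrM mulNr divfK ?gt_eqF//.
  by rewrite mulrA -powRD ?subrr ?powRr0 ?mul1r// (gt_eqF rho0) implybT.
have lrho0 : 0 < lam * rho by rewrite mulr_gt0.
have sub : ball x (lam * rho) `<=` (Some : X -> hX) @^-1` ball (Some x : hX) (10 * lam * r).
  move=> z; rewrite /preimage/= !ball_sphereE/= metric_sym => xz.
  have near : mdist x z * infdist a x <= 2^-1.
    apply: (le_trans (ler_wpM2r (ltW h0) (ltW xz))).
    have -> : lam * rho * infdist a x = (10 * lam * r) / infdist a x / 2.
      by rewrite rhoE; field; rewrite gt_eqF.
    by rewrite -[leRHS]mul1r ler_wpM2r// ler_pdivrMr// mul1r.
  have [hz _] := infdist_comparable near.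
  rewrite metric_sym; apply: (le_lt_trans (sph_dist_le_da _ _)); rewrite sph_da_SomeE.
  apply: (@le_lt_trans _ _ (mdist x z * (infdist a x * (2 * infdist a x)))).
    by rewrite ler_wpM2l ?mdist_ge0// ler_pM2l.
  have -> : 10 * lam * r = lam * rho * (infdist a x * (2 * infdist a x)).
    by rewrite rhoE; field; rewrite gt_eqF.
  by rewrite ltr_pM2r// !mulr_gt0.
have [|c Hc] := H2 x rho (e * t) u g rho0 (mulr_gt0 e0 t0) (iu x) gu.
  have /andP[_ DV] := muB x lrho0.
  apply: (le_trans (integral_power_le (measurable_mball _ _) (measurable_funTS mgT) g0 q0 qp t0
    DV (V' := rho `^ Q) _)).
    rewrite tp; apply: le_trans gint; apply: ge0_subset_integral => //.
    - exact: measurable_mball.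
    - exact: measurable_Some_ball.
    - exact: measurable_funTS.
    - by move=> z _; exact: poweR_ge0.
  rewrite lee_fin powRM ?(ltW lam0) ?(ltW rho0)// (@powRM _ e) ?(ltW e0) ?(ltW t0)//.
  rewrite (_ : CA * (lam `^ Q * rho `^ Q) + rho `^ Q = rho `^ Q * e); last by rewrite eE; ring.
  rewrite -mulrA ler_wpM2l ?powR_ge0// ler_wpM2r ?powR_ge0//.
  by rewrite -[leLHS]powRr1 ?(ltW e0)// ler_powR// ltW.
exists c.
apply: (@le_trans _ _ (\int[mu]_(z in (Some : X -> hX) @^-1` ball (Some x : hX) r)
    (((2 * infdist a x) `^ (2 * p))%:E * `|u z - c%:E|))%E).
  apply: ge0_le_integral => //.
  - exact: measurable_Some_ball.
  - by move=> z _; rewrite mule_ge0// sph_weight_ge0.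
  - by apply: measurable_funTS; apply: emeasurable_funM => //; exact: measurable_sph_weight.
  - by apply: measurable_funTS; exact: emeasurable_funM.
  - move=> z zx; rewrite muleC lee_wpmul2r// sph_weightE lee_fin.
    rewrite ge0_ler_powR ?nnegrE ?(ltW p20) ?mulr_ge0 ?(ltW h0) ?(ltW (infdist_gt0 _ _))//.
    exact: small_ball_infdist zx.
rewrite ge0_integralZl_EFin ?powR_ge0//; last 2 first.
- exact: measurable_Some_ball.
- exact: measurable_funTS.
apply: (@le_trans _ _ (((2 * infdist a x) `^ (2 * p))%:E *
    (C2 * rho `^ Q * (rho * (e * t)))%:E)%E).
  rewrite lee_wpmul2l ?lee_fin ?powR_ge0//; apply: le_trans Hc.
  apply: ge0_subset_integral => //.
  - exact: measurable_Some_ball.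
  - exact: measurable_mball.
  - exact: measurable_funTS.
  - by rewrite rhoE; exact: small_ball_sub.
rewrite -EFinM lee_fin tE.
have -> : (2 * infdist a x) `^ (2 * p) * (C2 * rho `^ Q * (rho * (e * (rho `^ (- (Q / p)) * y)))) =
  (2 * infdist a x) `^ (2 * p) * (C2 * e * (rho `^ Q * rho `^ 1 * rho `^ (- (Q / p))) * y).
  by rewrite powRr1 ?(ltW rho0)//; ring.
rewrite -!powRD ?(gt_eqF rho0) ?implybT// -bE rhoE.
have r1 : r <= 1 by lra.
rewrite /sph_bound /sph_volume /= (min_idPl r1) (max_idPl (_ : r <= infdist a x)); last by lra.
rewrite (@powRM _ 2) ?(ltW h0)// (@powRM _ (5 * r)) ?mulr_ge0 ?invr_ge0 ?exprn_ge0 ?(ltW h0) ?(ltW r0)//.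
rewrite (@powRM _ 5) ?(ltW r0)// -(powR_mulrn 2 (ltW h0)) (@powR_invl _ (infdist a x `^ 2%:R)) ?powR_ge0//.
rewrite -powRrM -powRN (@powRM _ (infdist a x `^ _)) ?powR_ge0// -!powRrM.
have -> : r * (infdist a x `^ ((2 * p - 2 * Q) * (1 - p^-1)) * r `^ (Q * (1 - p^-1)) * y) =
    infdist a x `^ ((2 * p - 2 * Q) * (1 - p^-1)) * (r `^ 1 * r `^ (Q * (1 - p^-1))) * y.
  by rewrite powRr1 ?(ltW r0)//; ring.
rewrite -powRD ?(gt_eqF r0) ?implybT//.
rewrite (_ : 1 + Q * (1 - p^-1) = b); last by rewrite bE; ring.
(* The powers of h(x) match: 2p from the weight, -2b from rho, which is proportional to
   h(x)^(-2). *)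
rewrite (_ : (2 * p - 2 * Q) * (1 - p^-1) = 2 * p + - (2 * b)); last first.
  by rewrite bE; field; rewrite gt_eqF.
rewrite (@powRD _ (infdist a x)) ?(gt_eqF h0) ?implybT//.
by apply: eq_ler; ring.
Qed.

(** As h(x) <= l r, the ball lies between neighbourhoods of infinity of comparable size, and
    [infinity_poincare] applies. *)
Lemma global_sph_poincare (l : R) : 1 <= l -> exists Lam C : R, [/\ 1 <= Lam, 0 < C &
  forall (x : hX) (r y : R) (u g : X -> \bar R), 0 < r -> 0 < y ->
    height x <= l * r -> locally_integrable u -> upper_gradient g u ->
    (\int[mu]_(z in (Some : X -> hX) @^-1` ball x (Lam * r)) (g z `^ p) <= (y `^ p)%:E)%E ->
    exists c : R, (\int[mu]_(z in (Some : X -> hX) @^-1` ball x r)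
      (`|u z - c%:E| * sph_weight a p z) <= (C * sph_bound x r y)%:E)%E].
Proof.
move=> l1; have [L [C [L1 C0 H]]] := infinity_poincare a Q0 CA1 muB q1 qQ qp Q2p X_poincare.
(* Points of the ball have height below r + h(x) <= (1 + l) r. *)
have [k kE k1] : exists2 k, k = 1 + l & 1 <= k by eexists; [reflexivity|lra].
have k0 : 0 < k by exact: lt_le_trans k1.
have s0 : 0 <= 2 * p - Q - (1 - Q / p).
  have := exponent_gap Q0 p1 Q2p; have : 0 < 2 * p - Q by rewrite subr_gt0.
  lra.
exists ((L + 1) * k), (C * k `^ (2 * p - Q - (1 - Q / p)) *
  k `^ `|(2 * p - 2 * Q) * (1 - p^-1)|); split.
- by rewrite mulrDl mul1r ler_wpDl// mulr_ge0 ?(ltW k0)//; lra.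
- by rewrite !mulr_gt0 ?powR_gt0.
move=> x r y u g r0 y0 hr iu gu gint; have [mg g0 _] := gu.
have mu_u : measurable_fun [set: X] u by exact: (locally_integrable_measurable (iu a)).
have mabs (c : R) := measurable_dist_cst c mu_u.
have mgp := measurable_gradient_power p gu.
have kr0 : 0 < k * r by rewrite mulr_gt0.
have Lkr0 : 0 < L * (k * r) by rewrite mulr_gt0//; lra.
have [|c Hc] := H _ y u g kr0 y0 iu gu.
  apply: le_trans gint; apply: ge0_subset_integral => //.
  - exact: measurable_infdist_lt.
  - exact: measurable_Some_ball.
  - exact: measurable_funTS.
  - by move=> z _; exact: poweR_ge0.
  - move=> z /= zL; rewrite /preimage/= ball_sphereE/=.
    apply: (le_lt_trans (le_trans (sph_dist_le_da _ _) (sph_da_le_heightD _ _))) => /=.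
    have : (L + 1) * k * r = L * (k * r) + r + l * r by rewrite kE; ring.
    lra.
exists c; apply: (@le_trans _ _ (\int[mu]_(z in [set z | (infdist a z < k * r)%R])
    (`|u z - c%:E| * sph_weight a p z))%E).
  apply: ge0_subset_integral => //.
  - exact: measurable_Some_ball.
  - exact: measurable_infdist_lt.
  - by apply: measurable_funTS; apply: emeasurable_funM => //; exact: measurable_sph_weight.
  - by move=> z _; rewrite mule_ge0// sph_weight_ge0.
  - move=> z; rewrite /preimage/= ball_sphereE/= => zx.
    by have := heightB_le (Some z : hX) x; rewrite /= kE; lra.
apply: (le_trans Hc); rewrite lee_fin.
have m0 : 0 < Num.min r 1 by rewrite lt_min r0 ltr01.
have m1 : Num.min (k * r) 1 <= k * Num.min r 1.
  by have [|] := leP r 1; rewrite ge_min ?lexx// mulr1 k1 orbT.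
have mk0 : 0 < Num.min (k * r) 1 by rewrite lt_min kr0 ltr01.
rewrite /sph_bound mulrA -!(mulrA C) ler_pM2l// mulrA ler_wpM2r ?(ltW y0)//.
apply: (@le_trans _ _ (k `^ (2 * p - Q - (1 - Q / p)) * Num.min r 1 `^ (2 * p - Q - (1 - Q / p)))).
  by rewrite -powRM ?(ltW k0) ?(ltW m0)// ge0_ler_powR ?nnegrE ?mulr_ge0 ?(ltW k0) ?(ltW m0) ?(ltW mk0).
rewrite -!mulrA ler_wpM2l ?powR_ge0// /sph_volume.
set t := Num.max _ _.
have t0 : 0 < t by rewrite /t lt_max m0 orbT.
have mt : Num.min r 1 <= t by rewrite /t le_max lexx orbT.
have tm : t <= k * Num.min r 1.
  rewrite /t ge_max; apply/andP; split; last by rewrite ler_peMl ?(ltW m0).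
  by have := height_le1 x; have [|] := leP r 1; nra.
rewrite (@powRM _ (t `^ _)) ?powR_ge0// -!powRrM.
have -> : k `^ `|(2 * p - 2 * Q) * (1 - p^-1)| * (Num.min r 1 *
    (t `^ ((2 * p - 2 * Q) * (1 - p^-1)) * Num.min r 1 `^ (Q * (1 - p^-1)))) =
  k `^ `|(2 * p - 2 * Q) * (1 - p^-1)| * t `^ ((2 * p - 2 * Q) * (1 - p^-1)) *
    (Num.min r 1 `^ 1 * Num.min r 1 `^ (Q * (1 - p^-1))).
  by rewrite powRr1 ?(ltW m0)//; ring.
rewrite -powRD ?(gt_eqF m0) ?implybT//.
apply: (@le_trans _ _ (Num.min r 1 `^ ((2 * p - 2 * Q) * (1 - p^-1)) *
    Num.min r 1 `^ (1 + Q * (1 - p^-1)))).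
  rewrite -powRD ?(gt_eqF m0) ?implybT//; apply: eq_ler; congr (_ `^ _).
  by field; rewrite gt_eqF.
rewrite ler_wpM2r ?powR_ge0//; apply: powR_comparable => //.
by apply: (le_trans mt); rewrite ler_peMl ?(ltW t0).
Qed.

Lemma weighted_sph_poincare : exists Lam C : R, [/\ 1 <= Lam, 0 < C &
  forall (x : hX) (r y : R) (u g : X -> \bar R), 0 < r -> 0 < y ->
    locally_integrable u -> upper_gradient g u ->
    (\int[mu]_(z in (Some : X -> hX) @^-1` ball x (Lam * r)) (g z `^ p) <= (y `^ p)%:E)%E ->
    exists c : R, (\int[mu]_(z in (Some : X -> hX) @^-1` ball x r)
      (`|u z - c%:E| * sph_weight a p z) <= (C * sph_bound x r y)%:E)%E].
Proof.
have [l [L1 [C1 [l1 L11 C10 H1]]]] := local_sph_poincare.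
have [L2 [C2 [L21 C20 H2]]] := global_sph_poincare l1.
exists (Num.max L1 L2), (C1 + C2); split; [by rewrite le_max L11|exact: addr_gt0|].
move=> x r y u g r0 y0 iu gu gint; have [mg g0 _] := gu.
have mgp := measurable_gradient_power p gu.
have sub L : L <= Num.max L1 L2 ->
    (\int[mu]_(z in (Some : X -> hX) @^-1` ball x (L * r)) (g z `^ p) <= (y `^ p)%:E)%E.
  move=> LL; apply: le_trans gint; apply: ge0_subset_integral => //.
  - exact: measurable_Some_ball.
  - exact: measurable_Some_ball.
  - exact: measurable_funTS.
  - by move=> z _; exact: poweR_ge0.
  - by move=> z; rewrite /preimage/=; apply: le_ball; rewrite ler_wpM2r// ltW.
have b0 : 0 <= sph_bound x r y.
  by rewrite mulr_ge0 ?le_min ?(ltW r0) ?ler01// mulr_ge0 ?powR_ge0// ltW.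
have [hr|rh] := leP (height x) (l * r).
  have [|c Hc] := H2 x r y u g r0 y0 hr iu gu; first by apply: sub; rewrite le_max lexx orbT.
  by exists c; apply: (le_trans Hc); rewrite lee_fin ler_wpM2r// lerDr ltW.
have h0 : 0 < height x by apply: lt_trans rh; rewrite mulr_gt0//; lra.
case: x gint sub b0 h0 rh => [x|] gint sub b0 h0 rh; last by move: h0; rewrite /= ltxx.
have [|c Hc] := H1 x r y u g r0 y0 (ltW rh) iu gu; first by apply: sub; rewrite le_max lexx.
by exists c; apply: (le_trans Hc); rewrite lee_fin ler_wpM2r// lerDl ltW.
Qed.

End sph_poincare.

(** * Integrals on the sphericalization, and conclusion *)

Section sph_integral.
Context d (R : realType) (X : borelMetricType d R) (mu : {measure set X -> \bar R}).
Variables (a : X) (p : R).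
Hypothesis p0 : 0 < p.
Local Notation hX := (sphericalization a).
Local Notation hmu := (sph_measure a mu p).

Lemma integral_sph_measure (D : set hX) (f : hX -> \bar R) :
  measurable D -> measurable_fun D f -> (forall y, (0 <= f y)%E) ->
  (\int[hmu]_(y in D) f y)%E =
  (\int[mu]_(x in (Some : X -> hX) @^-1` D) (f (Some x) * sph_weight a p x))%E.
Proof.
move=> mD mf f0.
apply: (ge0_integral_density (phi := Some : X -> hX)
  (w := fun x => (1 + mdist x a) `^ (- (2 * p)))) => //.
- by apply/measurable_EFinP; exact: measurable_sph_weight.
- by move=> x; exact: powR_ge0.
Qed.

(** Conformal invariance of the p-energy: the weight h^(2p) is the p-th power of the factor h^2. *)
Lemma integral_sph_measure_power (D : set hX) (g : hX -> \bar R) :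
  measurable D -> measurable_fun [set: hX] g -> (forall y, (0 <= g y)%E) ->
  (\int[hmu]_(y in D) (g y `^ p))%E =
  (\int[mu]_(x in (Some : X -> hX) @^-1` D) ((g (Some x) * (infdist a x ^+ 2)%:E) `^ p))%E.
Proof.
move=> mD mg g0; rewrite integral_sph_measure//.
- apply: eq_integral => x _; have h0 := infdist_gt0 a x.
  rewrite poweRM ?lee_fin ?sqr_ge0// sph_weightE -(powR_mulrn _ (ltW h0)) poweR_EFin -powRrM.
  by [].
- by apply: measurable_funTS; exact: (measurableT_comp (measurable_poweR p) mg).
- by move=> y; exact: poweR_ge0.
Qed.

(** On each ball of X the weight is bounded below by a positive constant. *)
Lemma sph_locally_integrable (u : hX -> \bar R) : hmu.-integrable [set: hX] u ->
  forall (x : X) (rho : R), mu.-integrable (ball x rho) (fun z => u (Some z)).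
Proof.
move=> /integrableP[mu_ iu] x rho.
have mS : measurable_fun [set: X] (fun z => u (Some z)).
  exact: measurableT_comp mu_ (@measurable_Some _ _ _ _).
apply/integrableP; split; first exact: measurable_funTS.
have [k kE k0] : exists2 k, k = 1 + mdist x a + `|rho| & 0 < k.
  by eexists; [reflexivity|rewrite ltr_pwDl// ltr_pwDl// mdist_ge0].
have K0 : 0 < k `^ (2 * p) by rewrite powR_gt0.
have mf : measurable_fun [set: X] (fun z => `|u (Some z)| * sph_weight a p z)%E.
  by apply: emeasurable_funM; [exact: measurableT_comp|exact: measurable_sph_weight].
apply: (@le_lt_trans _ _ (\int[mu]_(z in ball x rho)
    ((k `^ (2 * p))%:E * (`|u (Some z)| * sph_weight a p z)))%E).
  apply: ge0_le_integral => //.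
  - exact: measurable_mball.
  - by apply: measurable_funTS; exact: measurableT_comp.
  - by apply: measurable_funTS; exact: emeasurable_funM.
  - move=> z; rewrite ball_sphereE/= => zx.
    rewrite muleC -muleA -[leLHS]mule1 lee_wpmul2l// -EFinM lee_fin powRN mulrC.
    have h0 : 0 < 1 + mdist z a by rewrite ltr_pwDl// mdist_ge0.
    rewrite ler_pdivlMr ?powR_gt0// mul1r ge0_ler_powR ?nnegrE ?mulr_ge0 ?(ltW p0) ?(ltW h0) ?(ltW k0)//.
    rewrite kE; have := metric_triangle z x a; have := ler_norm rho; lra.
rewrite ge0_integralZl_EFin ?(ltW K0)//; last 3 first.
- exact: measurable_mball.
- by move=> z _; rewrite mule_ge0// sph_weight_ge0.
- exact: measurable_funTS.
rewrite lte_mul_pinfty ?lee_fin ?(ltW K0)//.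
have mD : measurable [set: hX] by [].
have := integral_sph_measure mD (measurableT_comp (@abse_measurable _ _) mu_) (fun y => abse_ge0 _).
move=> E; move: iu; rewrite E; apply: le_lt_trans.
apply: ge0_subset_integral => //.
- exact: measurable_mball.
- by rewrite preimage_setT.
- by move=> z _; rewrite mule_ge0// sph_weight_ge0.
Qed.

End sph_integral.

Section sphere.
Context d (R : realType) (X : borelMetricType d R) (mu : {measure set X -> \bar R}).
Variables (Q CA : R) (a : X) (p q : R).
Hypotheses (Q0 : 0 < Q) (CA1 : 1 <= CA)
  (muB : forall (x : X) (r : R), 0 < r ->
    ((CA^-1 * r `^ Q)%:E <= mu (ball x r) <= (CA * r `^ Q)%:E)%E)
  (q1 : 1 < q) (qQ : q <= Q) (qp : q <= p) (Q2p : Q < 2 * p)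
  (X_poincare : poincare_inequality mu q).
Local Notation hX := (sphericalization a).
Local Notation hmu := (sph_measure a mu p).

Let p1 : 1 < p. Proof. exact: lt_le_trans q1 qp. Qed.
Let p0 : 0 < p. Proof. exact: lt_trans p1. Qed.

(** Divide the bound of [weighted_sph_poincare] by the measure of the ball. The volume estimates
    make V^(1-1/p) / V comparable to the power -1/p of the measure of the enlarged ball, and
    [sph_diameter] turns the radius into the diameter. *)
Lemma sph_poincare : poincare_inequality hmu p.
Proof.
have [L [C [L1 C0 H]]] := weighted_sph_poincare a Q0 CA1 muB q1 qQ qp Q2p X_poincare.
have [cV cV0 HcV] := sph_ball_ge a Q0 CA1 muB p1 Q2p.
have [CV CV0 HCV] := sph_ball_le a CA1 muB p1 Q2p.
have [cD cD0 HD] := sph_diameter a Q0 CA1 muB p1 Q2p.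
have L0 : 0 < L by exact: lt_le_trans L1.
have [C' C'E C'0] : exists2 C', C' = CV * L `^ (`|2 * p - 2 * Q| + Q) & 0 < C'.
  by eexists; [reflexivity|rewrite mulr_gt0// powR_gt0].
exists (2 * C * C' `^ p^-1 / (cV * cD)), L; split => //.
  by rewrite divr_gt0 ?mulr_gt0 ?powR_gt0.
move=> x r u g r0 iu gu /=; have [mgb g0 _] := gu.
have Lr0 : 0 < L * r by rewrite mulr_gt0.
have mg := borel_measurable_fun mgb.
have V00 := sph_volume_gt0 Q p x r0.
have [V VE [Vlo Vpos]] : exists2 V, hmu (ball x r) = V%:E & cV * sph_volume Q p x r <= V /\ 0 < V.
  have := HcV x r r0; have := HCV x r r0.
  case: (hmu (ball x r)) => [v||]// _; rewrite lee_fin => h; exists v => //.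
  by split => //; apply: lt_le_trans h; rewrite mulr_gt0.
have [W WE [Whi Wpos]] : exists2 W, hmu (ball x (L * r)) = W%:E &
    W <= C' * sph_volume Q p x r /\ 0 < W.
  have := HcV x _ Lr0; have := HCV x _ Lr0.
  case: (hmu (ball x (L * r))) => [v||]//; rewrite !lee_fin => h2 h1; exists v => //; split.
    apply: (le_trans h2); rewrite C'E -mulrA ler_pM2l//; exact: sph_volume_scale.
  by apply: lt_le_trans h1; rewrite mulr_gt0// sph_volume_gt0.
have m0 : 0 < Num.min r 1 by rewrite lt_min r0 ltr01.
have Dpos : (0 < diameter (ball x r))%E.
  by apply: lt_le_trans (HD x r r0); rewrite lte_fin mulr_gt0.
have Kpos : 0 < 2 * C * C' `^ p^-1 / (cV * cD) by rewrite divr_gt0 ?mulr_gt0 ?powR_gt0.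
have mB : measurable (ball x r) by exact: measurable_mball.
have mLB : measurable (ball x (L * r)) by exact: measurable_mball.
have iuX := sph_locally_integrable p0 iu.
have guX := upper_gradient_sph gu.
have pi0 : 0 < p^-1 by rewrite invr_gt0.
rewrite [X in ((X `^ _))%E](mean_real _ Wpos WE) integral_sph_measure_power//.
set J := (\int[mu]_(x in _) _)%E.
have J0 : (0 <= J)%E by apply: integral_ge0 => z _; exact: poweR_ge0.
case JE : J J0 => [j||]// J0; last first.
  rewrite gt0_mulye ?lte_fin ?invr_gt0// poweRyr ?gt_eqF// gt0_muley ?leey//.
  by rewrite mule_gt0.
rewrite lee_fin in J0.
have step (y : R) : 0 < y -> j <= y `^ p ->
    (mean hmu (ball x r) (fun z => `|u z - mean hmu (ball x r) u|) <=
     (2 * (C * (Num.min r 1 * (sph_volume Q p x r `^ (1 - p^-1) * y))) / V)%:E)%E.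
  move=> y0 jy; have [|c Hc] := H x r y _ _ r0 y0 iuX guX.
    by rewrite -/J JE lee_fin.
  have iuB : hmu.-integrable (ball x r) u by exact: integrableS iu.
  have mu_u : measurable_fun [set: hX] u by have /integrableP[] := iu.
  have mabs (k : R) : measurable_fun (ball x r) (fun z => `|u z - k%:E|)%E.
    apply: measurable_funTS; apply: measurableT_comp => //; exact: emeasurable_funB.
  have HB : (\int[hmu]_(z in ball x r) `|u z - c%:E| <=
      (C * (Num.min r 1 * (sph_volume Q p x r `^ (1 - p^-1) * y)))%:E)%E.
    by rewrite integral_sph_measure.
  have [m mE Hm] := integral_dist_mean_le mB VE Vpos iuB HB.
  have -> : mean hmu (ball x r) u = m%:E.
    by rewrite (mean_real _ Vpos VE) mE -EFinM mulfK// gt_eqF.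
  by rewrite (mean_le _ _ Vpos VE) divfK ?gt_eqF.
(* [step] needs y > 0 while the energy j may vanish: take y slightly above j^(1/p) and let the
   excess tend to 0. *)
have lim : (mean hmu (ball x r) (fun z => `|u z - mean hmu (ball x r) u|) <=
     (2 * (C * (Num.min r 1 * (sph_volume Q p x r `^ (1 - p^-1) * j `^ p^-1))) / V)%:E)%E.
  set A := 2 * (C * (Num.min r 1 * sph_volume Q p x r `^ (1 - p^-1))) / V.
  have A0 : 0 < A by rewrite /A divr_gt0// !mulr_gt0// powR_gt0.
  have AE y : 2 * (C * (Num.min r 1 * (sph_volume Q p x r `^ (1 - p^-1) * y))) / V = A * y.
    by rewrite /A; ring.
  rewrite AE; apply/lee_addgt0Pr => e e0.
  have eA : 0 < e / A by rewrite divr_gt0.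
  have y0 : 0 < j `^ p^-1 + e / A by rewrite ltr_wpDl// powR_ge0.
  apply: (le_trans (step _ y0 _)); last by rewrite AE mulrDr mulrCA divff ?gt_eqF// mulr1 EFinD.
  have {1}-> : j = (j `^ p^-1) `^ p by rewrite -powRrM mulVf ?gt_eqF// powRr1.
  by rewrite ge0_ler_powR ?nnegrE ?(ltW p0) ?powR_ge0 ?(ltW y0)// lerDl ltW.
apply: (le_trans lim).
rewrite -EFinM poweR_EFin.
apply: (@le_trans _ _ ((2 * C * C' `^ p^-1 / (cV * cD))%:E * (cD * Num.min r 1)%:E *
  ((j / W) `^ p^-1)%:E)%E); last first.
  rewrite lee_wpmul2r ?lee_fin ?powR_ge0// lee_wpmul2l ?lee_fin ?(ltW Kpos)//; exact: HD.
rewrite -!EFinM lee_fin (@powRM _ j) ?invr_ge0 ?(ltW Wpos)// powR_invl ?(ltW Wpos)//.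
have W'0 : 0 < W `^ p^-1 by rewrite powR_gt0.
have jp0 : 0 <= j `^ p^-1 by exact: powR_ge0.
have -> : 2 * C * C' `^ p^-1 / (cV * cD) * (cD * Num.min r 1) * (j `^ p^-1 / W `^ p^-1) =
  2 * C * Num.min r 1 * j `^ p^-1 * (C' `^ p^-1 / (cV * W `^ p^-1)).
  by field; rewrite !gt_eqF.
have -> : 2 * (C * (Num.min r 1 * (sph_volume Q p x r `^ (1 - p^-1) * j `^ p^-1))) / V =
  2 * C * Num.min r 1 * j `^ p^-1 * (sph_volume Q p x r `^ (1 - p^-1) / V) by ring.
rewrite ler_wpM2l ?mulr_ge0 ?(ltW C0) ?(ltW m0)//.
rewrite ler_pdivrMr// mulrAC ler_pdivlMr ?mulr_gt0//.
have -> : sph_volume Q p x r `^ (1 - p^-1) = sph_volume Q p x r / sph_volume Q p x r `^ p^-1.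
  by rewrite powRD ?powRN ?powRr1 ?(ltW V00)// (gt_eqF V00) implybT.
have V0p : 0 < sph_volume Q p x r `^ p^-1 by rewrite powR_gt0.
have Wle : W `^ p^-1 <= C' `^ p^-1 * sph_volume Q p x r `^ p^-1.
  rewrite -powRM ?(ltW C'0) ?(ltW V00)//.
  by rewrite ge0_ler_powR ?nnegrE ?(ltW pi0) ?(ltW Wpos) ?(mulr_ge0 (ltW C'0) (ltW V00)).
rewrite [leLHS](_ : _ = (cV * sph_volume Q p x r) * (W `^ p^-1 / sph_volume Q p x r `^ p^-1)); last first.
  by ring.
rewrite [leRHS]mulrC ler_pM ?(mulr_ge0 (ltW cV0) (ltW V00)) ?divr_ge0 ?powR_ge0//.
by rewrite ler_pdivrMr.
Qed.

End sphere.


Unset Implicit Arguments.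

Theorem proposition5p1 (R : realType) (d : measure_display)
  (X : borelMetricType d R) (mu : {measure set X -> \bar R}) (Q p q : R) (a : X)
  (X_complete : forall F : set_system X, ProperFilter F -> cauchy F -> cvg F)
  (X_unbounded : forall M : R, exists x y : X, M < mdist x y)
  (mu_complete : complete_borel mu)
  (mu_ball : forall (x : X) (r : R), 0 < r -> (0 < mu (ball x r) < +oo)%E)
  (mu_regular : ahlfors_regular mu Q)
  (Q_gt1 : 1 < Q)
  (p_lt2 : Q < 2 -> 1 < p < Q / (2 - Q))
  (p_ge2 : 2 <= Q -> Q / 2 < p)
  (q_le : Q / 2 < p <= Q -> q = p)
  (q_ge : Q <= p -> q = p * Q / (2 * p - Q))
  (X_poincare : poincare_inequality mu q) :
  poincare_inequality (sph_measure a mu p) p /\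
  doubling_measure (sph_measure a mu p).

Proof.
have [CA CA1 muB] := mu_regular.
have Q0 : 0 < Q by exact: lt_trans Q_gt1.
(* For Q < 2 this follows from 2p > 2; for Q >= 2, p > Q/2 >= 1. *)
have [p1 Q2p] : 1 < p /\ Q < 2 * p.
  have [Q2|Q2] := ltP Q 2; first by have /andP[] := p_lt2 Q2; split => //; lra.
  by have := p_ge2 Q2; split; lra.
(* For p > Q, q = pQ / (2p - Q): both upper bounds reduce to Q <= p, and q > 1 means p (2 - Q) < Q,
   which is the upper bound on p when Q < 2. *)
have [q1 qQ qp] : [/\ 1 < q, q <= Q & q <= p].
  have [pQ|Qp] := leP p Q.
    have -> : q = p by apply: q_le; apply/andP; split => //; lra.
    by split => //; lra.
  have e0 : 0 < 2 * p - Q by lra.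
  rewrite (q_ge (ltW Qp)); split.
  - rewrite ltr_pdivlMr// mul1r; have [Q2|Q2] := ltP Q 2; last by nra.
    have /andP[_] := p_lt2 Q2; rewrite ltr_pdivlMr; last by lra.
    by lra.
  - rewrite ler_pdivrMr//; nra.
  - rewrite ler_pdivrMr//; nra.
split; first exact: sph_poincare Q0 CA1 muB q1 qQ qp Q2p X_poincare.
exact: sph_doubling Q0 CA1 muB p1 Q2p.
Qed.
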